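(* Let $\alpha\ge\beta\ge-\frac12$, $\alpha>-\frac12$, let $\zeta\ge0$, $1<p,q<\infty$ and $\kappa,\sigma\in\mathbb R$, and set $$\mathcal J^\zeta_{\kappa,\sigma}f(\lambda)=(\lambda^2+\zeta^2)^{-\frac\sigma2}\int_0^\infty t^{-\kappa}f(t)\varphi_\lambda(t)m(t)\,dt .$$ Suppose that there is a constant $C$ such that $$\left(\int_0^\infty|\mathcal J^\zeta_{\kappa,\sigma}f(\lambda)|^q n(\lambda)\,d\lambda\right)^{\frac1q}\le C\left(\int_0^\infty|f(t)|^p m(t)\,dt\right)^{\frac1p}$$ for all $f\in C_c^\infty(\mathbb R_+)$. Then necessarily $p\le2$. Moreover, denoting by (N) the condition $$(\mathrm N)\qquad \sigma-\kappa\ge2(\alpha+1)\left(\frac1p+\frac1q-1\right),$$ the following hold: (1) if $\zeta\ne0$, then $\kappa p'<2(\alpha+1)$ and (N); (2) if $\zeta\ne0$ and $p=2$, then $\kappa<\alpha+1$, (N), and $\kappa\ge3\left(\frac12-\frac1q\right)$; additionally, if $p=q=2$, then $0\le\kappa<\alpha+1$ and $\kappa\le\sigma$; (3) if $\zeta=0$, then $\kappa p'<2(\alpha+1)$, $\sigma q<3$ and (N); (4) if $\zeta=0$ and $p=2$, then $\kappa<\alpha+1$, (N), $\sigma q<3$, and $\sigma-\kappa\le3\left(\frac1q-\frac12\right)$; additionally, if $p=q=2$, then $\kappa=\sigma<\frac{\min\{2(\alpha+1),3\}}2$.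
   Context: Let $\rho=\alpha+\beta+1$. The Jacobi functions are $\varphi_\lambda(t)=\varphi_\lambda^{(\alpha,\beta)}(t)={}_2F_1\!\left(\frac{\rho+i\lambda}2,\frac{\rho-i\lambda}2;\alpha+1;-(\sinh t)^2\right)$, $t\ge0$, with ${}_2F_1$ the Gauss hypergeometric function. The weights are $$m(t)=(2\pi)^{-1/2}2^{2\rho}(\sinh t)^{2\alpha+1}(\cosh t)^{2\beta+1},\qquad n(\lambda)=(2\pi)^{-1/2}|\mathbf c(\lambda)|^{-2},$$ $$\mathbf c(\lambda)=\frac{2^{\rho-i\lambda}\Gamma(\alpha+1)\Gamma(i\lambda)}{\Gamma\left(\frac{\rho+i\lambda}2\right)\Gamma\left(\frac{\rho+i\lambda}2-\beta\right)}.$$ $\mathbb R_+=(0,\infty)$ and $p'=p/(p-1)$. *)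

(* Defs.v *)
From HB Require Import structures.
From mathcomp Require Import all_boot all_order all_algebra.
From mathcomp Require Import all_classical all_reals all_analysis.
From mathcomp Require Import complex.

Set Implicit Arguments.
Unset Strict Implicit.
Unset Printing Implicit Defensive.

Import Order.TTheory GRing.Theory Num.Theory.
Import numFieldNormedType.Exports.
Local Notation Re := complex.Re.
Local Notation Im := complex.Im.

Local Open Scope classical_set_scope.
Local Open Scope ring_scope.
Local Open Scope complex_scope.

Section Defs.
Variable R : realType.
Implicit Types (a b c z : R[i]) (x t lambda : R).

Definition sinh t : R := (expR t - expR (- t)) / 2.
Definition cosh t : R := (expR t + expR (- t)) / 2.

Definition cexp z : R[i] :=
  (expR (Re z))%:C * (cos (Im z) +i* sin (Im z)).

(* The principal power x ^ z, for x > 0. *)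
Definition cpow x z : R[i] := cexp (z * (ln x)%:C).

(* R[i]^o carries the topology of the complex modulus. *)

(* Gauss's product formula, valid for every z outside 0, -1, -2, ... *)
Definition Gamma z : R[i] :=
  limn ((fun n : nat => n`!%:R * cpow n%:R z / \prod_(k < n.+1) (z + k%:R))
        : nat -> R[i]^o).

Definition pochhammer z (n : nat) : R[i] := \prod_(k < n) (z + k%:R).

Definition gauss_series a b c z : nat -> R[i]^o :=
  series ((fun n : nat => pochhammer a n * pochhammer b n
                          / (pochhammer c n * n`!%:R) * z ^+ n)
          : nat -> R[i]^o).

Definition analytic_at (F : R -> R[i]) (x0 : R) : Prop :=
  exists u : nat -> R[i], \forall x \near x0,
    series ((fun n : nat => u n * ((x - x0)%:C) ^+ n) : nat -> R[i]^o) @ \oo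
      --> (F x : R[i]^o).

(* F is the analytic continuation of the Gauss series from ]-1, 1[ to the
   half-line ]-oo, 1[, i.e. the restriction to that half-line of the principal
   branch on C \ [1, +oo[; F is determined there by the identity theorem. *)
Definition is_gauss_continuation a b c (F : R -> R[i]) : Prop :=
  (forall x, `|x| < 1 -> gauss_series a b c x%:C @ \oo --> (F x : R[i]^o)) /\
  (forall x, x < 1 -> analytic_at F x).

(* Gauss's hypergeometric function 2F1(a, b; c; x) at real x < 1. *)
Definition hyp2F1 a b c x : R[i] :=
  xget 0 [set y | exists F, is_gauss_continuation a b c F /\ F x = y].

Section Jacobi.
Variables alpha beta : R.

Definition rho : R := alpha + beta + 1.

Definition jacobi_phi lambda t : R[i] :=
  hyp2F1 ((rho +i* lambda) / 2) ((rho -i* lambda) / 2) (alpha + 1)%:C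
         (- sinh t ^+ 2).

Definition jacobi_m t : R :=
  (2 * pi) `^ (- 2^-1) * 2 `^ (2 * rho) *
  sinh t `^ (2 * alpha + 1) * cosh t `^ (2 * beta + 1).

Definition jacobi_c lambda : R[i] :=
  cpow 2 (rho -i* lambda) * Gamma (alpha + 1)%:C * Gamma (lambda *i) /
  (Gamma ((rho +i* lambda) / 2) * Gamma ((rho +i* lambda) / 2 - beta%:C)).

Definition jacobi_n lambda : R :=
  (2 * pi) `^ (- 2^-1) * Normc.normc (jacobi_c lambda) ^- 2.

Definition cintegral (D : set R) (g : R -> R[i]) : R[i] :=
  (\int[lebesgue_measure]_(t in D) Re (g t)) +i*
  (\int[lebesgue_measure]_(t in D) Im (g t)).

Definition jacobi_transform (zeta kappa sigma : R) (f : R -> R[i]) lambda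
    : R[i] :=
  ((lambda ^+ 2 + zeta ^+ 2) `^ (- (sigma / 2)))%:C *
  cintegral `]0, +oo[
    (fun t => (t `^ (- kappa))%:C * f t * jacobi_phi lambda t
              * (jacobi_m t)%:C).

End Jacobi.

(* Norm of g in L^p(]0, +oo[, w dt). *)
Definition weighted_Lnorm (p : R) (w : R -> R) (g : R -> R[i]) : \bar R :=
  ((\int[lebesgue_measure]_(t in `]0%R, +oo[) (Normc.normc (g t) `^ p * w t)%:E)
     `^ p^-1)%E.

Definition smooth (g : R -> R) : Prop :=
  forall (n : nat) x, derivable (derive1n n g) x 1.

(* Elements of C_c^oo(]0, +oo[), extended by 0 to R. *)
Definition test_function (f : R -> R[i]) : Prop :=
  [/\ smooth (fun t => Re (f t)), smooth (fun t => Im (f t)) &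
      exists K : set R, [/\ compact K, K `<=` `]0, +oo[ &
        forall t, ~ K t -> f t = 0]].

End Defs.

(* Main.v *)
Require Import Defs.
From mathcomp Require Import all_boot all_order all_algebra.
From mathcomp Require Import all_classical all_reals all_analysis.
From mathcomp Require Import complex ring lra.

Set Implicit Arguments.
Unset Strict Implicit.
Unset Printing Implicit Defensive.

Import Order.TTheory GRing.Theory Num.Theory.
Import numFieldNormedType.Exports.

Local Open Scope classical_set_scope.
Local Open Scope ring_scope.

(** Why the conditions are necessary.

    All of them come from testing the inequality on the functions
    cutoff u v a b, which are comparable to t^(- a) exp (- b t) on
    [2 u, v / 2] and vanish outside ]u, v[, and from bounding the transform from
    below only at the frequencies lambda <= 1 / v, where nothing oscillates.
    Two bounds carry the argument.

    The first is phi_lambda(t) >= exp (- rho t) (1 + rho t) / 2 for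
    lambda t <= 1 (jacobi_sol_ge_half): phi_lambda is real, satisfies a second
    order equation in t, and a Sturm comparison with the equation whose drift
    2 a coth t + 2 b tanh t is replaced by its infimum at infinity gives an
    explicit minorant.  To know that phi_lambda, defined by analytic
    continuation, satisfies this equation (jacobi_phi_sol), a continuation is
    built by gluing two power series, in x near 0 and in x / (x - 1) on the
    negative half-line; the identity theorem says that every other
    continuation agrees with it (hyp2F1_eq).

    The second is n(lambda) >= c lambda^2 for lambda <= 1 and
    n(lambda) >= c lambda^(2 alpha + 1) for lambda >= 1 (jacobi_n_ge).  It is
    read off Gauss's products, in which the duplication formula replaces
    Gamma(i lambda) by factors that match those of the other two Gamma
    functions.

    With m(t) comparable to t^(2 alpha + 1) near 0 and to exp (2 rho t) at
    infinity, four families of test functions remain.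
    - Intervals of size 1 / T against frequencies of size T: scaling gives (N)
      (high_frequency_cond).
    - Intervals of size T against frequencies of size 1 / T, with
      b = 2 rho / p: the ratio of both sides contains exp (rho (1 - 2 / p) T),
      whence p <= 2, and when p = 2 the remaining power of T gives the
      conditions on kappa for zeta <> 0 and on sigma - kappa for zeta = 0
      (low_frequency_cond).
    - A fixed function against small frequencies: when zeta = 0 the integral of
      lambda^(- sigma q) lambda^2 must converge at 0, so that sigma q < 3
      (zero_frequency_cond).
    - The extremal functions t^(- kappa / (p - 1)) of Hoelder's inequality,
      truncated near 0, against frequencies of size 1: they give
      kappa p' < 2 (alpha + 1) (origin_cond).
    The other conditions of the theorem follow by arithmetic. *)

(** * Derivatives and monotonicity *)

Lemma is_derive_continuous (R : realType) (f : R -> R) (x d : R) :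
  is_derive x 1 f d -> {for x, continuous f}.
Proof. by case=> df _; apply/differentiable_continuous/derivable1_diffP. Qed.

Lemma is_derive_within (R : realType) (f df : R -> R) (a b : R) :
  (forall x, a <= x <= b -> is_derive x 1 f (df x)) ->
  {within `[a, b], continuous f}.
Proof.
move=> fdf; apply: derivable_within_continuous => x; rewrite in_itv/= => xab.
by case: (fdf x xab).
Qed.

(** The rules below are stated for functions written as lambda terms, so that the
    derivative of an explicit expression is obtained by composing proofs. *)
Lemma drv_eq (R : realType) (f : R -> R) (x a b : R) :
  is_derive x 1 f a -> a = b -> is_derive x 1 f b.
Proof. by move=> fa <-. Qed.

Lemma drv_cst (R : realType) (a x : R) : is_derive x 1 (fun=> a) 0.
Proof. exact: is_derive_cst. Qed.

Lemma drv_id (R : realType) (x : R) : is_derive x 1 (fun y : R => y) 1.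
Proof. exact: is_derive_id. Qed.

Lemma drvD (R : realType) (f g : R -> R) (x a b : R) :
  is_derive x 1 f a -> is_derive x 1 g b ->
  is_derive x 1 (fun y => f y + g y) (a + b).
Proof. by move=> fa gb; exact: is_deriveD. Qed.

Lemma drvN (R : realType) (f : R -> R) (x a : R) :
  is_derive x 1 f a -> is_derive x 1 (fun y => - f y) (- a).
Proof. by move=> fa; exact: is_deriveN. Qed.

Lemma drvB (R : realType) (f g : R -> R) (x a b : R) :
  is_derive x 1 f a -> is_derive x 1 g b ->
  is_derive x 1 (fun y => f y - g y) (a - b).
Proof. by move=> fa gb; exact: is_deriveB. Qed.

Lemma drvM (R : realType) (f g : R -> R) (x a b : R) :
  is_derive x 1 f a -> is_derive x 1 g b ->
  is_derive x 1 (fun y => f y * g y) (a * g x + f x * b).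
Proof.
move=> fa gb; apply: (drv_eq (is_deriveM fa gb)).
by rewrite addrC mulrC.
Qed.

Lemma drvZ (R : realType) (k : R) (f : R -> R) (x a : R) :
  is_derive x 1 f a -> is_derive x 1 (fun y => k * f y) (k * a).
Proof.
by move=> fa; apply: (drv_eq (drvM (drv_cst k x) fa)); rewrite mul0r add0r.
Qed.

Lemma drv_comp (R : realType) (f g : R -> R) (x a b : R) :
  is_derive x 1 g b -> is_derive (g x) 1 f a ->
  is_derive x 1 (fun y => f (g y)) (a * b).
Proof. by move=> gb fa; exact: is_derive1_comp. Qed.

Lemma drv_sqr (R : realType) (f : R -> R) (x a : R) :
  is_derive x 1 f a -> is_derive x 1 (fun y => f y ^+ 2) (2 * f x * a).
Proof.
move=> fa; rewrite (_ : (fun y => _) = (fun y => f y * f y)).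
  by apply: (drv_eq (drvM fa fa)); ring.
by apply/funext => y; rewrite expr2.
Qed.

Lemma drvV (R : realType) (f : R -> R) (x a : R) :
  is_derive x 1 f a -> f x != 0 ->
  is_derive x 1 (fun y => (f y)^-1) (- (f x) ^- 2 * a).
Proof. by move=> fa f0; apply: is_deriveV. Qed.

Lemma drv_exp (R : realType) (f : R -> R) (x a : R) :
  is_derive x 1 f a -> is_derive x 1 (fun y => expR (f y)) (expR (f x) * a).
Proof. by move=> fa; exact: drv_comp fa (is_derive_expR _). Qed.

Lemma drv_eqon (R : realType) (f g : R -> R) (U : set R) (x a : R) :
  open U -> U x -> (forall y, U y -> f y = g y) ->
  is_derive x 1 g a -> is_derive x 1 f a.
Proof.
move=> oU Ux fg; apply: near_eq_is_derive.
by have : nbhs x U by [exact: open_nbhs_nbhs]; apply: filterS => y /fg.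
Qed.

Lemma derive_le0_le (R : realType) (f df : R -> R) (a b : R) : a <= b ->
  (forall x, a <= x <= b -> is_derive x 1 f (df x)) ->
  (forall x, a < x < b -> df x <= 0) -> f b <= f a.
Proof.
move=> ab fdf df0; have := @MVT_segment R f df a b ab.
case: (ltgtP a b) ab => // [ab _|-> //] mvt.
have [] := @MVT R f df a b ab.
- by move=> x; rewrite in_itv/= => /andP[ax xb]; apply: fdf; rewrite !ltW.
- exact: is_derive_within fdf.
- move=> c; rewrite in_itv/= => cab fba.
  by rewrite -subr_le0 fba mulr_le0_ge0 ?df0// subr_ge0 ltW.
Qed.

Lemma derive_ge0_le (R : realType) (f df : R -> R) (a b : R) : a <= b ->
  (forall x, a <= x <= b -> is_derive x 1 f (df x)) ->
  (forall x, a < x < b -> 0 <= df x) -> f a <= f b.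
Proof.
move=> ab fdf df0; rewrite -lerN2.
apply: (@derive_le0_le R (fun x => - f x) (fun x => - df x)) => // x xab.
  by have ? := fdf _ xab; apply: is_deriveN.
by rewrite oppr_le0 df0.
Qed.

(** If f b > 0, let s be the last point before b with f s <= 0: between s and b
    the function is positive, hence decreases, which contradicts f s <= 0 < f b. *)
Lemma barrier (R : realType) (f df : R -> R) (b : R) : 0 <= b -> f 0 <= 0 ->
  (forall x, 0 <= x <= b -> is_derive x 1 f (df x)) ->
  (forall x, 0 < x < b -> 0 < f x -> df x <= 0) -> f b <= 0.
Proof.
move=> b0 f0 fdf df0; rewrite leNgt; apply/negP => fb.
pose S := [set x | 0 <= x <= b /\ f x <= 0].
have S0 : S 0 by split; rewrite ?lexx ?b0.
have Sb : has_sup S.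
  by split; [exists 0|exists b => x [/andP[]]].
have [s0 sb] : 0 <= sup S /\ sup S <= b.
  split; first exact: ub_le_sup (proj2 Sb) _ S0.
  by apply: ge_sup => [|x [/andP[]]//]; exists 0.
have cs : {for sup S, continuous f}.
  by apply: is_derive_continuous (fdf _ _); rewrite s0 sb.
have fs : f (sup S) <= 0.
  rewrite leNgt; apply/negP => fs.
  have /cs/nbhs_ballP[e /= e0 be] : nbhs (f (sup S)) [set y | 0 < y].
    exact: lt_nbhsr.
  have [x Sx xs] := sup_adherent e0 Sb.
  have xS : x <= sup S by apply: (ub_le_sup (proj2 Sb)).
  have bx : `|sup S - x| < e -> 0 < f x by exact: be.
  have := bx; rewrite ger0_norm ?subr_ge0// ltrBlDr -ltrBlDl => /(_ xs).
  by case: Sx => _ fx; rewrite ltNge fx.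
have fpos x : sup S < x <= b -> 0 < f x.
  move=> /andP[sx xb]; rewrite ltNge; apply/negP => fx.
  have : x <= sup S by apply: (ub_le_sup (proj2 Sb)); split=> //; rewrite xb; lra.
  by rewrite leNgt sx.
have : f b <= f (sup S).
  apply: (@derive_le0_le R f df) => // x /andP[x1 x2].
    by apply: fdf; rewrite x2 (le_trans s0).
  by apply: df0; [rewrite x2 (le_lt_trans s0)|apply: fpos; rewrite x1 ltW].
lra.
Qed.

(** * Power series *)

Lemma cvg_eqfun (V : topologicalType) (u v : nat -> V) (l : V) :
  u =1 v -> u @ \oo --> l -> v @ \oo --> l.
Proof. by move=> /funext ->. Qed.

Lemma cvgn_ge (R : realType) (u : nat -> R) (l m : R) N :
  u @ \oo --> l -> (forall n, (N <= n)%N -> m <= u n) -> m <= l.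
Proof.
move=> ul um; have <- : limn u = l by exact: cvg_lim.
apply: limr_ge; first by apply/cvg_ex; exists l.
by exists N => // n /= /um.
Qed.

Definition pbound (R : realType) (u : nat -> R) (r : R) :=
  exists M, forall n, `|u n| * r ^+ n <= M.

(** By Abel's lemma, bounded terms at all smaller radii mean a radius of
    convergence at least rho; this form passes to derived and shifted series by
    estimates on coefficients alone. *)
Definition radius_ge (R : realType) (u : nat -> R) (rho : R) :=
  forall r, 0 < r < rho -> pbound u r.

Definition psum (R : realType) (u : nat -> R) (x : R) : R := limn (pseries u x).

Definition pshift (R : realType) (u : nat -> R) (n : nat) : R :=
  if n is k.+1 then u k else 0.

Lemma pbound_cvg (R : realType) (u : nat -> R) r x :
  pbound u r -> `|x| < r -> cvgn (pseries u x).
Proof.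
move=> [M uM] xr; have r0 : 0 < r := le_lt_trans (normr_ge0 _) xr.
apply: normed_cvg.
apply: (@series_le_cvg R _ (geometric M (`|x| / r))) => [n|n|n|].
- exact: normr_ge0.
- rewrite /geometric/= mulr_ge0 ?exprn_ge0 ?divr_ge0 ?(ltW r0)//.
  by apply: le_trans (uM 0%N); rewrite expr0 mulr1.
- rewrite /geometric/= normrM normrX expr_div_n mulrA ler_pdivlMr ?exprn_gt0//.
  by rewrite mulrAC ler_wpM2r ?exprn_ge0.
- apply: is_cvg_geometric_series.
  by rewrite ger0_norm ?divr_ge0 ?(ltW r0)// ltr_pdivrMr// mul1r.
Qed.

Lemma radius_cvg (R : realType) (u : nat -> R) rho x :
  radius_ge u rho -> `|x| < rho -> pseries u x @ \oo --> psum u x.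
Proof.
move=> ur xr; have x0 := normr_ge0 x.
apply: (@pbound_cvg _ u ((`|x| + rho) / 2)); last by lra.
by apply: ur; lra.
Qed.

Lemma bernoulli_ge (R : realType) (h : R) n : 0 <= h ->
  1 + n%:R * h <= (1 + h) ^+ n.
Proof.
move=> h0; elim: n => [|n ih]; first by rewrite mul0r addr0 expr0.
rewrite exprS; apply: le_trans (_ : (1 + h) * (1 + n%:R * h) <= _).
  rewrite -natr1; have : 0 <= n%:R * h * h by rewrite !mulr_ge0.
  by move: (n%:R) => N; nra.
by rewrite ler_wpM2l// addr_ge0.
Qed.

(** The factor n + 1 gained by differentiation is absorbed by (r / s)^n, in view
    of Bernoulli's inequality. *)
Lemma pbound_diffs (R : realType) (u : nat -> R) r s :
  pbound u r -> 0 < s < r -> pbound (pseries_diffs u) s.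
Proof.
move=> [M uM] /andP[s0 sr]; have r0 := lt_trans s0 sr.
have M0 : 0 <= M by apply: le_trans (uM 0%N); rewrite expr0 mulr1.
pose h := r / s - 1.
have h0 : 0 < h by rewrite /h subr_gt0 ltr_pdivlMr// mul1r.
exists (M / r * (1 + h^-1)) => n.
have E : r ^+ n.+1 = r * s ^+ n * (1 + h) ^+ n.
  rewrite exprS -mulrA -exprMn /h; congr (_ * _ ^+ _).
  by field; rewrite lt0r_neq0.
have := uM n.+1; rewrite E /pseries_diffs normrM normr_nat => uMn.
have bn := bernoulli_ge n (ltW h0).
have h1 : n.+1%:R <= (1 + h^-1) * (1 + h) ^+ n.
  apply: le_trans (_ : (1 + h^-1) * (1 + n%:R * h) <= _); last first.
    by rewrite ler_wpM2l// addr_ge0// invr_ge0 ltW.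
  have -> : (1 + h^-1) * (1 + n%:R * h) = 1 + h^-1 + n%:R * h + n%:R.
    by field; rewrite lt0r_neq0.
  rewrite -natr1 addrC lerD2r -addrA lerDl addr_ge0 ?invr_ge0 ?(ltW h0)//.
  by rewrite mulr_ge0// ltW.
apply: le_trans (_ : (1 + h^-1) * (1 + h) ^+ n * `|u n.+1| * s ^+ n <= _).
  by rewrite ler_wpM2r ?exprn_ge0 ?(ltW s0)// ler_wpM2r.
have hi : 0 <= 1 + h^-1 by rewrite addr_ge0// invr_ge0 ltW.
apply: le_trans (_ : (1 + h^-1) * (`|u n.+1| * (r * s ^+ n * (1 + h) ^+ n)) / r <= _).
  rewrite le_eqVlt; apply/orP; left; apply/eqP.
  move: (1 + h^-1) ((1 + h) ^+ n) (s ^+ n) => a b c.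
  by field; exact: lt0r_neq0.
by rewrite [leRHS]mulrC -mulrA ler_wpM2l// ler_wpM2r// invr_ge0 ltW.
Qed.

Lemma radius_diffs (R : realType) (u : nat -> R) rho :
  radius_ge u rho -> radius_ge (pseries_diffs u) rho.
Proof.
move=> ur r rr; apply: (@pbound_diffs _ _ ((r + rho) / 2)); last by lra.
by apply: ur; lra.
Qed.

Lemma radius_shift (R : realType) (u : nat -> R) rho :
  radius_ge u rho -> radius_ge (pshift u) rho.
Proof.
move=> ur r rr; have [M uM] := ur r rr; exists (M * r) => -[|n] /=.
  rewrite normr0 mul0r mulr_ge0//; last lra.
  by apply: le_trans (uM 0%N); rewrite expr0 mulr1.
by rewrite exprS mulrCA mulrC ler_wpM2r//; lra.
Qed.

Lemma psum_shift_cvg (R : realType) (u : nat -> R) x s :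
  pseries u x @ \oo --> s -> pseries (pshift u) x @ \oo --> x * s.
Proof.
move=> us; rewrite -cvg_shiftS.
rewrite (_ : (fun n => _) = (fun n => x * pseries u x n)); first exact: cvgMl_tmp.
apply/funext => n; rewrite /pseries /series/= big_nat_recl//= mul0r add0r.
by rewrite big_distrr/=; apply: eq_bigr => i _; rewrite exprS mulrCA.
Qed.

Lemma psum_lin_cvg (R : realType) (u v : nat -> R) (a x s t : R) :
  pseries u x @ \oo --> s -> pseries v x @ \oo --> t ->
  pseries (fun n => a * u n + v n) x @ \oo --> a * s + t.
Proof.
move=> us vt.
rewrite (_ : pseries _ x = (fun n => a * pseries u x n + pseries v x n)).
  by apply: cvgD => //; exact: cvgMl_tmp.
apply/funext => n; rewrite /pseries /series/= big_distrr -big_split/=.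
by apply: eq_bigr => i _; rewrite mulrDl mulrA.
Qed.

Lemma psum_eq0 (R : realType) (u : nat -> R) (x s : R) :
  (forall n, u n = 0) -> pseries u x @ \oo --> s -> s = 0.
Proof.
move=> u0; rewrite (_ : pseries u x = (fun=> 0)); last first.
  apply/funext => n; rewrite /pseries /series/= big1// => i _.
  by rewrite u0 mul0r.
by move=> /cvg_lim <-//; rewrite lim_cst.
Qed.

Lemma psum0 (R : realType) (u : nat -> R) : psum u 0 = u 0%N.
Proof.
apply/cvg_lim => //; rewrite -cvg_shiftS.
rewrite (_ : (fun n => _) = (fun=> u 0%N)); first exact: cvg_cst.
apply/funext => n; rewrite /pseries /series/= big_nat_recl//= expr0 mulr1.
by rewrite big1 ?addr0// => i _; rewrite exprS mul0r mulr0.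
Qed.

Lemma is_derive_psum (R : realType) (u : nat -> R) (rho x : R) :
  radius_ge u rho -> `|x| < rho ->
  is_derive x 1 (psum u) (psum (pseries_diffs u) x).
Proof.
move=> ur xr; have x0 := normr_ge0 x.
pose K := (`|x| + rho) / 2.
have K0 : 0 < K by rewrite /K; lra.
have Kr : `|K| < rho by rewrite gtr0_norm// /K; lra.
apply: (@pseries_snd_diffs _ _ K).
- by have /cvgP := radius_cvg ur Kr.
- by have /cvgP := radius_cvg (radius_diffs ur) Kr.
- by have /cvgP := radius_cvg (radius_diffs (radius_diffs ur)) Kr.
- by rewrite (gtr0_norm K0) /K; lra.
Qed.

(** Induction on k: u is the derived series of the shift of u n / (n + 1). *)
Lemma radius_poly (R : realType) (u : nat -> R) (M : R) k :
  (forall n, `|u n| <= M * n.+1%:R ^+ k) -> radius_ge u 1.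
Proof.
elim: k u M => [|k ih] u M uM r /andP[r0 r1].
  exists M => n; have := uM n; rewrite expr0 mulr1 => un.
  apply: le_trans un; rewrite -[leRHS]mulr1 ler_wpM2l//.
  by rewrite exprn_ile1// ltW.
have vM n : `|u n / n.+1%:R| <= M * n.+1%:R ^+ k.
  rewrite normrM normfV normr_nat ler_pdivrMr// -mulrA -exprSr; exact: uM.
have [|M' H] := radius_diffs (radius_shift (ih _ _ vM)) (r := r); first by rewrite r0.
exists M' => n; have := H n; rewrite /pseries_diffs /pshift.
by rewrite (mulrC n.+1%:R) divfK// pnatr_eq0.
Qed.

Lemma radius_geom (R : realType) (u : nat -> R) (M L : R) : 0 < L ->
  (forall n, `|u n| <= M * L ^+ n) -> radius_ge u L^-1.
Proof.
move=> L0 uM r /andP[r0 rL]; exists M => n.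
have M0 : 0 <= M by have := le_trans (normr_ge0 _) (uM 0%N); rewrite expr0 mulr1.
apply: le_trans (_ : M * L ^+ n * r ^+ n <= _).
  by rewrite ler_wpM2r// exprn_ge0// ltW.
rewrite -mulrA -exprMn -[leRHS]mulr1 ler_wpM2l// exprn_ile1//.
  by rewrite mulr_ge0// ltW.
by rewrite -ler_pdivlMl// mulr1 ltW.
Qed.

(** * Series solutions of the hypergeometric equation *)

(** Discharges the side conditions of field: denominators that are products of
    quantities linear arithmetic proves positive. *)
Ltac pos_neq0 := repeat (apply/andP; split); apply: lt0r_neq0; lra.

Lemma psum_scale_cvg (R : realType) (u : nat -> R) (a x s : R) :
  pseries u x @ \oo --> s -> pseries (fun n => a * u n) x @ \oo --> a * s.
Proof.
move=> us; rewrite (_ : pseries _ x = (fun n => a * pseries u x n)).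
  exact: cvgMl_tmp.
apply/funext => n; rewrite /pseries /series/= big_distrr/=.
by apply: eq_bigr => i _; rewrite mulrA.
Qed.

Fixpoint rec2_pair (R : realType) (step : nat -> R -> R -> R) (a b : R) n : R * R :=
  if n is k.+1 then
    let p := rec2_pair step a b k in (p.2, step k p.1 p.2)
  else (a, b).

Definition rec2 (R : realType) (step : nat -> R -> R -> R) (a b : R) n : R :=
  (rec2_pair step a b n).1.

Lemma rec2E (R : realType) (step : nat -> R -> R -> R) (a b : R) n :
  rec2 step a b n.+2 = step n (rec2 step a b n) (rec2 step a b n.+1).
Proof. by []. Qed.

Lemma rec2_radius (R : realType) (step : nat -> R -> R -> R) (a b K : R) : 0 <= K ->
  (forall n x y, `|step n x y| <= K * (`|x| + `|y|)) ->
  radius_ge (rec2 step a b) (2 * K + 1)^-1.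
Proof.
move=> K0 stepK; set L := 2 * K + 1; have L1 : 1 <= L by rewrite /L; lra.
have L0 : 0 < L by lra.
apply: (@radius_geom _ _ (`|a| + `|b|)) => // n.
set M := `|a| + `|b|; have M0 : 0 <= M by rewrite addr_ge0.
suff : `|rec2 step a b n| <= M * L ^+ n /\ `|rec2 step a b n.+1| <= M * L ^+ n.+1.
  by case.
elim: n => [|n [ih1 ih2]].
  rewrite expr0 expr1 /rec2/= /M; split; first by rewrite mulr1 lerDl.
  apply: le_trans (_ : (`|a| + `|b|) * 1 <= _); first by rewrite mulr1 lerDr.
  by rewrite ler_wpM2l.
split=> //; rewrite rec2E; apply: le_trans (stepK _ _ _) _.
apply: le_trans (_ : K * (M * L ^+ n + M * L ^+ n.+1) <= _).
  by rewrite ler_wpM2l// lerD.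
rewrite !exprS.
have := exprn_ge0 n (ltW L0); move: (L ^+ n) => l l0.
have ML : 0 <= M * l by rewrite mulr_ge0.
have -> : K * (M * l + M * (L * l)) = (M * l) * (K * (1 + L)) by ring.
have -> : M * (L * (L * l)) = (M * l) * (L * L) by ring.
by rewrite ler_wpM2l//; rewrite /L; nra.
Qed.

(** The coefficients of 2F1(a, b; c; x) for a + b = rho and a b = nu. *)
Fixpoint gauss_coef (R : realType) (rho c nu : R) n : R :=
  if n is k.+1 then
    gauss_coef rho c nu k * ((k%:R ^+ 2 + rho * k%:R + nu) / (k.+1%:R * (k%:R + c)))
  else 1.

(** The ratio of consecutive coefficients is at most 1 + k / (n + 1) for some
    integer k, so that the coefficients grow at most like n^k. *)
Lemma gauss_coef_radius (R : realType) (rho c nu : R) :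
  0 <= rho -> 0 < c -> 0 <= nu -> radius_ge (gauss_coef rho c nu) 1.
Proof.
move=> r0 c0 n0.
have [k [kr kn]] : exists k : nat, rho <= k%:R /\ nu <= c * k%:R.
  pose x := rho + nu / c; have x0 : 0 <= x by rewrite addr_ge0// divr_ge0// ltW.
  exists (Num.trunc x).+1; have xk := ltW (truncnS_gt x).
  have rx : rho <= x by rewrite lerDl divr_ge0// ltW.
  have nx : nu / c <= x by rewrite lerDr.
  split; first exact: le_trans xk.
  by rewrite mulrC -ler_pdivrMr// (le_trans nx).
apply: (@radius_poly _ _ 1 k) => n; rewrite mul1r.
elim: n => [|n ih]; first by rewrite /= normr1 expr1n.
rewrite /= normrM; set q := (_ / _).
have d0 : 0 < n.+1%:R * (n%:R + c) :> R by rewrite mulr_gt0// ltr_wpDl.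
have q0 : 0 <= q.
  by rewrite divr_ge0 ?(ltW d0)// !addr_ge0 ?mulr_ge0 ?exprn_ge0.
have qk : q <= 1 + k%:R * n.+1%:R^-1.
  rewrite ler_pdivrMr// -natr1; set N : R := n%:R.
  have N0 : 0 <= N by rewrite ler0n.
  have -> : (1 + k%:R * (N + 1)^-1) * ((N + 1) * (N + c)) = (N + 1 + k%:R) * (N + c).
    by field; apply: lt0r_neq0; lra.
  have h1 : 0 <= (k%:R - rho) * N by rewrite mulr_ge0// subr_ge0.
  nra.
rewrite (ger0_norm q0).
apply: le_trans (_ : n.+1%:R ^+ k * (1 + n.+1%:R^-1) ^+ k <= _).
  apply: ler_pM => //; apply: (le_trans qk); apply: bernoulli_ge.
  by rewrite invr_ge0.
rewrite -exprMn mulrDr mulr1 divff ?pnatr_eq0//.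
by rewrite -[n.+2%:R]natr1.
Qed.

(** The hypergeometric equation, in the unknowns y = F(x), y' = F'(x) and
    y'' = F''(x). *)
Definition gauss_eq (R : realType) (rho c nu x y y' y'' : R) :=
  x * (1 - x) * y'' + (c - (rho + 1) * x) * y' - nu * y = 0.

(** In this lemma and its two analogues below, each term of the differential
    equation is the sum of a shifted or derived series, and the recurrence says
    that the resulting coefficients vanish. *)
Lemma gauss_psum_eq (R : realType) (rho c nu x : R) :
  0 <= rho -> 0 < c -> 0 <= nu -> `|x| < 1 ->
  let u := gauss_coef rho c nu in
  gauss_eq rho c nu x (psum u x) (psum (pseries_diffs u) x)
    (psum (pseries_diffs (pseries_diffs u)) x).
Proof.
move=> r0 c0 n0 x1 u.
have ru : radius_ge u 1 by exact: gauss_coef_radius.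
have ru1 := radius_diffs ru; have ru2 := radius_diffs ru1.
have H0 := radius_cvg ru x1; have H1 := radius_cvg ru1 x1.
have H2 := radius_cvg ru2 x1.
have XH1 := psum_shift_cvg H1; have XH2 := psum_shift_cvg H2.
have XXH2 := psum_shift_cvg XH2.
have := psum_lin_cvg (a := 1) XH2 (psum_lin_cvg (a := -1) XXH2 (psum_lin_cvg (a := c) H1
  (psum_lin_cvg (a := - (rho + 1)) XH1 (psum_scale_cvg (a := - nu) H0)))).
move=> /psum_eq0 E; rewrite /gauss_eq -[RHS]E; first by ring.
have un n : u n.+1 = u n * ((n%:R ^+ 2 + rho * n%:R + nu) / (n.+1%:R * (n%:R + c))).
  by [].
have N0 n : 0 <= n%:R :> R by rewrite ler0n.
case=> [|[|n]]; rewrite /pshift /pseries_diffs.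
- by rewrite un; field; pos_neq0.
- by rewrite (un 1%N); field; pos_neq0.
- by rewrite (un n.+2); have Nn := N0 n; field; pos_neq0.
Qed.

(** The coefficients of w |-> 2F1(a, b; c; w / (w - 1)); the differential
    equation turns into a three-term recurrence. *)
Definition pfaff_step (R : realType) (rho c nu : R) (n : nat) (a b : R) : R :=
  ((2 * (n%:R + 1) * (n%:R + c) - (rho - 1) * (n%:R + 1) - nu) * b
   - n%:R * (n%:R + c - rho) * a) / ((n%:R + 2) * (n%:R + 1 + c)).

Definition pfaff_coef (R : realType) (rho c nu : R) : nat -> R :=
  rec2 (pfaff_step rho c nu) 1 (- nu / c).

(** The difference d n of consecutive coefficients satisfies
    |d (n + 1)| <= |d n| + O(1 / n^2) |g (n + 1)|, the conditions on rho and c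
    being what bounds the factor of d n by 1.  Hence d and g grow at most
    polynomially. *)
Lemma pfaff_coef_radius (R : realType) (rho c nu : R) :
  0 <= rho -> 0 < c -> 0 <= nu -> rho <= 2 * c -> c - rho <= 1 ->
  radius_ge (pfaff_coef rho c nu) 1.
Proof.
move=> r0 c0 n0 rc cr; set g := pfaff_coef _ _ _.
pose k0 := rho + 1 + nu; have k00 : 0 <= k0 by rewrite /k0; lra.
pose k := (Num.trunc k0).+1; have kk0 : k0 <= k%:R := ltW (truncnS_gt k0).
pose M := 1 + nu / c.
have nc0 : 0 <= nu / c by rewrite divr_ge0// ltW.
have M0 : 0 <= M by rewrite /M; lra.
have gE n : g n.+2 = pfaff_step rho c nu n (g n) (g n.+1) by exact: rec2E.
have dE n : g n.+2 - g n.+1 =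
    (n%:R * (n%:R + c - rho) * (g n.+1 - g n) - k0 * g n.+1)
     / ((n%:R + 2) * (n%:R + 1 + c)).
  rewrite gE /pfaff_step /k0; have N0 : 0 <= n%:R :> R by rewrite ler0n.
  by field; apply/andP; split; apply: lt0r_neq0; lra.
suff H n : `|g n.+1 - g n| <= M * n.+1%:R ^+ k /\ `|g n.+1| <= M * n.+1%:R ^+ k.+1.
  apply: (@radius_poly _ _ M k.+1) => -[|n].
    by rewrite /g /pfaff_coef /rec2/= normr1 expr1n mulr1 /M; lra.
  have [_ /le_trans] := H n; apply; rewrite ler_wpM2l//.
  by rewrite lerXn2r ?nnegrE ?ler0n// ler_nat.
elim: n => [|n [ih1 ih2]].
  rewrite /g /pfaff_coef /rec2/= !expr1n !mulr1 mulNr normrN; split.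
    by rewrite -opprD normrN ger0_norm /M; lra.
  by rewrite ger0_norm /M; lra.
set N : R := n%:R; have N0 : 0 <= N by rewrite ler0n.
have NS : n.+1%:R = N + 1 :> R by rewrite /N natr1.
have Q : `|n%:R * (n%:R + c - rho)| <= (N + 2) * (N + 1 + c).
  rewrite normrM -/N (ger0_norm N0); apply: ler_pM => //; first lra.
  by rewrite ler_norml; apply/andP; split; lra.
have D0 : 0 < (N + 2) * (N + 1 + c) by rewrite mulr_gt0//; lra.
have P1 : `|g n.+2 - g n.+1| <= M * n.+2%:R ^+ k.
  rewrite dE normrM normfV -/N (gtr0_norm D0) ler_pdivrMr//.
  apply: le_trans (ler_normB _ _) _; rewrite normrM.
  rewrite [X in _ + X]normrM (ger0_norm k00).
  apply: le_trans (_ : (N + 2) * (N + 1 + c) * (M * n.+1%:R ^+ k) +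
     k0 * (M * n.+1%:R ^+ k.+1) <= _).
    by rewrite lerD// ?ler_wpM2l// ler_pM.
  have b1 : n.+1%:R ^+ k * (1 + k%:R * n.+1%:R^-1) <= n.+2%:R ^+ k :> R.
    apply: le_trans (_ : n.+1%:R ^+ k * (1 + n.+1%:R^-1) ^+ k <= _).
      by rewrite ler_wpM2l ?exprn_ge0//; apply: bernoulli_ge; rewrite invr_ge0.
    by rewrite -exprMn mulrDr mulr1 divff ?pnatr_eq0// -[n.+2%:R]natr1.
  have {}b1 := ler_wpM2l M0 b1.
  apply: le_trans (ler_wpM2r (ltW D0) b1).
  have E0 : 0 <= M * n.+1%:R ^+ k by rewrite mulr_ge0// exprn_ge0.
  rewrite exprS; move: E0; set e := n.+1%:R ^+ k => E0.
  have -> : (N + 2) * (N + 1 + c) * (M * e) + k0 * (M * (n.+1%:R * e)) =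
            (M * e) * ((N + 2) * (N + 1 + c) + k0 * n.+1%:R) by ring.
  have -> : M * (e * (1 + k%:R / n.+1%:R)) * ((N + 2) * (N + 1 + c)) =
    (M * e) * ((1 + k%:R / n.+1%:R) * ((N + 2) * (N + 1 + c))) by ring.
  rewrite ler_wpM2l// [leRHS]mulrDl mul1r lerD2l NS -mulrA.
  apply: ler_pM => //; first lra.
  rewrite ler_pdivlMl; last lra.
  by have := mulr_ge0 N0 (ltW c0); nra.
split=> //.
have -> : g n.+2 = (g n.+2 - g n.+1) + g n.+1 by rewrite subrK.
apply: le_trans (ler_normD _ _) _.
apply: le_trans (lerD P1 ih2) _.
rewrite -mulrDr ler_wpM2l// [leRHS]exprS -[X in X * _]natr1 mulrDl mul1r addrC lerD2r.
rewrite exprS ler_wpM2l//.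
by rewrite lerXn2r ?nnegrE ?ler0n// ler_nat.
Qed.

(** The hypergeometric equation in the variable w = x / (x - 1). *)
Definition pfaff_eq (R : realType) (rho c nu w y y' y'' : R) :=
  w * (1 - w) ^+ 2 * y'' + (c * (1 - w) ^+ 2 + (rho - 1) * w * (1 - w)) * y'
  + nu * y = 0.

Lemma pfaff_psum_eq (R : realType) (rho c nu w : R) :
  0 <= rho -> 0 < c -> 0 <= nu -> rho <= 2 * c -> c - rho <= 1 -> `|w| < 1 ->
  let u := pfaff_coef rho c nu in
  pfaff_eq rho c nu w (psum u w) (psum (pseries_diffs u) w)
    (psum (pseries_diffs (pseries_diffs u)) w).
Proof.
move=> r0 c0 n0 rc cr x1 u.
have ru : radius_ge u 1 by exact: pfaff_coef_radius.
have ru1 := radius_diffs ru; have ru2 := radius_diffs ru1.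
have H0 := radius_cvg ru x1; have H1 := radius_cvg ru1 x1.
have H2 := radius_cvg ru2 x1.
have XH1 := psum_shift_cvg H1; have XH2 := psum_shift_cvg H2.
have XXH1 := psum_shift_cvg XH1.
have XXH2 := psum_shift_cvg XH2; have XXXH2 := psum_shift_cvg XXH2.
have := psum_lin_cvg (a := 1) XH2 (psum_lin_cvg (a := -2) XXH2 (psum_lin_cvg (a := 1) XXXH2
  (psum_lin_cvg (a := c) H1 (psum_lin_cvg (a := rho - 1 - 2 * c) XH1
  (psum_lin_cvg (a := c - rho + 1) XXH1 (psum_scale_cvg (a := nu) H0)))))).
move=> /psum_eq0 E; rewrite /pfaff_eq -[RHS]E; first by ring.
have un n : u n.+2 = pfaff_step rho c nu n (u n) (u n.+1) by exact: rec2E.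
have N0 n : 0 <= n%:R :> R by rewrite ler0n.
case=> [|[|[|n]]]; rewrite /pshift /pseries_diffs.
- by rewrite /u /pfaff_coef /rec2/=; field; pos_neq0.
- by rewrite (un 0%N) /pfaff_step; field; pos_neq0.
- by rewrite (un 1%N) /pfaff_step; field; pos_neq0.
- by rewrite (un n.+2) /pfaff_step; have Nn := N0 n; field; pos_neq0.
Qed.

(** The recurrence for the coefficients of a solution of the hypergeometric
    equation in powers of x - x0. *)
Definition local_step (R : realType) (rho c nu x0 : R) (n : nat) (a b : R) : R :=
  ((n%:R * (n%:R - 1) + (rho + 1) * n%:R + nu) * a
   - ((1 - 2 * x0) * n%:R + (c - (rho + 1) * x0)) * (n%:R + 1) * b)
  / (x0 * (1 - x0) * (n%:R + 2) * (n%:R + 1)).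

Lemma local_radius (R : realType) (rho c nu x0 a b : R) :
  0 <= rho -> 0 <= nu -> x0 * (1 - x0) != 0 ->
  exists2 r, 0 < r & radius_ge (rec2 (local_step rho c nu x0) a b) r.
Proof.
move=> r0 n0 p0; pose p : R := `|x0 * (1 - x0)|.
have pp : 0 < p by rewrite normr_gt0.
pose A := 2 + rho + nu; pose B : R := `|1 - 2 * x0| + `|c - (rho + 1) * x0|.
have A0 : 0 <= A by rewrite /A; lra.
have B0 : 0 <= B by rewrite addr_ge0.
pose K := (A + B) / p.
have K0 : 0 <= K by rewrite divr_ge0 ?(ltW pp)// addr_ge0.
exists (2 * K + 1)^-1; first by rewrite invr_gt0; lra.
apply: rec2_radius => // n x y.
rewrite /local_step; set N : R := n%:R; have N0 : 0 <= N by rewrite ler0n.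
rewrite normrM normfV !normrM -/p -normrM -/p.
rewrite (ger0_norm (_ : 0 <= N + 2)); last lra.
rewrite (ger0_norm (_ : 0 <= N + 1)); last lra.
have D0 : 0 < p * (N + 2) * (N + 1) by rewrite !mulr_gt0//; lra.
rewrite ler_pdivrMr//.
have -> : K * (`|x| + `|y|) * (p * (N + 2) * (N + 1)) =
   (A + B) * ((N + 2) * (N + 1)) * (`|x| + `|y|).
  by rewrite /K; field; exact: lt0r_neq0.
apply: le_trans (ler_normB _ _) _.
rewrite [leRHS]mulrDr; apply: lerD; rewrite normrM ler_wpM2r//.
  have T0 : 0 <= N * (N - 1).
    by rewrite /N; case: (n) => [|m]; rewrite ?mul0r// -natr1 addrK mulr_ge0.
  rewrite ger0_norm; last by rewrite !addr_ge0// mulr_ge0//; lra.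
  apply: le_trans (_ : A * ((N + 2) * (N + 1)) <= _).
    by rewrite /A; nra.
  by rewrite ler_wpM2r ?lerDl// mulr_ge0; lra.
rewrite normrM (ger0_norm (_ : 0 <= N + 1)); last lra.
rewrite mulrA ler_wpM2r//; first lra.
apply: le_trans (ler_normD _ _) _; rewrite normrM (ger0_norm N0).
apply: le_trans (_ : B * (N + 2) <= _).
  rewrite /B [leRHS]mulrDl lerD//; first by rewrite ler_wpM2l//; lra.
  by rewrite -[leLHS]mulr1 ler_wpM2l//; lra.
by rewrite ler_wpM2r ?lerDr//; lra.
Qed.

Lemma local_psum_eq (R : realType) (rho c nu x0 a b r h : R) :
  0 <= rho -> 0 <= nu -> x0 * (1 - x0) != 0 ->
  let u := rec2 (local_step rho c nu x0) a b in
  radius_ge u r -> `|h| < r ->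
  gauss_eq rho c nu (x0 + h) (psum u h) (psum (pseries_diffs u) h)
    (psum (pseries_diffs (pseries_diffs u)) h).
Proof.
move=> r0 n0 p0 u ru x1.
have ru1 := radius_diffs ru; have ru2 := radius_diffs ru1.
have H0 := radius_cvg ru x1; have H1 := radius_cvg ru1 x1.
have H2 := radius_cvg ru2 x1.
have XH1 := psum_shift_cvg H1; have XH2 := psum_shift_cvg H2.
have XXH2 := psum_shift_cvg XH2.
have := psum_lin_cvg (a := x0 * (1 - x0)) H2 (psum_lin_cvg (a := 1 - 2 * x0) XH2
  (psum_lin_cvg (a := -1) XXH2 (psum_lin_cvg (a := c - (rho + 1) * x0) H1
  (psum_lin_cvg (a := - (rho + 1)) XH1 (psum_scale_cvg (a := - nu) H0))))).
move=> /psum_eq0 E; rewrite /gauss_eq -[RHS]E; first by ring.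
have un n : u n.+2 = local_step rho c nu x0 n (u n) (u n.+1) by exact: rec2E.
have [x00 x01] : x0 != 0 /\ 1 - x0 != 0 by apply/andP; rewrite -negb_or -mulf_eq0.
have N0 n : 0 <= n%:R :> R by rewrite ler0n.
case=> [|[|n]]; rewrite /pshift /pseries_diffs.
- by rewrite (un 0%N) /local_step; field; rewrite x00 x01.
- by rewrite (un 1%N) /local_step; field; rewrite x00 x01.
- rewrite (un n.+2) /local_step; have Nn := N0 n.
  by field; rewrite x00 x01 ?andbT /=; pos_neq0.
Qed.

(** * Uniqueness for linear differential equations *)

(** The energy y^2 + y1^2 multiplied by exp (- (1 + 3 K) h) decreases. *)
Lemma gronwall_right (R : realType) (y y1 y2 : R -> R) (d K : R) : 0 <= K ->
  (forall h, 0 <= h <= d -> is_derive h 1 y (y1 h)) ->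
  (forall h, 0 <= h <= d -> is_derive h 1 y1 (y2 h)) ->
  (forall h, 0 <= h <= d -> `|y2 h| <= K * (`|y h| + `|y1 h|)) ->
  y 0 = 0 -> y1 0 = 0 -> forall h, 0 <= h <= d -> y h = 0.
Proof.
move=> K0 dy dy1 y2K y00 y10 h /andP[h0 hd].
pose L := 1 + 3 * K.
pose E x := (y x ^+ 2 + y1 x ^+ 2) * expR (- (L * x)).
pose E' x := (2 * y x * y1 x + 2 * y1 x * y2 x) * expR (- (L * x)) +
  (y x ^+ 2 + y1 x ^+ 2) * (expR (- (L * x)) * - (L * 1)).
have le_d x : 0 <= x <= h -> 0 <= x <= d by lra.
have : E h <= E 0.
  apply: (@derive_le0_le R E E' 0 h h0) => x xh.
    have xd := le_d _ xh.
    exact: (drvM (drvD (drv_sqr (dy _ xd)) (drv_sqr (dy1 _ xd)))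
      (drv_exp (drvN (drvZ L (drv_id x))))).
  have xd : 0 <= x <= d by lra.
  rewrite /E'; move: (y2K x xd); move: (expR_ge0 (- (L * x))).
  move: (expR _) => e e0 yK.
  have -> : (2 * y x * y1 x + 2 * y1 x * y2 x) * e +
     (y x ^+ 2 + y1 x ^+ 2) * (e * - (L * 1)) =
     - (e * (L * (y x ^+ 2 + y1 x ^+ 2) - (2 * y x * y1 x + 2 * y1 x * y2 x))) by ring.
  rewrite oppr_le0 mulr_ge0// subr_ge0.
  have h1 : y x * y1 x <= `|y x| * `|y1 x| by rewrite -normrM ler_norm.
  have h2 : y1 x * y2 x <= `|y1 x| * (K * (`|y x| + `|y1 x|)).
    by apply: le_trans (ler_norm _) _; rewrite normrM ler_wpM2l.
  rewrite -[y x ^+ 2]real_normK ?num_real// -[y1 x ^+ 2]real_normK ?num_real//.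
  move: h1 h2; rewrite /L; move: (`|y x|) (`|y1 x|) => a b h1 h2.
  have Kab : 0 <= K * (a - b) ^+ 2 by rewrite mulr_ge0// sqr_ge0.
  have Ka : 0 <= K * a ^+ 2 by rewrite mulr_ge0// sqr_ge0.
  have := sqr_ge0 (a - b); nra.
rewrite /E y00 y10 expr0n/= addr0 mul0r pmulr_lle0 ?expR_gt0// => Eh.
apply/eqP; rewrite -sqrf_eq0 eq_le sqr_ge0 andbT.
by apply: le_trans Eh; rewrite lerDl sqr_ge0.
Qed.

Lemma gronwall (R : realType) (y y1 y2 : R -> R) (d K : R) : 0 <= K ->
  (forall h : R, `|h| <= d -> is_derive h 1 y (y1 h)) ->
  (forall h : R, `|h| <= d -> is_derive h 1 y1 (y2 h)) ->
  (forall h, `|h| <= d -> `|y2 h| <= K * (`|y h| + `|y1 h|)) ->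
  y 0 = 0 -> y1 0 = 0 -> forall h : R, `|h| <= d -> y h = 0.
Proof.
move=> K0 dy dy1 y2K y00 y10 h; rewrite ler_norml => /andP[dh hd].
have nd x : 0 <= x <= d -> `|x| <= d by move=> /andP[x0 xd]; rewrite ger0_norm.
have [h0|h0] := leP 0 h.
  by apply: (@gronwall_right R y y1 y2 d K) => // [x /nd||x /nd|]; auto; rewrite h0.
rewrite -[h]opprK.
have ndN x : 0 <= x <= d -> `|- x| <= d by rewrite normrN; exact: nd.
apply: (@gronwall_right R (fun x => y (- x)) (fun x => - y1 (- x)) (fun x => y2 (- x)) d K) => //.
- move=> x /ndN xd; apply: (drv_eq (drv_comp (drvN (drv_id x)) (dy _ xd))).
  by rewrite mulrN1.
- move=> x /ndN xd; apply: (drv_eq (drvN (drv_comp (drvN (drv_id x)) (dy1 _ xd)))).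
  by rewrite mulrN1 opprK.
- by move=> x /ndN xd; rewrite normrN; exact: y2K.
- by rewrite oppr0.
- by rewrite oppr0 y10 oppr0.
- by lra.
Qed.

(** * Solutions of the hypergeometric equation on the half-line *)

Definition gauss_sol (R : realType) (rho c nu : R) (F F1 F2 : R -> R) (U : set R) :=
  forall x, U x -> [/\ is_derive x 1 F (F1 x), is_derive x 1 F1 (F2 x) &
    gauss_eq rho c nu x (F x) (F1 x) (F2 x)].

(** Pfaff's substitution w = x / (x - 1) maps ]-oo, 1/2[ into ]-1, 1[, so that a
    power series of radius 1 in w gives a solution on the whole negative
    half-line. *)
Lemma pfaff_gauss_sol (R : realType) (rho c nu : R) (G G1 G2 : R -> R) :
  (forall w : R, `|w| < 1 -> [/\ is_derive w 1 G (G1 w), is_derive w 1 G1 (G2 w) &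
     pfaff_eq rho c nu w (G w) (G1 w) (G2 w)]) ->
  gauss_sol rho c nu (fun x => G (x / (x - 1)))
    (fun x => - (G1 (x / (x - 1)) * (x - 1) ^- 2))
    (fun x => G2 (x / (x - 1)) * (x - 1) ^- 4 + 2 * G1 (x / (x - 1)) * (x - 1) ^- 3)
    [set x | x < 2^-1].
Proof.
move=> Gsol x /= x2; have x1 : x - 1 != 0 by apply/eqP; lra.
have x1' : 0 < 1 - x by lra.
have w1 : `|x / (x - 1)| < 1.
  have -> : x / (x - 1) = - x / (1 - x) by rewrite -[x - 1]opprB invrN mulrN mulNr.
  by rewrite ltr_norml ltr_pdivlMr// ltr_pdivrMr//; lra.
have [dG dG1 eqG] := Gsol _ w1.
have dx : is_derive x 1 (fun y : R => y - 1) 1.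
  by apply: (drv_eq (drvB (drv_id x) (drv_cst 1 x))); rewrite subr0.
have dw : is_derive x 1 (fun y => y / (y - 1)) (- (x - 1) ^- 2).
  by apply: (drv_eq (drvM (drv_id x) (drvV dx x1))); field.
split.
- by apply: (drv_eq (drv_comp dw dG)); rewrite mulrN.
- have dx2 : (x - 1) ^+ 2 != 0 by rewrite expf_neq0.
  apply: (drv_eq (drvN (drvM (drv_comp dw dG1) (drvV (drv_sqr dx) dx2)))).
  by field.
- move: eqG; rewrite /pfaff_eq /gauss_eq.
  move: (G _) (G1 _) (G2 _) => g g1 g2 E.
  rewrite -[RHS]oppr0 -[in RHS]E; field.
  by rewrite x1.
Qed.

Lemma gauss_sol_eqon (R : realType) (rho c nu : R) (F G G1 G2 : R -> R) (U : set R) :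
  open U -> (forall x, U x -> F x = G x) -> gauss_sol rho c nu G G1 G2 U ->
  gauss_sol rho c nu F (derive1 F) (derive1 (derive1 F)) U.
Proof.
move=> oU FG Gs.
have dF x : U x -> is_derive x 1 F (G1 x).
  by move=> Ux; have [? _ _] := Gs _ Ux; apply: drv_eqon FG _.
have F1 x : U x -> derive1 F x = G1 x.
  by move=> Ux; rewrite derive1E; case: (dF _ Ux).
have dF1 x : U x -> is_derive x 1 (derive1 F) (G2 x).
  by move=> Ux; have [_ ? _] := Gs _ Ux; apply: drv_eqon F1 _.
have F2 x : U x -> derive1 (derive1 F) x = G2 x.
  by move=> Ux; rewrite derive1E; case: (dF1 _ Ux).
move=> x Ux; have [_ _ eG] := Gs _ Ux; rewrite (F1 x Ux) (F2 x Ux) (FG x Ux).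
by split; [exact: (dF x Ux)|exact: (dF1 x Ux)|exact: eG].
Qed.

(** ** The radial variable *)

Lemma drv_sinh (R : realType) (t : R) : is_derive t 1 (@sinh R) (cosh t).
Proof.
rewrite /sinh /cosh.
have d1 := drv_exp (drv_id t); have d2 := drv_exp (drvN (drv_id t)).
by apply: (drv_eq (drvM (drvB d1 d2) (drv_cst 2^-1 t))); ring.
Qed.

Lemma drv_cosh (R : realType) (t : R) : is_derive t 1 (@cosh R) (sinh t).
Proof.
rewrite /sinh /cosh.
have d1 := drv_exp (drv_id t); have d2 := drv_exp (drvN (drv_id t)).
by apply: (drv_eq (drvM (drvD d1 d2) (drv_cst 2^-1 t))); ring.
Qed.

Lemma cosh2 (R : realType) (t : R) : cosh t ^+ 2 = 1 + sinh t ^+ 2.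
Proof.
rewrite /sinh /cosh expRN; have : expR t != 0 by rewrite gt_eqF// expR_gt0.
by move: (expR t) => e e0; field.
Qed.

Lemma cosh_gt0 (R : realType) (t : R) : 0 < cosh t.
Proof. by rewrite /cosh divr_gt0// addr_gt0// expR_gt0. Qed.

Lemma sinh0 (R : realType) : sinh (0 : R) = 0.
Proof. by rewrite /sinh oppr0 subrr mul0r. Qed.

Lemma sinh_lt (R : realType) (s t : R) : s < t -> sinh s < sinh t.
Proof.
move=> st; rewrite /sinh ltr_pM2r ?invr_gt0//.
by rewrite ltrB// ltr_expR// ltrN2.
Qed.

Lemma sinh_le (R : realType) (s t : R) : s <= t -> sinh s <= sinh t.
Proof.
by rewrite le_eqVlt => /predU1P[->//|/sinh_lt/ltW].
Qed.

Lemma sinh_gt0 (R : realType) (t : R) : 0 < t -> 0 < sinh t.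
Proof. by move=> /sinh_lt; rewrite sinh0. Qed.

Lemma sinh_ge0 (R : realType) (t : R) : 0 <= t -> 0 <= sinh t.
Proof. by move=> /sinh_le; rewrite sinh0. Qed.

Lemma sinh_surj (R : realType) (s : R) : exists t, sinh t = s.
Proof.
pose q := Num.sqrt (s ^+ 2 + 1).
have q2 : q ^+ 2 = s ^+ 2 + 1 by rewrite sqr_sqrtr// addr_ge0// sqr_ge0.
have q0 : 0 <= q by exact: sqrtr_ge0.
have e0 : 0 < s + q by nra.
exists (ln (s + q)); rewrite /sinh expRN lnK//.
have -> : (s + q)^-1 = q - s.
  apply: (@mulfI _ (s + q)); first exact: lt0r_neq0.
  by rewrite divff ?lt0r_neq0//; nra.
by field.
Qed.

(** The equation of the Jacobi functions, with a = alpha + 1/2, b = beta + 1/2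
    and mu = lambda^2 + rho^2; it is the hypergeometric equation in the variable
    x = - sinh^2 t. *)
Definition jacobi_sol (R : realType) (a b mu : R) (f f1 f2 : R -> R) (T : set R) :=
  [/\ f 0 = 1, f1 0 = 0 & forall t, T t ->
    [/\ is_derive t 1 f (f1 t), is_derive t 1 f1 (f2 t) &
     sinh t * cosh t * f2 t +
     (2 * a * cosh t ^+ 2 + 2 * b * sinh t ^+ 2) * f1 t +
     mu * (sinh t * cosh t) * f t = 0]].

Lemma gauss_jacobi_sol (R : realType) (a b mu : R) (F F1 F2 : R -> R) (U : set R) :
  F 0 = 1 -> gauss_sol (a + b) (a + 2^-1) (mu / 4) F F1 F2 U ->
  jacobi_sol a b mu (fun t => F (- sinh t ^+ 2))
    (fun t => F1 (- sinh t ^+ 2) * - (2 * sinh t * cosh t))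
    (fun t => F2 (- sinh t ^+ 2) * (2 * sinh t * cosh t) ^+ 2 -
       2 * F1 (- sinh t ^+ 2) * (cosh t ^+ 2 + sinh t ^+ 2))
    [set t | U (- sinh t ^+ 2)].
Proof.
move=> F01 Fs; split.
- by rewrite sinh0 expr0n/= oppr0.
- by rewrite sinh0 mulr0 mul0r oppr0 mulr0.
- move=> t /= Ut; have [dF dF1 eqF] := Fs _ Ut.
  have dS := drv_sinh t; have dC := drv_cosh t.
  have dx := drvN (drv_sqr dS).
  split.
  + exact: drv_comp dx dF.
  + apply: (drv_eq (drvM (drv_comp dx dF1) (drvN (drvM (drvZ 2 dS) dC)))).
    ring.
  + move: eqF; rewrite /gauss_eq; move: (F _) (F1 _) (F2 _) => f f1 f2 E.
    have C2 := cosh2 t; move: (sinh t) (cosh t) E C2 => s k E C2.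
    have -> : s * k * (f2 * (2 * s * k) ^+ 2 - 2 * f1 * (k ^+ 2 + s ^+ 2)) +
       (2 * a * k ^+ 2 + 2 * b * s ^+ 2) * (f1 * - (2 * s * k)) +
       mu * (s * k) * f = s * k * (4 * s ^+ 2 * f2 * k ^+ 2
       - 2 * f1 * (k ^+ 2 + s ^+ 2) - 2 * (2 * a * k ^+ 2 + 2 * b * s ^+ 2) * f1
       + mu * f) by ring.
    rewrite C2.
    have -> : 4 * s ^+ 2 * f2 * (1 + s ^+ 2) - 2 * f1 * (1 + s ^+ 2 + s ^+ 2) -
       2 * (2 * a * (1 + s ^+ 2) + 2 * b * s ^+ 2) * f1 + mu * f =
       - 4 * (- s ^+ 2 * (1 - - s ^+ 2) * f2 +
         (a + 2^-1 - (a + b + 1) * - s ^+ 2) * f1 - mu / 4 * f) by field.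
    by rewrite E !mulr0.
Qed.

(** The energy f1^2 + mu f^2 of the difference of two solutions decreases from
    the value 0, since the drift coefficient is nonnegative. *)
Lemma jacobi_sol_unique (R : realType) (a b mu T : R) (f f1 f2 g g1 g2 : R -> R) :
  0 <= a -> 0 <= b -> 0 < mu ->
  jacobi_sol a b mu f f1 f2 [set t | 0 <= t <= T] ->
  jacobi_sol a b mu g g1 g2 [set t | 0 <= t <= T] ->
  forall t, 0 <= t <= T -> f t = g t.
Proof.
move=> a0 b0 mu0 [f0 f10 fs] [g0 g10 gs] t /andP[t0 tT].
pose E x := (f1 x - g1 x) ^+ 2 + mu * (f x - g x) ^+ 2.
pose E' x := 2 * (f1 x - g1 x) * (f2 x - g2 x) + mu * (2 * (f x - g x) * (f1 x - g1 x)).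
have : E t <= E 0.
  apply: (@derive_le0_le R E E' 0 t t0) => x xt; have xT : 0 <= x <= T by lra.
    have [df df1 _] := fs _ xT; have [dg dg1 _] := gs _ xT.
    exact: (drvD (drv_sqr (drvB df1 dg1)) (drvZ mu (drv_sqr (drvB df dg)))).
  have [_ _ ef] := fs _ xT; have [_ _ eg] := gs _ xT.
  have s0 : 0 < sinh x by apply: sinh_gt0; lra.
  have c0 := cosh_gt0 x.
  rewrite /E'; move: ef eg; set s := sinh x in s0 *; set c := cosh x in c0 *.
  move=> ef eg; have sc : 0 < s * c by rewrite mulr_gt0.
  rewrite -(pmulr_rle0 _ sc).
  have -> : s * c * (2 * (f1 x - g1 x) * (f2 x - g2 x) +
     mu * (2 * (f x - g x) * (f1 x - g1 x))) =
     2 * (f1 x - g1 x) * ((s * c * f2 x + mu * (s * c) * f x)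
       - (s * c * g2 x + mu * (s * c) * g x)) by ring.
  have -> : s * c * f2 x + mu * (s * c) * f x =
     - ((2 * a * c ^+ 2 + 2 * b * s ^+ 2) * f1 x).
    by apply/eqP; rewrite -addr_eq0 -[eqbRHS]ef; apply/eqP; ring.
  have -> : s * c * g2 x + mu * (s * c) * g x =
     - ((2 * a * c ^+ 2 + 2 * b * s ^+ 2) * g1 x).
    by apply/eqP; rewrite -addr_eq0 -[eqbRHS]eg; apply/eqP; ring.
  have -> : 2 * (f1 x - g1 x) * (- ((2 * a * c ^+ 2 + 2 * b * s ^+ 2) * f1 x) -
      - ((2 * a * c ^+ 2 + 2 * b * s ^+ 2) * g1 x)) =
      - (4 * (a * c ^+ 2 + b * s ^+ 2) * (f1 x - g1 x) ^+ 2) by ring.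
  by rewrite oppr_le0 mulr_ge0 ?sqr_ge0// mulr_ge0// addr_ge0// mulr_ge0// sqr_ge0.
rewrite /E f10 g10 f0 g0 !subrr expr0n/= mulr0 addr0 => Et.
apply/eqP; rewrite -subr_eq0 -sqrf_eq0 eq_le sqr_ge0 andbT.
rewrite -(pmulr_rle0 _ mu0); apply: le_trans Et.
by rewrite lerDr sqr_ge0.
Qed.

Lemma jacobi_sol_sub (R : realType) (a b mu : R) (f f1 f2 : R -> R) (T T' : set R) :
  T' `<=` T -> jacobi_sol a b mu f f1 f2 T -> jacobi_sol a b mu f f1 f2 T'.
Proof. by move=> TT' [? ? H]; split=> // t /TT'; exact: H. Qed.

(** The Gauss series covers ]-1, 1[ and the series in x / (x - 1) covers the
    negative half-line.  They agree on ]-1, 0] because in the variable t, with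
    x = - sinh^2 t, both are solutions regular at the origin. *)
Lemma gauss_global (R : realType) (a b mu : R) :
  0 < a -> 0 <= b -> b <= a -> 0 < mu ->
  exists F : R -> R, [/\ F 0 = 1,
    forall x, `|x| < 1 ->
      pseries (gauss_coef (a + b) (a + 2^-1) (mu / 4)) x @ \oo --> F x &
    gauss_sol (a + b) (a + 2^-1) (mu / 4) F (derive1 F) (derive1 (derive1 F))
      [set x | x < 1]].
Proof.
move=> a0 b0 ba mu0; set rho := a + b; set c := a + 2^-1; set nu := mu / 4.
have r0 : 0 <= rho by rewrite /rho; lra.
have c0 : 0 < c by rewrite /c; lra.
have n0 : 0 <= nu by rewrite /nu; lra.
have rc : rho <= 2 * c by rewrite /rho /c; lra.
have cr : c - rho <= 1 by rewrite /rho /c; lra.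
pose u := gauss_coef rho c nu; pose g := pfaff_coef rho c nu.
have ru : radius_ge u 1 by exact: gauss_coef_radius.
have rg : radius_ge g 1 by exact: pfaff_coef_radius.
have su : gauss_sol rho c nu (psum u) (psum (pseries_diffs u))
    (psum (pseries_diffs (pseries_diffs u))) [set x | `|x| < 1].
  move=> x /= x1; split; [exact: is_derive_psum ru x1| |exact: gauss_psum_eq].
  exact: is_derive_psum (radius_diffs ru) x1.
have := @pfaff_gauss_sol R rho c nu (psum g) (psum (pseries_diffs g))
    (psum (pseries_diffs (pseries_diffs g))).
move=> /(_ _)/wrap[|].
  move=> w w1; split; [exact: is_derive_psum rg w1| |exact: pfaff_psum_eq].
  exact: is_derive_psum (radius_diffs rg) w1.
set Fb := fun x => psum g (x / (x - 1)); set Fb1 := (X in gauss_sol _ _ _ _ X).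
set Fb2 := (X in gauss_sol _ _ _ _ _ X) => sb.
have u0 : psum u 0 = 1 by rewrite psum0.
have g0 : Fb 0 = 1 by rewrite /Fb mul0r psum0.
have agree x : -1 < x <= 0 -> Fb x = psum u x.
  move=> /andP[x1 x0]; have [t' st'] := sinh_surj (Num.sqrt (- x)).
  have [t t0 st] : exists2 t : R, 0 <= t & sinh t = Num.sqrt (- x).
    exists t' => //; rewrite leNgt; apply/negP => /sinh_lt.
    by rewrite st' sinh0 ltNge sqrtr_ge0.
  have -> : x = - sinh t ^+ 2 by rewrite st sqr_sqrtr ?opprK//; lra.
  have lt1 y : 0 <= y <= t -> `|- sinh y ^+ 2| < 1.
    move=> /andP[y0 yt]; rewrite normrN ger0_norm ?sqr_ge0//.
    apply: le_lt_trans (_ : sinh t ^+ 2 < 1).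
      by rewrite lerXn2r ?nnegrE ?sinh_ge0// sinh_le.
    by rewrite st sqr_sqrtr; lra.
  have jb := gauss_jacobi_sol (mu := mu) g0 sb.
  have ju := gauss_jacobi_sol (mu := mu) u0 su.
  apply: (jacobi_sol_unique (ltW a0) b0 mu0 (jacobi_sol_sub _ jb)
    (jacobi_sol_sub _ ju) (T := t)); last by rewrite t0 lexx.
  - by move=> y _ /=; have := sqr_ge0 (sinh y); lra.
  - by move=> y; exact: lt1.
pose F x := if x < 0 then Fb x else psum u x.
have Fu x : -1 < x < 1 -> F x = psum u x.
  by move=> /andP[x1 x2]; rewrite /F; case: ltP => // x0; rewrite agree// x1 ltW.
exists F; split.
- by rewrite Fu//; lra.
- by move=> x x1; rewrite Fu; [exact: (radius_cvg ru)|rewrite -ltr_norml].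
- move=> x /= x1; have [x0|x0] := ltP x 0.
    apply: (@gauss_sol_eqon R rho c nu F Fb Fb1 Fb2 [set x | x < 0]) => //.
    + by move=> y /= y0; rewrite /F y0.
    + by move=> y /= y0; apply: sb => /=; lra.
  apply: (@gauss_sol_eqon R rho c nu F _ _ _ [set x | `|x| < 1] _ _ su).
  + rewrite (_ : mkset _ = [set y | -1 < y] `&` [set y | y < 1]).
      by apply: openI; [exact: open_gt|exact: open_lt].
    by apply/seteqP; split => y /=; rewrite ltr_norml => /andP.
  + by move=> y /=; rewrite ltr_norml => /Fu.
  + by rewrite /= ltr_norml; lra.
Qed.

Definition real_analytic_at (R : realType) (F : R -> R) (x0 : R) : Prop :=
  exists u : nat -> R, \forall x \near x0, pseries u (x - x0) @ \oo --> F x.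

(** At a point other than the singularities 0 and 1 the equation has a power
    series solution with the same initial data, and Gronwall's inequality
    identifies it with the given one. *)
Lemma gauss_sol_analytic (R : realType) (rho c nu : R) (F F1 F2 : R -> R)
  (U : set R) (x0 : R) :
  0 <= rho -> 0 <= nu -> x0 * (1 - x0) != 0 -> nbhs x0 U ->
  gauss_sol rho c nu F F1 F2 U -> real_analytic_at F x0.
Proof.
move=> r0 n0 p0 /nbhs_ballP[e /= e0 eU] Fs.
have [r rgt0 ru] := local_radius c (F x0) (F1 x0) r0 n0 p0.
set u := rec2 _ _ _ in ru.
pose P : R := `|x0 * (1 - x0)|; have P0 : 0 < P by rewrite normr_gt0.
pose A : R := `|1 - 2 * x0| + 1; have A0 : 0 < A by rewrite ltr_wpDl.
pose d := Num.min (Num.min 1 (e / 2)) (Num.min (r / 2) (P / (2 * A))).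
have d0 : 0 < d by rewrite !lt_min ltr01/= !divr_gt0// mulr_gt0.
have [d1 de dr dP] : [/\ d <= 1, d <= e / 2, d <= r / 2 & d <= P / (2 * A)].
  by split; rewrite /d !ge_min lexx ?orbT.
have hU h : `|h| <= d -> U (x0 + h).
  by move=> hd; apply: eU; rewrite /ball/= opprD addrA subrr sub0r normrN; lra.
have hr (h : R) : `|h| <= d -> `|h| < r by move=> hd; lra.
have hp h : `|h| <= d -> P / 2 <= `|(x0 + h) * (1 - (x0 + h))|.
  move=> hd; have -> : (x0 + h) * (1 - (x0 + h)) =
    x0 * (1 - x0) - (h * (h - (1 - 2 * x0))) by ring.
  apply: le_trans (lerB_dist _ _); rewrite -/P normrM.
  suff : `|h| * `|h - (1 - 2 * x0)| <= P / (2 * A) * A.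
    have -> : P / (2 * A) * A = P / 2 by field; exact: lt0r_neq0.
    by move: (`|h| * _) => z; lra.
  apply: ler_pM => //; first exact: le_trans dP.
  by apply: le_trans (ler_normB _ _) _; rewrite /A addrC lerD2l (le_trans hd).
pose Q : R := `|c| + (rho + 1) * (`|x0| + 1).
have Q0 : 0 <= Q by rewrite addr_ge0// mulr_ge0 ?addr_ge0//; lra.
have hq h : `|h| <= d -> `|c - (rho + 1) * (x0 + h)| <= Q.
  move=> hd; apply: le_trans (ler_normB _ _) _; rewrite lerD2l normrM.
  rewrite ger0_norm; last lra.
  rewrite ler_wpM2l//; first lra.
  by apply: le_trans (ler_normD _ _) _; rewrite lerD2l (le_trans hd).
pose K := 2 * (nu + Q) / P.
have K0 : 0 <= K by rewrite divr_ge0// ?(ltW P0)//; lra.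
have ru1 := radius_diffs ru; have ru2 := radius_diffs ru1.
have dh (h : R) : is_derive h 1 (fun h : R => x0 + h) 1.
  by apply: (drv_eq (drvD (drv_cst x0 h) (drv_id h))); rewrite add0r.
have key : forall h, `|h| <= d -> psum u h - F (x0 + h) = 0.
  apply: (@gronwall R (fun h => psum u h - F (x0 + h))
    (fun h => psum (pseries_diffs u) h - F1 (x0 + h))
    (fun h => psum (pseries_diffs (pseries_diffs u)) h - F2 (x0 + h)) d K) => //.
  - move=> h hd; have [dF _ _] := Fs _ (hU _ hd).
    apply: (drv_eq (drvB (is_derive_psum ru (hr _ hd)) (drv_comp (dh h) dF))).
    by rewrite mulr1.
  - move=> h hd; have [_ dF _] := Fs _ (hU _ hd).
    apply: (drv_eq (drvB (is_derive_psum ru1 (hr _ hd)) (drv_comp (dh h) dF))).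
    by rewrite mulr1.
  - move=> h hd; have [_ _ e1] := Fs _ (hU _ hd).
    have e2 := local_psum_eq r0 n0 p0 ru (hr _ hd).
    move: e1 e2; rewrite /gauss_eq.
    move: (psum u h) (psum (pseries_diffs u) h)
      (psum (pseries_diffs (pseries_diffs u)) h) => y y1 y2.
    move: (F _) (F1 _) (F2 _) => z z1 z2 e1 e2.
    have := hp h hd; have := hq h hd; move: e1 e2.
    set p := (x0 + h) * (1 - (x0 + h)).
    set q := c - (rho + 1) * (x0 + h) => e1 e2 qQ pP.
    have E : p * (y2 - z2) = nu * (y - z) - q * (y1 - z1).
      by apply/eqP; rewrite -subr_eq0 -[eqbRHS](subrr 0) -{1}e2 -e1; apply/eqP; ring.
    have E' : `|p| * `|y2 - z2| <= (nu + Q) * (`|y - z| + `|y1 - z1|).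
      rewrite -normrM E; apply: le_trans (ler_normB _ _) _.
      rewrite !normrM (ger0_norm n0) mulrDr; apply: lerD.
        by rewrite ler_wpM2r// lerDl.
      by rewrite ler_wpM2r// (le_trans qQ)// lerDr.
    rewrite /K mulrAC ler_pdivlMr// -mulrA.
    have : P / 2 * `|y2 - z2| <= `|p| * `|y2 - z2| by rewrite ler_wpM2r.
    by move: E'; move: (`|p| * _) (_ * (_ + _)) => s t; lra.
  - by rewrite addr0 psum0 subrr.
  - by rewrite addr0 psum0 /pseries_diffs mul1r subrr.
exists u; near=> x.
have xd : `|x - x0| <= d.
  rewrite distrC; near: x; apply/nbhs_ballP; exists d => //= y.
  by rewrite /ball/= => /ltW.
have := key _ xd; rewrite [x0 + _]addrC subrK => /eqP; rewrite subr_eq0 => /eqP <-.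
by apply: radius_cvg ru _; exact: hr.
Unshelve. all: by end_near. Qed.

(** * The identity theorem *)

Lemma cvg_series0_coef0 (R : realType) (u : nat -> R) (d : R) : 0 < d ->
  (forall h : R, 0 < h < d -> pseries u h @ \oo --> (0 : R)) -> u 0%N = 0.
Proof.
move=> d0 u0.
have ru : radius_ge u d.
  move=> r rd; have /cvgP/cvg_series_bounded[M [Mr uM]] := u0 r rd.
  exists (M + 1) => n; have := uM (M + 1); rewrite ltrDl ltr01 => /(_ isT n I).
  by rewrite /= normrM normrX (gtr0_norm (proj1 (andP rd))).
have cu : {for 0, continuous (psum u)}.
  by apply: is_derive_continuous (is_derive_psum ru _); rewrite normr0.
rewrite -[LHS]psum0; apply/eqP/negPn/negP => n0.
have : \forall x \near (0 : R), psum u x != 0 by exact: (cvgr_neq0 _ cu n0).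
move=> /nbhs_ballP[e /= e0 be].
pose h := Num.min (e / 2) (d / 2).
have h0 : 0 < h by rewrite lt_min !divr_gt0.
have [he hd] : h <= e / 2 /\ h <= d / 2 by rewrite /h !ge_min !lexx orbT.
have /= := be h; rewrite /ball/= sub0r normrN gtr0_norm// => /(_ ltac:(lra)).
have hhd : 0 < h < d by rewrite h0; lra.
by have /cvg_lim := u0 h hhd; rewrite /psum => ->//; rewrite eqxx.
Qed.

Lemma cvg_series0_coefs0 (R : realType) (d : R) n (u : nat -> R) : 0 < d ->
  (forall h : R, 0 < h < d -> pseries u h @ \oo --> (0 : R)) -> u n = 0.
Proof.
move=> d0; elim: n u => [|n ih] u uh; first exact: cvg_series0_coef0 uh.
have u0 : u 0%N = 0 by exact: cvg_series0_coef0 uh.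
apply: (ih (fun n => u n.+1)) => h hd; have h0 := proj1 (andP hd).
have := uh h hd; rewrite -cvg_shiftS => /(@cvgMl_tmp _ _ _ _ _ h^-1).
rewrite mulr0; apply: cvg_eqfun => k; rewrite /pseries /series/= big_nat_recl//= u0 mul0r add0r.
rewrite big_distrr/=; apply: eq_bigr => i _.
by rewrite exprS; field; exact: lt0r_neq0.
Qed.

(** At the supremum s of the points where D does not vanish, D is the sum of a
    power series that vanishes to the right of s; its coefficients are all zero,
    so that D vanishes to the left of s as well. *)
Lemma real_identity (R : realType) (D : R -> R) :
  (forall x, x < 1 -> real_analytic_at D x) ->
  (forall x, `|x| < 1 -> D x = 0) -> forall x, x < 1 -> D x = 0.
Proof.
move=> aD D0 x1 x11; apply: contrapT => Dx1.
have x1N : x1 <= -1.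
  by rewrite leNgt; apply/negP => ?; apply/Dx1/D0; rewrite ltr_norml; lra.
pose T := [set x | x < 1 /\ D x <> 0].
have TN x : T x -> x <= -1.
  move=> [x1' Dx]; rewrite leNgt; apply/negP => ?.
  by apply/Dx/D0; rewrite ltr_norml; lra.
have sT : has_sup T by split; [exists x1|exists (-1) => x /TN].
have s1 : sup T <= -1 by apply: ge_sup => [|x /TN//]; exists x1.
have Dr x : sup T < x < 1 -> D x = 0.
  move=> /andP[sx x1']; apply: contrapT => Dx.
  have : x <= sup T by apply: (ub_le_sup (proj2 sT)).
  by rewrite leNgt sx.
have [u] := aD (sup T) ltac:(lra).
move=> /nbhs_ballP[e /= e0 eu].
have u0 n : u n = 0.
  apply: (@cvg_series0_coefs0 R (Num.min e 1)) => [|h]; first by rewrite lt_min e0 ltr01.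
  rewrite lt_min => /and3P[h0 he h1].
  have := eu (sup T + h); rewrite /ball/= opprD addrA subrr sub0r normrN gtr0_norm//.
  move=> /(_ he); rewrite [_ + h]addrC addrK Dr//.
  by lra.
have [x Tx xs] := sup_adherent e0 sT.
have xS : x <= sup T by apply: (ub_le_sup (proj2 sT)).
have := eu x; rewrite /ball/= ger0_norm ?subr_ge0// => /(_ ltac:(lra)).
by move=> /psum_eq0 => /(_ u0); case: Tx.
Qed.

(** * Complex sequences *)

Lemma normcE (R : realType) (z : R[i]) : `|z| = (Normc.normc z)%:C%C.
Proof. by rewrite normc_def; case: z. Qed.

Lemma normc_ge_abs (R : realType) (z : R[i]) :
  `|complex.Re z| <= Normc.normc z /\ `|complex.Im z| <= Normc.normc z.
Proof.
case: z => x y /=; split; rewrite -sqrtr_sqr ler_wsqrtr//.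
  by rewrite lerDl sqr_ge0.
by rewrite lerDr sqr_ge0.
Qed.

Lemma normc_le_abs (R : realType) (z : R[i]) :
  Normc.normc z <= `|complex.Re z| + `|complex.Im z|.
Proof.
case: z => x y /=; rewrite -[leRHS]ger0_norm ?addr_ge0// -sqrtr_sqr ler_wsqrtr//.
rewrite -[x ^+ 2]real_normK ?num_real// -[y ^+ 2]real_normK ?num_real//.
by have := mulr_ge0 (normr_ge0 x) (normr_ge0 y); nra.
Qed.

Lemma cvgc_normP (R : realType) (z : nat -> R[i]^o) (l : R[i]) :
  z @ \oo --> (l : R[i]^o) <->
  (forall e : R, 0 < e -> \forall n \near \oo, Normc.normc (l - z n) < e).
Proof.
split=> [zl e e0|H].
  have e0' : 0 < e%:C%C by rewrite ltcR.
  move/cvgrPdist_lt: zl => /(_ _ e0').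
  by apply: filterS => n; rewrite normcE ltcR.
apply/cvgrPdist_lt => e; rewrite ltcE/= => /andP[/eqP e1 e2].
have -> : e = (complex.Re e)%:C%C by case: e e1 {e2} => x y /= ->.
by apply: filterS (H _ e2) => n; rewrite normcE ltcR.
Qed.

Lemma cvgc_ReIm (R : realType) (z : nat -> R[i]^o) (l : R[i]) :
  z @ \oo --> (l : R[i]^o) <->
  (fun n => complex.Re (z n)) @ \oo --> complex.Re l /\
  (fun n => complex.Im (z n)) @ \oo --> complex.Im l.
Proof.
have ReB (x y : R[i]) : complex.Re (x - y) = complex.Re x - complex.Re y by case: x y => ? ? [].
have ImB (x y : R[i]) : complex.Im (x - y) = complex.Im x - complex.Im y by case: x y => ? ? [].
rewrite cvgc_normP; split=> [H|[H1 H2] e e0].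
  split; apply/cvgrPdist_lt => e e0; apply: filterS (H e e0) => n.
    by apply: le_lt_trans; rewrite -ReB; case: (normc_ge_abs (l - z n)).
  by apply: le_lt_trans; rewrite -ImB; case: (normc_ge_abs (l - z n)).
have e20 : 0 < e / 2 by rewrite divr_gt0.
move/cvgrPdist_lt: H1 => /(_ _ e20) H1; move/cvgrPdist_lt: H2 => /(_ _ e20) H2.
apply: filterS2 H1 H2 => n h1 h2.
by apply: le_lt_trans (normc_le_abs _) _; rewrite ReB ImB; lra.
Qed.

Lemma cvgc_real (R : realType) (z : nat -> R) (l : R) :
  z @ \oo --> l -> (fun n => (z n)%:C%C : R[i]^o) @ \oo --> (l%:C%C : R[i]^o).
Proof. by move=> zl; apply/cvgc_ReIm => /=; split=> //; exact: cvg_cst. Qed.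

Lemma cvgc_unique (R : realType) (z : nat -> R[i]^o) (l l' : R[i]) :
  z @ \oo --> (l : R[i]^o) -> z @ \oo --> (l' : R[i]^o) -> l = l'.
Proof.
move=> /cvgc_ReIm[r1 i1] /cvgc_ReIm[r2 i2].
have := cvg_unique (@Rhausdorff R) r1 r2; have := cvg_unique (@Rhausdorff R) i1 i2.
by case: l l' {r1 i1 r2 i2} => [? ?] [? ?] /= -> ->.
Qed.

Lemma limc (R : realType) (z : nat -> R[i]^o) (l : R[i]) :
  z @ \oo --> (l : R[i]^o) -> limn z = l.
Proof.
move=> zl; have lz : z @ \oo --> (limn z : R[i]^o) by exact: cvgP zl.
exact: cvgc_unique lz zl.
Qed.

(** * Identification of the hypergeometric function *)

Lemma ReM_real (R : realType) (z : R[i]) (x : R) :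
  complex.Re (z * x%:C%C) = complex.Re z * x /\
  complex.Im (z * x%:C%C) = complex.Im z * x.
Proof. by case: z => u v /=; rewrite !mulr0 subr0 add0r. Qed.

Lemma Re_sum (R : realType) (I : Type) (r : seq I) (z : I -> R[i]) :
  complex.Re (\sum_(i <- r) z i) = \sum_(i <- r) complex.Re (z i) /\
  complex.Im (\sum_(i <- r) z i) = \sum_(i <- r) complex.Im (z i).
Proof.
elim: r => [|i r [ih1 ih2]]; first by rewrite !big_nil.
by rewrite !big_cons -ih1 -ih2; case: (z i) (\sum_(_ <- _) _) => ? ? [].
Qed.

Lemma analytic_ReIm (R : realType) (F : R -> R[i]) (x0 : R) : analytic_at F x0 ->
  real_analytic_at (fun x => complex.Re (F x)) x0 /\
  real_analytic_at (fun x => complex.Im (F x)) x0.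
Proof.
have rX (y : R) n : (y%:C%C) ^+ n = (y ^+ n)%:C%C by rewrite rmorphXn.
move=> [u uF]; split; [exists (fun n => complex.Re (u n))|exists (fun n => complex.Im (u n))];
  apply: filterS uF => x /cvgc_ReIm[H1 H2]; [apply: cvg_eqfun H1|apply: cvg_eqfun H2] => n;
  rewrite /pseries /series/= ?(proj1 (Re_sum _ _)) ?(proj2 (Re_sum _ _));
  apply: eq_bigr => i _; rewrite rX.
  by rewrite (proj1 (ReM_real _ _)).
by rewrite (proj2 (ReM_real _ _)).
Qed.

Lemma analytic_real (R : realType) (F : R -> R) (x0 : R) :
  real_analytic_at F x0 -> analytic_at (fun x => (F x)%:C%C) x0.
Proof.
move=> [u uF]; exists (fun n => (u n)%:C%C); apply: filterS uF => x /cvgc_real.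
apply: cvg_eqfun => n.
rewrite /pseries /series/= rmorph_sum/=; apply: eq_bigr => i _.
by rewrite rmorphM rmorphXn.
Qed.

Lemma real_analyticB (R : realType) (F G : R -> R) (x0 : R) :
  real_analytic_at F x0 -> real_analytic_at G x0 ->
  real_analytic_at (fun x => F x - G x) x0.
Proof.
move=> [u uF] [v vG]; exists (fun n => -1 * v n + u n).
apply: filterS2 uF vG => x uF vG.
by rewrite (_ : F x - G x = -1 * G x + F x); [exact: psum_lin_cvg|ring].
Qed.

(** Two continuations agree by the identity theorem, so that the value of
    hyp2F1 may be computed from any of them. *)
Lemma hyp2F1_eq (R : realType) (a b c : R[i]) (F : R -> R) :
  is_gauss_continuation a b c (fun x => (F x)%:C%C) ->
  forall x, x < 1 -> hyp2F1 a b c x = (F x)%:C%C.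
Proof.
move=> FF x x1; rewrite /hyp2F1; case: xgetP => [y _ [G [[G1 G2] <-]]|/(_ (F x)%:C%C)]; last first.
  by case; exists (fun x => (F x)%:C%C).
case: FF => [F1 F2].
have FG s : `|s| < 1 -> G s = (F s)%:C%C.
  by move=> s1; exact: cvgc_unique (G1 _ s1) (F1 _ s1).
have rF s : s < 1 -> real_analytic_at F s by move=> /F2/analytic_ReIm[].
have dRe : forall y, y < 1 -> complex.Re (G y) - F y = 0.
  apply: real_identity => s s1.
    by apply: real_analyticB; [case: (analytic_ReIm (G2 _ s1))|exact: rF].
  by rewrite FG//= subrr.
have dIm : forall y, y < 1 -> complex.Im (G y) = 0.
  apply: real_identity => s s1; first by case: (analytic_ReIm (G2 _ s1)).
  by rewrite FG.
have := dRe _ x1; have := dIm _ x1; case: (G x) => /= r i -> /eqP.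
by rewrite subr_eq0 => /eqP ->.
Qed.

(** The factors (rho + i lambda) / 2 + k and (rho - i lambda) / 2 + k are
    conjugate, which is why the coefficients are real. *)
Lemma gauss_series_real (R : realType) (rho lambda c x : R) n : 0 < c ->
  gauss_series ((rho +i* lambda)%C / 2) ((rho -i* lambda)%C / 2) c%:C%C x%:C%C n =
  (pseries (gauss_coef rho c ((rho ^+ 2 + lambda ^+ 2) / 4)) x n)%:C%C.
Proof.
move=> c0; rewrite /gauss_series /pseries /series/= rmorph_sum/=.
apply: eq_bigr => i _; rewrite rmorphM rmorphXn/=; congr (_ * _).
elim: i => [|i ih]; first by rewrite /pochhammer !big_ord0 !mul1r invr1.
have cn : c%:C%C + i%:R != 0 :> R[i].
  rewrite -(rmorph_nat (real_complex R)) -rmorphD/=.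
  by rewrite fmorph_eq0 lt0r_neq0// ltr_wpDr.
rewrite /pochhammer !big_ord_recr/= -!/(pochhammer _ _) factS.
have pc : pochhammer c%:C%C i != 0.
  apply/prodf_neq0 => k _; rewrite -(rmorph_nat (real_complex R)) -rmorphD/=.
  by rewrite fmorph_eq0 lt0r_neq0// ltr_wpDr.
have num : ((rho +i* lambda)%C / 2 + i%:R) * ((rho -i* lambda)%C / 2 + i%:R) =
    (i%:R ^+ 2 + rho * i%:R + (rho ^+ 2 + lambda ^+ 2) / 4)%:C%C :> R[i].
  rewrite [(rho +i* lambda)%C]complexE [(rho -i* lambda)%C]complexE/= rmorphN/=.
  rewrite !rmorphD/= !rmorphM/= !rmorphD/= !rmorphXn/= fmorphV/= !rmorph_nat.
  have I2 := sqr_i R; move: I2; move: 'i%C rho%:C%C lambda%:C%C => I r L I2.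
  transitivity (i%:R ^+ 2 + r * i%:R + (r ^+ 2 - I ^+ 2 * L ^+ 2) / 4); first by field.
  by rewrite I2 mulN1r opprK.
have den : ((i.+1%:R * (i%:R + c))%:C%C : R[i]) = i.+1%:R * (c%:C%C + i%:R).
  by rewrite rmorphM/= rmorphD/= !rmorph_nat addrC.
rewrite -/(gauss_coef _ _ _) rmorphM/= -ih fmorph_div/= den -num natrM.
have f0 : i`!%:R != 0 :> R[i] by rewrite pnatr_eq0 -lt0n fact_gt0.
have i0 : i.+1%:R != 0 :> R[i] by rewrite pnatr_eq0.
move: (_ / 2 + _) (_ / 2 + _) (pochhammer _ _) (pochhammer _ _) (pochhammer _ _) pc.
move: (_ + _) cn (_%:R) f0 (_%:R) i0 => s s0 t t0 v v0 p q x1 x2 x3 x30.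
by field; rewrite s0 t0 v0 x30.
Qed.

(** The glued solution is analytic at 0 by its Gauss series and at any other
    point of ]-oo, 1[ as a solution of the equation, hence is a continuation. *)
Lemma jacobi_phi_sol (R : realType) (alpha beta lambda : R) :
  beta <= alpha -> - 2^-1 <= beta -> - 2^-1 < alpha ->
  exists f f1 f2 : R -> R,
   jacobi_sol (alpha + 2^-1) (beta + 2^-1) (rho alpha beta ^+ 2 + lambda ^+ 2)
     f f1 f2 setT /\
   forall t, jacobi_phi alpha beta lambda t = (f t)%:C%C.
Proof.
move=> hab hb ha; set mu := _ + lambda ^+ 2.
pose a := alpha + 2^-1; pose b := beta + 2^-1.
have rE : rho alpha beta = a + b by rewrite /rho /a /b; lra.
have a0 : 0 < a by rewrite /a; lra.
have b0 : 0 <= b by rewrite /b; lra.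
have ba : b <= a by rewrite /a /b; lra.
have mu0 : 0 < mu.
  by rewrite ltr_wpDr ?sqr_ge0// exprn_gt0// rE; lra.
have [F [F0 Fs Fd]] := gauss_global a0 b0 ba mu0.
have js := gauss_jacobi_sol (mu := mu) F0 Fd.
have sx t : - sinh t ^+ 2 < 1 by have := sqr_ge0 (sinh t); lra.
do 3!eexists; split.
  by apply: jacobi_sol_sub js => t _; exact: sx.
move=> t; apply: hyp2F1_eq; last exact: sx.
have cE : alpha + 1 = a + 2^-1 by rewrite /a; lra.
split=> [x x1|x x1].
  apply: cvg_eqfun (cvgc_real (Fs _ x1)) => n.
  by rewrite rE cE gauss_series_real -?rE//; lra.
apply: analytic_real; have [->|x0] := eqVneq x 0.
  exists (gauss_coef (a + b) (a + 2^-1) (mu / 4)); near=> y.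
  rewrite subr0; apply: Fs.
  near: y; apply/nbhs_ballP; exists 1 => //= y.
  by rewrite /ball/= sub0r normrN.
apply: (gauss_sol_analytic _ _ _ _ Fd); [lra|lra| |].
  by rewrite mulf_neq0// subr_eq0 eq_sym lt_eqF.
by apply: open_nbhs_nbhs; split; [exact: open_lt|].
Unshelve. all: by end_near. Qed.

(** * A lower bound for the Jacobi functions *)

Lemma drv_sin (R : realType) (x : R) : is_derive x 1 (@sin R) (cos x).
Proof. exact: is_derive_sin. Qed.

Lemma drv_cos (R : realType) (x : R) : is_derive x 1 (@cos R) (- sin x).
Proof. exact: is_derive_cos. Qed.

Lemma sin_le_id (R : realType) (x : R) : 0 <= x -> sin x <= x.
Proof.
move=> x0; suff : 0 - sin 0 <= x - sin x :> R by rewrite sin0; lra.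
apply: (@derive_ge0_le R (fun y => y - sin y) (fun y => 1 - cos y)) => [//|y _].
by rewrite subr_ge0 cos_le1.
Qed.

Lemma cos_ge_quad (R : realType) (x : R) : 1 - x ^+ 2 / 2 <= cos x.
Proof.
wlog x0 : x / 0 <= x => [wl|].
  have [x0|x0] := leP 0 x; first exact: wl.
  by have := wl (- x); rewrite sqrrN cosN; apply; lra.
suff : cos 0 + 0 ^+ 2 * 2^-1 <= cos x + x ^+ 2 * 2^-1.
  by rewrite cos0 expr0n/=; lra.
apply: (@derive_ge0_le R (fun y => cos y + y ^+ 2 * 2^-1)
  (fun y => - sin y + (2 * y * 1 * 2^-1 + y ^+ 2 * 0))) => // y yx.
  exact: drvD (drv_cos y) (drvM (drv_sqr (drv_id y)) (drv_cst _ y)).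
by have := @sin_le_id R y ltac:(lra); lra.
Qed.

Lemma sin_ge_half (R : realType) (x : R) : 0 <= x <= 1 -> x / 2 <= sin x.
Proof.
move=> /andP[x0 x1].
suff : sin 0 - 0 * 2^-1 <= sin x - x * 2^-1 by rewrite sin0; lra.
apply: (@derive_ge0_le R (fun y => sin y - y * 2^-1)
  (fun y => cos y - (1 * 2^-1 + y * 0))) => // y yx.
  exact: drvB (drv_sin y) (drvM (drv_id y) (drv_cst _ y)).
by have := cos_ge_quad y; nra.
Qed.

(** The left-hand side p solves the equation in which the drift coefficient
    2 a coth t + 2 b tanh t is replaced by 2 (a + b), a lower bound of it; since p
    decreases it is a subsolution, and f / p increases from 1.  The comparison
    runs through U = f (f p' - f' p), whose sign makes sense before f is known to
    be positive: U satisfies a differential inequality that forces U' <= 0 where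
    U > 0, so that it stays nonpositive. *)
Lemma jacobi_sol_ge (R : realType) (a b lambda : R) (f f1 f2 : R -> R) :
  0 < a -> 0 <= b -> b <= a -> 0 < lambda ->
  jacobi_sol a b ((a + b) ^+ 2 + lambda ^+ 2) f f1 f2 setT ->
  forall t, 0 <= t -> lambda * t <= 1 ->
  expR (- ((a + b) * t)) *
    (cos (lambda * t) + (a + b) / lambda * sin (lambda * t)) <= f t.
Proof.
move=> a0 b0 ba l0 [f0 f10 fs] t t0 lt1.
set rho := a + b; have r0 : 0 < rho by rewrite /rho; lra.
pose g := lambda + rho ^+ 2 / lambda.
have g0 : 0 < g by rewrite /g ltr_wpDr// divr_ge0 ?sqr_ge0// ltW.
have l0' : lambda != 0 by exact: lt0r_neq0.
pose e x := expR (- (rho * x)).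
pose p x := e x * (cos (lambda * x) + rho / lambda * sin (lambda * x)).
pose p1 x := - (g * e x * sin (lambda * x)).
pose p2 x := - (g * e x * (lambda * cos (lambda * x) - rho * sin (lambda * x))).
have dl (x : R) : is_derive x 1 (fun y => lambda * y) lambda.
  by apply: (drv_eq (drvZ lambda (drv_id x))); rewrite mulr1.
have de (x : R) : is_derive x 1 e (- rho * e x).
  apply: (drv_eq (drv_exp (drvN (drvZ rho (drv_id x))))).
  by rewrite /e; ring.
have ds (x : R) : is_derive x 1 (fun y => sin (lambda * y)) (cos (lambda * x) * lambda).
  exact: drv_comp (dl x) (drv_sin _).
have dc (x : R) : is_derive x 1 (fun y => cos (lambda * y)) (- sin (lambda * x) * lambda).
  exact: drv_comp (dl x) (drv_cos _).
have dp (x : R) : is_derive x 1 p (p1 x).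
  apply: (drv_eq (drvM (de x) (drvD (dc x) (drvZ (rho / lambda) (ds x))))).
  by rewrite /p1 /g; field.
have dp1 (x : R) : is_derive x 1 p1 (p2 x).
  apply: (drv_eq (drvN (drvM (drvZ g (de x)) (ds x)))).
  by rewrite /p2; ring.
have df (x : R) : is_derive x 1 f (f1 x) by case: (fs x I).
have df1 (x : R) : is_derive x 1 f1 (f2 x) by case: (fs x I).
have lx x : 0 <= x <= t -> 0 <= lambda * x <= 1.
  move=> /andP[x0 xt]; rewrite mulr_ge0 ?(ltW l0)//=.
  by apply: le_trans lt1; rewrite ler_wpM2l// ltW.
have sx x : 0 <= x <= t -> 0 <= sin (lambda * x).
  by move=> /lx xl; have := sin_ge_half xl; lra.
have p0 x : 0 <= x <= t -> 0 < p x.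
  move=> xt; rewrite mulr_gt0 ?expR_gt0// ltr_wpDr//.
    by rewrite mulr_ge0 ?sx// divr_ge0// ltW.
  have := lx _ xt; have := cos_ge_quad (lambda * x); nra.
pose U x := f x * (f x * p1 x - f1 x * p x).
pose U' x := f1 x * (f x * p1 x - f1 x * p x) +
  f x * (f1 x * p1 x + f x * p2 x - (f2 x * p x + f1 x * p1 x)).
have dU (x : R) : is_derive x 1 U (U' x).
  exact: drvM (df x) (drvB (drvM (df x) (dp1 x)) (drvM (df1 x) (dp x))).
have U0 y : 0 <= y <= t -> U y <= 0.
  move=> /andP[y0 yt]; apply: (@barrier R U U' y y0) => [|x xy Ux].
  - by rewrite /U f10 /p1 mulr0 sin0 !mulr0 oppr0 !mulr0 mul0r subr0 mulr0.
  - have xt : 0 <= x <= t by lra.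
    have S0 : 0 < sinh x by apply: sinh_gt0; lra.
    have C0 := cosh_gt0 x; have C2 := cosh2 x.
    have [_ _ eqf] := fs x I.
    have px := p0 _ xt; have sl := sx _ xt; have ex : 0 < e x := expR_gt0 _.
    move: eqf S0 C0 C2; set S := sinh x; set C := cosh x => eqf S0 C0 C2.
    have SC : S < C by nra.
    have p1x : p1 x <= 0 by rewrite oppr_le0 !mulr_ge0// ltW.
    pose Aq := 2 * a * C ^+ 2 + 2 * b * S ^+ 2.
    have Aq0 : 0 <= Aq by rewrite addr_ge0// mulr_ge0 ?sqr_ge0// mulr_ge0// ltW.
    pose W := f x * p1 x - f1 x * p x.
    (* p is a subsolution because (C - S) (a C - b S) >= 0 *)
    have src : S * C * p2 x + Aq * p1 x + (rho ^+ 2 + lambda ^+ 2) * (S * C) * p x =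
      - (2 * g * e x * sin (lambda * x) * ((C - S) * (a * C - b * S))).
      by rewrite /p /p1 /p2 /Aq /g /rho; field.
    have src0 : S * C * p2 x + Aq * p1 x + (rho ^+ 2 + lambda ^+ 2) * (S * C) * p x <= 0.
      rewrite src oppr_le0 mulr_ge0//; first by rewrite !mulr_ge0// ltW.
      rewrite mulr_ge0// subr_ge0; first exact: ltW.
      by apply: ler_pM => //; exact: ltW.
    have pos : 0 < p x * (S * C) by apply: mulr_gt0 => //; exact: mulr_gt0.
    rewrite -(pmulr_rle0 _ pos).
    have -> : p x * (S * C) * U' x = S * C * (p1 x * U x - W ^+ 2) +
      p x * (f x ^+ 2 * (S * C * p2 x + Aq * p1 x + (rho ^+ 2 + lambda ^+ 2) * (S * C) * p x)
       - Aq * U x - f x * p x *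
        (S * C * f2 x + Aq * f1 x + (rho ^+ 2 + lambda ^+ 2) * (S * C) * f x)).
      by rewrite /U' /U /W; ring.
    rewrite eqf mulr0 subr0.
    have h1 : p1 x * U x <= 0 by rewrite mulr_le0_ge0// ltW.
    have h2 : 0 <= W ^+ 2 by exact: sqr_ge0.
    have h3 : 0 <= Aq * U x by rewrite mulr_ge0// ltW.
    have h4 := mulr_ge0_le0 (sqr_ge0 (f x)) src0.
    have h5 : S * C * (p1 x * U x - W ^+ 2) <= 0.
      apply: mulr_ge0_le0; first exact: mulr_ge0 (ltW S0) (ltW C0).
      by rewrite subr_le0 (le_trans h1).
    have h6 : p x * (f x ^+ 2 * (S * C * p2 x + Aq * p1 x +
       (rho ^+ 2 + lambda ^+ 2) * (S * C) * p x) - Aq * U x) <= 0.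
      by apply: mulr_ge0_le0; [exact: ltW|rewrite subr_le0 (le_trans h4)].
    by rewrite -[leRHS]addr0 lerD.
have grow x : 0 <= x <= t -> p x <= `|f x|.
  move=> xt; have /andP[x0 x1] := xt.
  have : f 0 ^+ 2 * (p 0 ^+ 2)^-1 <= f x ^+ 2 * (p x ^+ 2)^-1.
    apply: (@derive_ge0_le R (fun y => f y ^+ 2 * (p y ^+ 2)^-1)
      (fun y => 2 * f y * f1 y * (p y ^+ 2)^-1 +
         f y ^+ 2 * (- (p y ^+ 2) ^- 2 * (2 * p y * p1 y)))) => // y yx.
      have py : p y ^+ 2 != 0 by rewrite expf_neq0// lt0r_neq0// p0//; lra.
      exact: drvM (drv_sqr (df y)) (drvV (drv_sqr (dp y)) py).
    have yt : 0 <= y <= t by lra.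
    have py := p0 _ yt.
    have -> : 2 * f y * f1 y / p y ^+ 2 + f y ^+ 2 * (- (p y ^+ 2) ^- 2 * (2 * p y * p1 y)) =
       2 * (- U y) / p y ^+ 3 by rewrite /U; field; exact: lt0r_neq0.
    by rewrite divr_ge0 ?exprn_ge0 ?(ltW py)// mulr_ge0// oppr_ge0 U0.
  rewrite f0 /p /e !mulr0 oppr0 expR0 cos0 sin0 mulr0 addr0 mulr1 expr1n invr1 mulr1.
  rewrite -/(p x) ler_pdivlMr ?exprn_gt0 ?p0// mul1r.
  rewrite -[f x ^+ 2]real_normK ?num_real//.
  by rewrite ler_pXn2r ?nnegrE// ltW// p0.
have fpos : 0 < f t.
  rewrite ltNge; apply/negP => ft.
  have [||c] := @IVT R f 0 t 0 t0.
  - by apply: is_derive_within => x _; exact: df.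
  - by rewrite f0 ge_min le_max ft ler01 orbT.
  - rewrite in_itv/= => ct fc; have := grow _ ct.
    by rewrite fc normr0 leNgt p0.
by have := grow t; rewrite t0 lexx (gtr0_norm fpos) => /(_ isT).
Qed.

(** The minorant without its dependence on lambda, from cos y >= 1/2 and
    sin y >= y / 2 on [0, 1]. *)
Lemma jacobi_sol_ge_half (R : realType) (a b lambda : R) (f f1 f2 : R -> R) :
  0 < a -> 0 <= b -> b <= a -> 0 < lambda ->
  jacobi_sol a b ((a + b) ^+ 2 + lambda ^+ 2) f f1 f2 setT ->
  forall t, 0 <= t -> lambda * t <= 1 ->
  expR (- ((a + b) * t)) * (1 + (a + b) * t) / 2 <= f t.
Proof.
move=> a0 b0 ba l0 fs t t0 lt1; have := jacobi_sol_ge a0 b0 ba l0 fs t0 lt1.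
apply: le_trans; rewrite -mulrA ler_wpM2l ?expR_ge0//.
have lt0 : 0 <= lambda * t by rewrite mulr_ge0// ltW.
rewrite mulrDl; apply: lerD.
  by have := cos_ge_quad (lambda * t); nra.
have := sin_ge_half (x := lambda * t) ltac:(lra) => s.
rewrite -[leRHS]mulrA -[leLHS]mulrA; apply: ler_wpM2l; first lra.
by rewrite ler_pdivlMl//; lra.
Qed.

(** * The Gamma function and the Plancherel density *)

Lemma normcB (R : realType) (x y : R[i]) :
  `|Normc.normc x - Normc.normc y| <= Normc.normc (x - y).
Proof.
have tri (a b : R[i]) : Normc.normc (a + b) <= Normc.normc a + Normc.normc b.
  exact: le_normcD.
have h1 := tri (x - y) y; have h2 := tri (y - x) x.
have h3 : Normc.normc (y - x) = Normc.normc (x - y) by rewrite -opprB normcN.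
rewrite !subrK in h1 h2; rewrite ler_norml; apply/andP; split; lra.
Qed.

Lemma normc_ge0 (R : realType) (x : R[i]) : 0 <= Normc.normc x.
Proof. by case: x => a b /=; rewrite sqrtr_ge0. Qed.

Lemma cvgc_normc (R : realType) (z : nat -> R[i]^o) (l : R[i]) :
  z @ \oo --> (l : R[i]^o) ->
  (fun n => Normc.normc (z n)) @ \oo --> Normc.normc l.
Proof.
move=> /cvgc_normP zl; apply/cvgrPdist_lt => e e0.
by apply: filterS (zl e e0) => n; apply: le_lt_trans; exact: normcB.
Qed.

(** Adding K / (n + 1) makes the sequence nonincreasing, subtracting it makes
    the sequence nondecreasing. *)
Lemma cvg_increments (R : realType) (r : nat -> R) (K : R) :
  (forall n, `|r n.+1 - r n| <= K * (n.+1%:R^-1 - n.+2%:R^-1)) -> cvgn r.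
Proof.
move=> rK; pose c n : R := K * n.+1%:R^-1.
have ck : c @ \oo --> (0 : R).
  by rewrite -(mulr0 K); apply: cvgMl_tmp; exact: cvg_harmonic.
have rc n : `|r n.+1 - r n| <= c n - c n.+1.
  by rewrite /c -mulrBr; exact: rK.
have inc : nonincreasing_seq (fun n => r n + c n).
  by apply/nonincreasing_seqP => n; have := rc n; rewrite ler_norml => /andP[]; lra.
have dec : nondecreasing_seq (fun n => r n - c n).
  by apply/nondecreasing_seqP => n; have := rc n; rewrite ler_norml => /andP[]; lra.
have c0 n : 0 <= c n.
  have K0 : 0 <= K.
    have := le_trans (normr_ge0 _) (rK 0%N); rewrite invr1.
    lra.
  by rewrite mulr_ge0 ?invr_ge0.
have lb : has_lbound (range (fun n => r n + c n)).
  exists (r 0%N - c 0%N) => _ [n _ <-].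
  by have := dec 0%N n (leq0n n); have := c0 n; lra.
have := nonincreasing_is_cvgn inc lb => /cvg_ex[l rl].
apply/cvg_ex; exists (l - 0); apply: cvg_eqfun (cvgB rl ck) => n.
by rewrite /= addrK.
Qed.

(** The hypothesis bounds the relative increments by O(1 / n^2), so that the
    moduli stay bounded, the real and imaginary parts have summable increments,
    and the quotients of consecutive moduli have a positive infinite product. *)
Lemma cvgc_product (R : realType) (u : nat -> R[i]^o) (K : R) : 0 <= K ->
  (forall n, u n != 0) ->
  (forall n, Normc.normc (u n.+1 - u n) <=
     K * (n.+1%:R^-1 - n.+2%:R^-1) * Normc.normc (u n)) ->
  exists2 l : R[i], u @ \oo --> (l : R[i]^o) & 0 < Normc.normc l.
Proof.
move=> K0 u0 uK; pose v n := Normc.normc (u n).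
have v0 n : 0 < v n.
  rewrite lt_neqAle normc_ge0 andbT eq_sym; apply/eqP => /Normc.eq0_normc/eqP.
  exact/negP.
pose d n : R := n.+1%:R^-1 - n.+2%:R^-1.
have d0 n : 0 <= d n by rewrite subr_ge0 lef_pV2 ?posrE// ler_nat.
have vd n : `|v n.+1 - v n| <= K * d n * v n by apply: le_trans (uK n); exact: normcB.
have vB n : v n <= v 0%N * expR (K * (1 - n.+1%:R^-1)).
  elim: n => [|n ih]; first by rewrite invr1 subrr mulr0 expR0 mulr1.
  have h1 : v n.+1 <= v n * expR (K * d n).
    have := vd n; rewrite ler_norml => /andP[_ h].
    apply: le_trans (_ : v n * (1 + K * d n) <= _); first by lra.
    by rewrite ler_wpM2l ?expR_ge1Dx// ltW.
  apply: (le_trans h1); apply: le_trans (ler_wpM2r (expR_ge0 _) ih) _.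
  rewrite -mulrA -expRD; suff -> : K * (1 - n.+1%:R^-1) + K * d n = K * (1 - n.+2%:R^-1) by [].
  by rewrite /d; ring.
pose B := v 0%N * expR K; have B0 : 0 <= B by rewrite mulr_ge0 ?expR_ge0 ?ltW.
have vB' n : v n <= B.
  apply: (le_trans (vB n)); apply: ler_wpM2l; first exact: ltW.
  by rewrite ler_expR mulrBr mulr1 lerBlDr lerDl mulr_ge0 ?invr_ge0.
have uKB n : Normc.normc (u n.+1 - u n) <= K * B * d n.
  apply: (le_trans (uK n)); rewrite -/(d n) -/(v n) [leRHS]mulrAC.
  by apply: ler_wpM2l; [exact: mulr_ge0|exact: vB'].
have ReB (x y : R[i]) : complex.Re (x - y) = complex.Re x - complex.Re y by case: x y => ? ? [].
have ImB (x y : R[i]) : complex.Im (x - y) = complex.Im x - complex.Im y by case: x y => ? ? [].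
have /cvg_ex[x cx] : cvgn (fun n => complex.Re (u n)).
  apply: (@cvg_increments _ _ (K * B)) => n; apply: le_trans (uKB n).
  by rewrite -ReB; case: (normc_ge_abs (u n.+1 - u n)).
have /cvg_ex[y cy] : cvgn (fun n => complex.Im (u n)).
  apply: (@cvg_increments _ _ (K * B)) => n; apply: le_trans (uKB n).
  by rewrite -ImB; case: (normc_ge_abs (u n.+1 - u n)).
have ul : u @ \oo --> ((x +i* y)%C : R[i]^o) by apply/cvgc_ReIm.
exists (x +i* y)%C => //.
(* from the rank N on, each factor is at least exp (- 2 K d n) *)
pose N := Num.trunc (2 * K).
have NK n : (N <= n)%N -> K * d n <= 2^-1.
  move=> Nn; have h : 2 * K <= n.+1%:R.
    by apply: le_trans (ltW (truncnS_gt _)) _; rewrite ler_nat ltnS.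
  apply: le_trans (_ : K * n.+1%:R^-1 <= _).
    by rewrite ler_wpM2l// /d lerBlDr lerDl invr_ge0.
  by rewrite ler_pdivrMr//; lra.
have vlow n : v N * expR (- (2 * K * (N.+1%:R^-1 - (n + N).+1%:R^-1))) <= v (n + N)%N.
  elim: n => [|n ih]; first by rewrite add0n subrr mulr0 oppr0 expR0 mulr1.
  have kd := NK (n + N)%N (leq_addl _ _).
  have kd0 : 0 <= K * d (n + N)%N by rewrite mulr_ge0.
  have h1 : v (n + N)%N * expR (- (2 * (K * d (n + N)%N))) <= v (n + N).+1.
    have := vd (n + N)%N; rewrite ler_norml => /andP[h _].
    apply: le_trans (_ : v (n + N)%N * (1 - K * d (n + N)%N) <= _); last by lra.
    rewrite ler_wpM2l ?(ltW (v0 _))//; move: kd kd0; move: (K * _) => s s1 s0.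
    rewrite expRN -[leRHS]invrK lef_pV2 ?posrE ?expR_gt0// ?invr_gt0; last lra.
    apply: le_trans (_ : 1 + 2 * s <= _); last exact: expR_ge1Dx.
    by rewrite -[leLHS]mul1r ler_pdivrMr; nra.
  rewrite addSn; apply: le_trans h1; apply: le_trans (ler_wpM2r (expR_ge0 _) ih).
  rewrite -[leRHS]mulrA -expRD ler_wpM2l ?(ltW (v0 _))// ler_expR /d.
  by rewrite le_eqVlt; apply/orP; left; apply/eqP; ring.
have low : v N * expR (- (2 * K)) <= Normc.normc (x +i* y)%C.
  apply: (cvgn_ge (cvgc_normc ul) (N := N)) => n Nn; have := vlow (n - N)%N; rewrite subnK//.
  apply: le_trans; rewrite ler_wpM2l ?(ltW (v0 _))// ler_expR lerN2.
  rewrite -[leRHS]mulr1 ler_wpM2l//; first lra.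
  rewrite lerBlDr; apply: le_trans (_ : 1 <= _); last by rewrite lerDl invr_ge0.
  by rewrite invf_le1// ler1n.
by apply: lt_le_trans low; rewrite mulr_gt0 ?expR_gt0.
Qed.

(** ** Gauss's product *)

Definition gamma_seq (R : realType) (z : R[i]) : nat -> R[i]^o :=
  fun n => n`!%:R * cpow n%:R z / \prod_(k < n.+1) (z + k%:R).

Lemma normc_cexp (R : realType) (z : R[i]) :
  Normc.normc (cexp z) = expR (complex.Re z).
Proof.
rewrite /cexp Normc.normcM /= expr0n/= addr0 sqrtr_sqr ger0_norm ?expR_ge0//.
by rewrite cos2Dsin2 sqrtr1 mulr1.
Qed.

Lemma normc_real (R : realType) (x : R) : Normc.normc (x%:C%C : R[i]) = `|x|.
Proof. by rewrite /= expr0n/= addr0 sqrtr_sqr. Qed.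

Lemma normc_nat (R : realType) n : Normc.normc (n%:R : R[i]) = n%:R.
Proof. by rewrite -(rmorph_nat (real_complex R)) normc_real normr_nat. Qed.

Lemma expR_lin (R : realType) (a : R) : 0 <= a ->
  0 <= expR a - 1 <= a * expR a /\ 0 <= expR a - 1 - a <= a ^+ 2 * expR a.
Proof.
move=> a0; have h1 := expR_ge1Dx a; have h2 := expR_ge1Dx (- a).
have e0 := expR_gt0 a.
have h3 : expR a - 1 <= a * expR a.
  have : (1 - a) * expR a <= 1.
    apply: le_trans (ler_wpM2r (ltW e0) h2) _.
    by rewrite expRN mulVf ?lt0r_neq0.
  by lra.
have h4 := ler_wpM2l a0 h3; split; first by apply/andP; split; lra.
by apply/andP; split; [|rewrite expr2]; lra.
Qed.

Lemma sin_sub_id (R : realType) (s : R) : `|sin s - s| <= `|s| ^+ 3.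
Proof.
wlog s0 : s / 0 <= s => [wl|].
  have [s0|s0] := leP 0 s; first exact: wl.
  by have := wl (- s); rewrite sinN -opprD !normrN; apply; lra.
have h1 := sin_le_id s0.
have h2 : s - s ^+ 3 <= sin s.
  suff : sin 0 - (0 - 0 ^+ 2 * 0) <= sin s - (s - s ^+ 2 * s) :> R.
    by rewrite sin0 -exprSr; lra.
  apply: (@derive_ge0_le R (fun y => sin y - (y - y ^+ 2 * y))
     (fun y => cos y - (1 - (2 * y * 1 * y + y ^+ 2 * 1)))) => // y ys.
    exact: drvB (drv_sin y) (drvB (drv_id y) (drvM (drv_sqr (drv_id y)) (drv_id y))).
  by have := cos_ge_quad y; have := sqr_ge0 y; lra.
by rewrite ler0_norm ?(ger0_norm s0); lra.
Qed.

Lemma cexp_lin (R : realType) (x y d : R) : 0 <= x -> 0 <= d <= 1 ->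
  Normc.normc (cexp ((x +i* y)%C * d%:C%C) - 1 - (x +i* y)%C * d%:C%C) <=
  (x ^+ 2 + y ^+ 2 + `|y| ^+ 3 + x * `|y|) * expR x * d ^+ 2.
Proof.
move=> x0 /andP[d0 d1].
have -> : (x +i* y)%C * d%:C%C = (x * d +i* (y * d))%C.
  by apply/eqP; rewrite eq_complex/=; apply/andP; split; apply/eqP; ring.
set a := x * d; set b := y * d.
have a0 : 0 <= a by rewrite mulr_ge0.
have ax : a <= x by rewrite -[leRHS]mulr1 ler_wpM2l.
have -> : cexp (a +i* b)%C - 1 - (a +i* b)%C =
   ((expR a * cos b - 1 - a) +i* (expR a * sin b - b))%C.
  by apply/eqP; rewrite eq_complex/=; apply/andP; split; apply/eqP; ring.
apply: le_trans (normc_le_abs _) _ => /=.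
have [/andP[e1 e2] /andP[e3 e4]] := expR_lin a0.
have ex : expR a <= expR x by rewrite ler_expR.
have E0 := expR_gt0 a.
have c1 : `|1 - cos b| <= b ^+ 2.
  by rewrite ger0_norm ?subr_ge0 ?cos_le1//; have := cos_ge_quad b; have := sqr_ge0 b; lra.
have h1 : `|expR a * cos b - 1 - a| <= (a ^+ 2 + b ^+ 2) * expR a.
  have -> : expR a * cos b - 1 - a = (expR a - 1 - a) - expR a * (1 - cos b) by ring.
  apply: le_trans (ler_normB _ _) _; rewrite (ger0_norm e3) mulrDl lerD//.
  by rewrite normrM (ger0_norm (ltW E0)) mulrC ler_wpM2r// ltW.
have h2 : `|expR a * sin b - b| <= (`|b| ^+ 3 + a * `|b|) * expR a.
  have -> : expR a * sin b - b = expR a * (sin b - b) + (expR a - 1) * b by ring.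
  apply: le_trans (ler_normD _ _) _; rewrite [leRHS]mulrDl lerD//.
    by rewrite normrM (ger0_norm (ltW E0)) mulrC ler_wpM2r ?(ltW E0)// sin_sub_id.
  by rewrite normrM (ger0_norm e1) mulrAC ler_wpM2r.
apply: le_trans (lerD h1 h2) _; rewrite -mulrDl [leRHS]mulrAC.
apply: ler_pM => //; try exact: ltW.
  by rewrite addr_ge0 // addr_ge0 ?sqr_ge0 ?exprn_ge0 ?mulr_ge0.
rewrite /a /b normrM (ger0_norm d0) !exprMn.
have d3 : `|y| ^+ 3 * d ^+ 3 <= `|y| ^+ 3 * d ^+ 2.
  rewrite ler_wpM2l ?exprn_ge0// exprS.
  by rewrite -[leRHS]mul1r ler_wpM2r// exprn_ge0.
lra.
Qed.

(** The quotient of consecutive terms is 1 + O(1 / n^2): to first order the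
    factor exp (z (ln (n + 1) - ln n)) cancels 1 + z / (n + 1). *)
Lemma gamma_seqS (R : realType) (z : R[i]) n : (0 < n)%N ->
  gamma_seq z n.+1 = gamma_seq z n *
    (cexp (z * (ln n.+1%:R - ln n%:R)%:C%C) * n.+1%:R / (z + n.+1%:R)).
Proof.
move=> n0; rewrite /gamma_seq factS natrM big_ord_recr/= invfM.
have -> : cpow n.+1%:R z = cpow n%:R z * cexp (z * (ln n.+1%:R - ln n%:R)%:C%C).
  rewrite /cpow; have cexpD (u v : R[i]) : cexp (u + v) = cexp u * cexp v.
    rewrite /cexp; case: u v => [u1 u2] [v1 v2] /=.
    rewrite expRD cosD sinD; apply/eqP; rewrite eq_complex/=.
    by apply/andP; split; apply/eqP; ring.
  by rewrite -cexpD -mulrDr -rmorphD/= addrC subrK.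
by ring.
Qed.

Lemma ln_incr (R : realType) n : (0 < n)%N ->
  n.+1%:R^-1 <= ln n.+1%:R - ln n%:R :> R /\ ln n.+1%:R - ln n%:R <= n%:R^-1 :> R.
Proof.
move=> n0; have nn : 0 < n%:R :> R by rewrite ltr0n.
rewrite -ln_div ?posrE//.
have E : n.+1%:R / n%:R = 1 + n%:R^-1 :> R by rewrite -natr1; field; exact: lt0r_neq0.
split; last by rewrite E le_ln1Dx// (lt_trans _ (_ : 0 < n%:R^-1)) ?invr_gt0.
rewrite -[X in ln X]invrK lnV ?posrE ?invr_gt0 ?divr_gt0// lerNr.
have -> : (n.+1%:R / n%:R)^-1 = 1 + (- n.+1%:R^-1) :> R.
  by rewrite -natr1; field; pos_neq0.
by rewrite le_ln1Dx// ltrN2 invf_lt1// ltr1n ltnS.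
Qed.

(** The imaginary axis is included for the factor Gamma(i lambda) of the
    c-function; the limit must be nonzero because values of Gamma are divided
    by in the density. *)
Lemma gamma_cvg (R : realType) (x y : R) : 0 <= x -> (x +i* y)%C != 0 ->
  gamma_seq (x +i* y)%C @ \oo --> (Gamma (x +i* y)%C : R[i]^o) /\
  0 < Normc.normc (Gamma (x +i* y)%C).
Proof.
move=> x0 z0; set z := (x +i* y)%C.
have znE n : z + n%:R = ((x + n%:R) +i* y)%C.
  by rewrite -(rmorph_nat (real_complex R)); apply/eqP; rewrite eq_complex/= addr0 !eqxx.
have zn n : z + n%:R != 0.
  rewrite znE; case: n => [|n]; first by rewrite addr0.
  rewrite eq_complex/= negb_and; apply/orP; left; apply: lt0r_neq0.
  by rewrite ltr_wpDl.
have nz n : n.+1%:R <= Normc.normc (z + n.+1%:R).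
  rewrite znE; have [h _] := normc_ge_abs ((x + n.+1%:R) +i* y)%C.
  by apply: le_trans h => /=; apply: le_trans (ler_norm _); rewrite lerDr.
pose M := (x ^+ 2 + y ^+ 2 + `|y| ^+ 3 + x * `|y|) * expR x.
have M0 : 0 <= M.
  by rewrite mulr_ge0 ?expR_ge0// !addr_ge0 ?sqr_ge0 ?exprn_ge0// mulr_ge0.
pose K := 2 * M + Normc.normc z.
have K0 : 0 <= K by have := normc_ge0 z; rewrite /K; lra.
have ce0 (w : R[i]) : cexp w != 0.
  apply/eqP => /(congr1 (@Normc.normc R)); rewrite normc_cexp Normc.normc0.
  by move/eqP; rewrite gt_eqF ?expR_gt0.
pose u n : R[i]^o := gamma_seq z n.+1.
have u0 n : u n != 0.
  rewrite /u /gamma_seq; apply: mulf_neq0.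
    by apply: mulf_neq0; [rewrite pnatr_eq0 -lt0n fact_gt0|exact: ce0].
  by rewrite invr_neq0//; apply/prodf_neq0 => k _; exact: zn.
have uK n : Normc.normc (u n.+1 - u n) <=
     K * (n.+1%:R^-1 - n.+2%:R^-1) * Normc.normc (u n).
  rewrite /u gamma_seqS//; set g := gamma_seq z n.+1.
  have [l1 l2] := @ln_incr R n.+1 isT.
  set d := ln n.+2%:R - ln n.+1%:R in l1 l2 *; clearbody d.
  have d01 : 0 <= d <= 1.
    rewrite (le_trans _ l1)/= ?invr_ge0// (le_trans l2)// invf_le1// ler1n//.
  set D : R := n.+1%:R^-1 - n.+2%:R^-1.
  have DE : D = (n.+1%:R * n.+2%:R)^-1.
    rewrite /D -[n.+2%:R]natr1; have : 0 < n.+1%:R :> R by [].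
    move: (n.+1%:R) => m m0; field; pos_neq0.
  have D0 : 0 <= D by rewrite DE invr_ge0 mulr_ge0.
  have cl := @cexp_lin R x y d x0 d01.
  rewrite -/z -/M in cl.
  have z1 := zn n.+2.
  have -> : g * (cexp (z * d%:C%C) * n.+2%:R / (z + n.+2%:R)) - g =
    ((cexp (z * d%:C%C) - 1 - z * d%:C%C) + z * (d - n.+2%:R^-1)%:C%C)
      * (n.+2%:R / (z + n.+2%:R)) * g.
    rewrite rmorphB/= fmorphV/= rmorph_nat.
    have : n.+2%:R != 0 :> R[i] by rewrite pnatr_eq0.
    move: z1; move: (n.+2%:R) (d%:C%C) (cexp _) => N d' w zN N0.
    by field; rewrite N0 zN.
  rewrite Normc.normcM ler_wpM2r ?normc_ge0// Normc.normcM.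
  have f1 : Normc.normc (n.+2%:R / (z + n.+2%:R)) <= 1.
    rewrite Normc.normcM Normc.normcV normc_nat ler_pdivrMr ?mul1r; first exact: nz.
    by apply: lt_le_trans (nz n.+1).
  rewrite -[leRHS]mulr1; apply: ler_pM; rewrite ?normc_ge0//.
  apply: le_trans (le_normcD _ _) _.
  have dd : d ^+ 2 <= 2 * D.
    apply: le_trans (_ : n.+1%:R^-1 ^+ 2 <= _).
      by rewrite lerXn2r ?nnegrE ?invr_ge0//; case/andP: d01.
    rewrite DE invfM expr2 mulrCA ler_wpM2l ?invr_ge0//.
    rewrite ler_pdivlMr// mulrC ler_pdivrMr//.
    by rewrite -natrM ler_nat mul2n -addnn addnS ltnS leq_addr.
  have h1 := le_trans cl (ler_wpM2l M0 dd).
  have h2 : Normc.normc (z * (d - n.+2%:R^-1)%:C%C) <= Normc.normc z * D.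
    rewrite Normc.normcM normc_real ler_wpM2l ?normc_ge0// ger0_norm ?subr_ge0//.
    by rewrite lerB.
  by apply: le_trans (lerD h1 h2) _; rewrite /K; lra.
have [l ul l0] := cvgc_product K0 u0 uK.
have gl : gamma_seq z @ \oo --> (l : R[i]^o) by rewrite -cvg_shiftS.
have -> : Gamma z = l by exact: limc gl.
by [].
Qed.

Lemma normc_gamma_seq (R : realType) (x y : R) n :
  Normc.normc (gamma_seq (x +i* y)%C n) ^+ 2 =
  (n`!%:R * expR (x * ln n%:R)) ^+ 2 / \prod_(k < n.+1) ((x + k%:R) ^+ 2 + y ^+ 2).
Proof.
rewrite /gamma_seq Normc.normcM Normc.normcV [Normc.normc (n`!%:R * _)]Normc.normcM.
rewrite normc_nat /cpow normc_cexp exprMn exprVn.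
congr ((_ * expR _) ^+ 2 / _) => /=.
  by rewrite mulr0 subr0.
elim: n.+1 => [|m ih]; first by rewrite !big_ord0 Normc.normc1 expr1n.
rewrite !big_ord_recr/= Normc.normcM exprMn ih; congr (_ * _).
rewrite -(rmorph_nat (real_complex R)).
have -> : (x +i* y)%C + (m%:R)%:C%C = ((x + m%:R) +i* y)%C.
  by apply/eqP; rewrite eq_complex/= addr0 !eqxx.
by rewrite /= sqr_sqrtr// addr_ge0 ?sqr_ge0.
Qed.

(** ** A lower bound for the density n *)

Definition gprod (R : realType) (x y : R) n : R :=
  \prod_(k < n) ((x + k%:R) ^+ 2 + y ^+ 2).

Lemma gprod_gt0 (R : realType) (x y : R) n : y != 0 -> 0 < gprod x y n.
Proof.
move=> y0; apply: prodr_gt0 => k _; rewrite ltr_wpDl ?sqr_ge0//.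
by rewrite lt_neqAle sqr_ge0 andbT eq_sym sqrf_eq0.
Qed.

(** The quotient of (x + d + k)^2 + y^2 by (x + k)^2 + y^2 is
    1 + 2 d k / (k^2 + y^2) + O(1 / k^2) uniformly in y, and the increments of
    ln (k^2 + y^2) are 2 k / (k^2 + y^2) up to O(1 / k^2).  The last term of the
    exponent is a telescoping majorant of the errors. *)
Lemma gprod_ratio (R : realType) (x d y : R) n : 0 <= x -> 0 <= d ->
  gprod (x + d + 1) y n <= gprod (x + 1) y n *
   expR (d * (ln (n.+1%:R ^+ 2 + y ^+ 2) - ln (1 + y ^+ 2)) +
     2 * d * (2 * x + d + 4) * (1 - n.+1%:R^-1)).
Proof.
move=> x0 d0; set C := 2 * d * (2 * x + d + 4).
have y2 : 0 <= y ^+ 2 := sqr_ge0 y.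
have g0 z m : 0 <= gprod z y m.
  by apply: prodr_ge0 => k _; rewrite addr_ge0// sqr_ge0.
elim: n => [|n ih].
  by rewrite /gprod !big_ord0 expr1n invr1 !subrr !mulr0 addr0 expR0 mul1r.
rewrite /gprod !big_ord_recr/= -!/(gprod _ _ _).
have [N NN] : {N : R | N = n.+1%:R} by exists n.+1%:R.
have N1 : 1 <= N by rewrite NN ler1n.
have nE : n%:R = N - 1 :> R by rewrite NN -natr1 addrK.
have -> : x + d + 1 + n%:R = x + d + N by rewrite nE; ring.
have -> : x + 1 + n%:R = x + N by rewrite nE; ring.
have NE : n.+2%:R = N + 1 :> R by rewrite NN natr1.
have p1 : 0 < N ^+ 2 + y ^+ 2 by rewrite ltr_pwDl// exprn_gt0//; lra.
have p2 : 0 < (N + 1) ^+ 2 + y ^+ 2 by rewrite ltr_pwDl// exprn_gt0//; lra.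
have p3 : 0 < (x + N) ^+ 2 + y ^+ 2 by rewrite ltr_pwDl// exprn_gt0//; lra.
pose E := d * (ln ((N + 1) ^+ 2 + y ^+ 2) - ln (N ^+ 2 + y ^+ 2))
   + C * (N^-1 - (N + 1)^-1).
have lnr : (2 * N + 1) / ((N + 1) ^+ 2 + y ^+ 2) <=
   ln ((N + 1) ^+ 2 + y ^+ 2) - ln (N ^+ 2 + y ^+ 2).
  rewrite -[leRHS]opprB -ln_div ?posrE//.
  have -> : (N ^+ 2 + y ^+ 2) / ((N + 1) ^+ 2 + y ^+ 2) =
    1 + (- ((2 * N + 1) / ((N + 1) ^+ 2 + y ^+ 2))).
    by field; exact: lt0r_neq0.
  rewrite lerNr le_ln1Dx// ltrN2 ltr_pdivrMr// mul1r.
  nra.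
have step : (x + d + N) ^+ 2 + y ^+ 2 <= ((x + N) ^+ 2 + y ^+ 2) * expR E.
  rewrite -ler_pdivrMl//.
  have -> : ((x + N) ^+ 2 + y ^+ 2)^-1 * ((x + d + N) ^+ 2 + y ^+ 2) =
    1 + d * (2 * N + 2 * x + d) / ((x + N) ^+ 2 + y ^+ 2).
    by field; exact: lt0r_neq0.
  apply: le_trans (expR_ge1Dx _) _; rewrite ler_expR.
  apply: le_trans (_ : d * ((2 * N + 2 * x + d) / (N ^+ 2 + y ^+ 2)) <= _).
    rewrite -mulrA ler_wpM2l// ler_wpM2l//; first lra.
    by rewrite lef_pV2 ?posrE// lerD2r lerXn2r ?nnegrE//; lra.
  apply: le_trans (_ : d * ((2 * N + 1) / ((N + 1) ^+ 2 + y ^+ 2)) +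
      d * ((2 * x + d + 4) / N ^+ 2) <= _).
    rewrite -[leRHS]mulrDr ler_wpM2l//.
    have -> : (2 * N + 2 * x + d) / (N ^+ 2 + y ^+ 2) =
       (2 * N + 1) / ((N + 1) ^+ 2 + y ^+ 2) + (2 * x + d - 1 +
        (2 * N + 1) ^+ 2 / ((N + 1) ^+ 2 + y ^+ 2)) / (N ^+ 2 + y ^+ 2).
      by field; rewrite (lt0r_neq0 p1) (lt0r_neq0 p2).
    rewrite lerD2l.
    have q4 : (2 * N + 1) ^+ 2 / ((N + 1) ^+ 2 + y ^+ 2) <= 4.
      by rewrite ler_pdivrMr//; nra.
    have N20 : 0 < N ^+ 2 by rewrite exprn_gt0//; lra.
    apply: le_trans (_ : (2 * x + d + 4) / (N ^+ 2 + y ^+ 2) <= _).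
      by rewrite ler_pM2r ?invr_gt0//; lra.
    rewrite ler_wpM2l//; first lra.
    by rewrite lef_pV2 ?posrE// lerDl.
  rewrite /E lerD//; first by rewrite ler_wpM2l.
  rewrite /C [2 * d]mulrC -!mulrA ler_wpM2l//.
  have -> : 2 * ((2 * x + d + 4) * (N^-1 - (N + 1)^-1)) =
    (2 * x + d + 4) * (2 * (N^-1 - (N + 1)^-1)) by ring.
  rewrite ler_wpM2l//; first lra.
  have -> : 2 * (N^-1 - (N + 1)^-1) = 2 / (N * (N + 1)).
    by field; pos_neq0.
  rewrite -[(N ^+ 2)^-1]mul1r ler_pdivlMr; last by rewrite mulr_gt0; lra.
  rewrite mulrAC ler_pdivrMr; last by rewrite exprn_gt0; lra.
  nra.
apply: le_trans (ler_pM (g0 _ _) _ ih step) _.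
  by rewrite addr_ge0// sqr_ge0.
rewrite mulrACA -expRD ler_wpM2l//.
  by rewrite mulr_ge0// ltW.
rewrite NE ler_expR /E -NN.
by rewrite le_eqVlt; apply/orP; left; apply/eqP; ring.
Qed.

Lemma gprod_recl (R : realType) (x y : R) n :
  gprod x y n.+1 = (x ^+ 2 + y ^+ 2) * gprod (x + 1) y n.
Proof.
rewrite /gprod big_ord_recl/= addr0; congr (_ * _); apply: eq_bigr => k _.
by rewrite /bump/= add1n -natr1 addrAC addrA.
Qed.

(** The duplication formula, at the level of Gauss's products. *)
Lemma gprod_double (R : realType) (y : R) m :
  gprod 0 (2 * y) m.*2 = 16 ^+ m * (gprod 0 y m * gprod 2^-1 y m).
Proof.
elim: m => [|m ih]; first by rewrite /gprod !big_ord0 expr0 !mul1r.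
rewrite doubleS /gprod !big_ord_recr/= -!/(gprod _ _ _) ih [16 ^+ m.+1]exprS.
by rewrite -[m.*2.+1%:R]natr1 -muln2 natrM; field.
Qed.

(** The inequality behind Wallis's formula, in a form that allows an induction. *)
Lemma double_fact_le (R : realType) n :
  (n.*2.+1)`!%:R ^+ 2 <= (n%:R + 3 / 4) * (16 ^+ n.+1 * n`!%:R ^+ 4) :> R.
Proof.
elim: n => [|n ih]; first by rewrite fact0 !expr1n expr1; lra.
rewrite doubleS !factS !natrM [16 ^+ _]exprS !exprMn.
have f0 : 0 <= 16 ^+ n.+1 * n`!%:R ^+ 4 :> R by rewrite mulr_ge0 ?exprn_ge0.
move: ih f0; rewrite factS natrM exprMn; set F := n.*2`!%:R ^+ 2; set G := _ * n`!%:R ^+ 4.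
rewrite -[n.*2.+3%:R]natr1 -[n.*2.+2%:R]natr1 -[n.*2.+1%:R]natr1 -[n.+1%:R]natr1.
rewrite -muln2 natrM; set N : R := n%:R; have N0 : 0 <= N by rewrite ler0n.
move=> ih f0; set F' := _ * F in ih.
have -> : (N * 2 + 1 + 1 + 1) ^+ 2 * ((N * 2 + 1 + 1) ^+ 2 * F') =
  4 * (N + 1) ^+ 2 * (2 * N + 3) ^+ 2 * F' by ring.
apply: le_trans (_ : 4 * (N + 1) ^+ 2 * (2 * N + 3) ^+ 2 * ((N + 3 / 4) * G) <= _).
  apply: ler_wpM2l => //; apply: mulr_ge0; last exact: sqr_ge0.
  by apply: mulr_ge0 => //; exact: sqr_ge0.
have -> : (N + 1 + 3 / 4) * (16 * 16 ^+ n.+1 * ((N + 1) ^+ 4 * n`!%:R ^+ 4)) =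
  4 * (N + 1) ^+ 2 * (4 * (N + 1) ^+ 2 * (N + 7 / 4) * G) by rewrite /G; field.
rewrite -mulrA; apply: ler_wpM2l; first by apply: mulr_ge0 => //; exact: sqr_ge0.
rewrite mulrA ler_wpM2r//.
nra.
Qed.

Lemma cvg_odd_subseq (R : realType) (u : nat -> R) (l : R) :
  u @ \oo --> l -> (fun n => u n.*2.+1) @ \oo --> l.
Proof.
move=> ul; apply: (@cvg_comp _ _ _ (fun n => n.*2.+1) u \oo \oo) => //.
move=> A [N _ NA]; exists N => // n /= Nn; apply: NA => /=.
by rewrite (leq_trans Nn)// -addnn leqW// leq_addr.
Qed.

(** The duplication formula turns the products for Gamma(2 i y) into those with
    real parts 0 and 1/2, which gprod_ratio compares with the products with real
    parts xa >= 0 and xb >= 1/2.  Only odd ranks occur on the left, where the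
    limit is taken along a subsequence. *)
Lemma gamma_imag_le (R : realType) (xa xb y s : R) :
  0 < xa -> 2^-1 <= xb -> 0 < y -> s = xa + xb - 2^-1 ->
  Normc.normc (Gamma (0 +i* (2 * y))%C) ^+ 2 <=
   (2 * ((xa ^+ 2 + y ^+ 2) * (xb ^+ 2 + y ^+ 2) / (y ^+ 2 * (4^-1 + y ^+ 2))) *
    expR (s * (ln 5 - ln (1 + y ^+ 2)) +
      (2 * xa * (xa + 4) + 2 * (xb - 2^-1) * (xb + 2^-1 + 4)))) *
   (Normc.normc (Gamma (xa +i* y)%C) ^+ 2 * Normc.normc (Gamma (xb +i* y)%C) ^+ 2).
Proof.
move=> xa0 xb0 y0 sE; set M := 2 * _ * _.
have yn : y != 0 by exact: lt0r_neq0.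
have y2n : 2 * y != 0 by apply: lt0r_neq0; lra.
have nz u v : v != 0 -> (u +i* v)%C != 0 :> R[i].
  by rewrite eq_complex/= negb_and orbC => ->.
have [ca _] := gamma_cvg (ltW xa0) (nz xa y yn).
have [cb _] := @gamma_cvg _ xb y ltac:(lra) (nz xb y yn).
have [ci _] := @gamma_cvg _ 0 (2 * y) (lexx _) (nz 0 (2 * y) y2n).
have {ca} := cvgc_normc ca; have {cb} := cvgc_normc cb; have {ci} := cvgc_normc ci.
set gi := Gamma (0 +i* _)%C; set ga := Gamma (xa +i* _)%C.
set gb := Gamma (xb +i* _)%C => ci cb ca.
have ci2 : (fun n => Normc.normc (gamma_seq (0 +i* (2 * y))%C n.*2.+1)) @ \oo -->
    Normc.normc gi.
  exact: cvg_odd_subseq ci.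
rewrite -subr_ge0.
have sq (u : nat -> R) (l : R) : u @ \oo --> l -> (fun n => u n ^+ 2) @ \oo --> l ^+ 2.
  by move=> ul; rewrite expr2; apply: cvg_eqfun (cvgM ul ul) => n; rewrite /= expr2.
have cd : (fun n => M * (Normc.normc (gamma_seq (xa +i* y)%C n) ^+ 2 *
     Normc.normc (gamma_seq (xb +i* y)%C n) ^+ 2) -
     Normc.normc (gamma_seq (0 +i* (2 * y))%C n.*2.+1) ^+ 2) @ \oo -->
   M * (Normc.normc ga ^+ 2 * Normc.normc gb ^+ 2) - Normc.normc gi ^+ 2.
  by apply: cvgB (sq _ _ ci2); apply: cvgMl_tmp; exact: cvgM (sq _ _ ca) (sq _ _ cb).
apply: (cvgn_ge cd (N := (Num.trunc y).+1)) => n Nn.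
have yN : y <= n%:R by apply: le_trans (ltW (truncnS_gt y)) _; rewrite ler_nat.
have n1 : 1 <= n%:R :> R by rewrite ler1n (leq_trans _ Nn).
rewrite subr_ge0 !normc_gamma_seq -!/(gprod _ _ _) mul0r expR0 mulr1 -doubleS.
rewrite gprod_double.
set L := ln n%:R; set P0 := gprod 0 y n.+1; set Ph := gprod 2^-1 y n.+1.
have P00 : 0 < P0 by exact: gprod_gt0.
have Ph0 : 0 < Ph by exact: gprod_gt0.
have Pa0 : 0 < gprod xa y n.+1 by exact: gprod_gt0.
have Pb0 : 0 < gprod xb y n.+1 by exact: gprod_gt0.
have F16 : 0 < 16 ^+ n.+1 :> R by exact: exprn_gt0.
rewrite ler_pdivrMr ?mulr_gt0//.
apply: le_trans (double_fact_le R n) _.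
set F := n`!%:R.
have F0 : 0 < F by rewrite /F ltr0n fact_gt0.
have eL : expR L = n%:R by rewrite /L lnK// posrE; lra.
have nb : n%:R + 3 / 4 <= 2 * expR L by rewrite eL; lra.
have Lb : ln (n.+1%:R ^+ 2 + y ^+ 2) <= ln 5 + 2 * L.
  rewrite -ler_expR lnK; last by rewrite posrE ltr_wpDr ?sqr_ge0// exprn_gt0.
  rewrite expRD lnK ?posrE// expRM_natl eL -natr1.
  have : y ^+ 2 <= n%:R ^+ 2 by rewrite lerXn2r ?nnegrE ?(ltW y0).
  by move: (n%:R) n1 => N n1; nra.
pose T := ln 5 + 2 * L - ln (1 + y ^+ 2).
have C0 z : 1 - z.+1%:R^-1 <= 1 :> R by rewrite lerBlDr lerDl invr_ge0.
have ra : gprod xa y n.+1 <= (xa ^+ 2 + y ^+ 2) / y ^+ 2 *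
    expR (xa * T + 2 * xa * (xa + 4)) * P0.
  rewrite /P0 !gprod_recl add0r expr0n/= add0r.
  have := @gprod_ratio R 0 xa y n (lexx _) (ltW xa0); rewrite !add0r => r.
  have {}r : gprod (xa + 1) y n <= gprod 1 y n * expR (xa * T + 2 * xa * (xa + 4)).
    apply: (le_trans r); rewrite ler_wpM2l//; first by rewrite ltW// gprod_gt0.
    rewrite ler_expR lerD// ?ler_wpM2l ?(ltW xa0)//.
      by rewrite /T lerB// .
    rewrite mulr0 add0r -[leRHS]mulr1 ler_wpM2l// mulr_ge0//; lra.
  apply: le_trans (ler_wpM2l _ r) _; first by rewrite addr_ge0 ?sqr_ge0.
  by rewrite le_eqVlt; apply/orP; left; apply/eqP; field.
have rb : gprod xb y n.+1 <= (xb ^+ 2 + y ^+ 2) / (4^-1 + y ^+ 2) *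
    expR ((xb - 2^-1) * T + 2 * (xb - 2^-1) * (xb + 2^-1 + 4)) * Ph.
  rewrite /Ph !gprod_recl.
  have := @gprod_ratio R 2^-1 (xb - 2^-1) y n ltac:(lra) ltac:(lra).
  rewrite [2^-1 + (xb - _)]addrC subrK => r.
  have {}r : gprod (xb + 1) y n <= gprod (2^-1 + 1) y n *
     expR ((xb - 2^-1) * T + 2 * (xb - 2^-1) * (xb + 2^-1 + 4)).
    apply: (le_trans r); rewrite ler_wpM2l//; first by rewrite ltW// gprod_gt0.
    rewrite ler_expR lerD// ?ler_wpM2l//.
    - by lra.
    - by rewrite /T lerB//.
    - have -> : 2 * 2^-1 + (xb - 2^-1) + 4 = xb + 2^-1 + 4 by lra.
      by rewrite -[leRHS]mulr1 ler_wpM2l// mulr_ge0//; lra.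
  apply: le_trans (ler_wpM2l _ r) _; first by rewrite addr_ge0 ?sqr_ge0.
  rewrite le_eqVlt; apply/orP; left; apply/eqP; field.
  by have y2 := sqr_ge0 y; pos_neq0.
have yy : 0 < 4^-1 + y ^+ 2 by rewrite ltr_pwDl ?sqr_ge0//; lra.
have nbF : (n%:R + 3 / 4) * (16 ^+ n.+1 * F ^+ 4) <= 2 * expR L * (16 ^+ n.+1 * F ^+ 4).
  by rewrite ler_wpM2r// mulr_ge0 ?exprn_ge0 ?(ltW F0) ?(ltW F16).
apply: (le_trans nbF).
rewrite !exprMn.
have -> : M * (F ^+ 2 * expR (xa * L) ^+ 2 / gprod xa y n.+1 *
   (F ^+ 2 * expR (xb * L) ^+ 2 / gprod xb y n.+1)) * (16 ^+ n.+1 * (P0 * Ph)) =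
  (M * expR (xa * L) ^+ 2 * expR (xb * L) ^+ 2 * (P0 * Ph)) /
   (gprod xa y n.+1 * gprod xb y n.+1) * (16 ^+ n.+1 * F ^+ 4).
  by field; rewrite !lt0r_neq0.
rewrite ler_wpM2r//; first by rewrite mulr_ge0 ?exprn_ge0 ?(ltW F0) ?(ltW F16).
rewrite ler_pdivlMr ?mulr_gt0//.
have e20 : 0 <= 2 * expR L by rewrite mulr_ge0 ?expR_ge0.
apply: le_trans (ler_wpM2l e20 (ler_pM (ltW Pa0) (ltW Pb0) ra rb)) _.
rewrite le_eqVlt; apply/orP; left; apply/eqP.
rewrite /M -!expRM_natl.
set A := xa ^+ 2 + y ^+ 2; set B := xb ^+ 2 + y ^+ 2.
set ea := expR (xa * T + _); set eb := expR (_ * T + _).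
have -> : 2 * expR L * (A / y ^+ 2 * ea * P0 * (B / (4^-1 + y ^+ 2) * eb * Ph)) =
   2 * (A * B / (y ^+ 2 * (4^-1 + y ^+ 2))) * (expR L * ea * eb) * (P0 * Ph).
  by rewrite [(y ^+ 2 * _)^-1]invfM; move: (4^-1 + y ^+ 2)^-1 (y ^+ 2)^-1 => u v; ring.
suff -> : expR L * ea * eb = expR (s * (ln 5 - ln (1 + y ^+ 2)) +
    (2 * xa * (xa + 4) + 2 * (xb - 2^-1) * (xb + 2^-1 + 4))) *
    expR (2 * (xa * L)) * expR (2 * (xb * L)).
  by rewrite !mulrA.
rewrite /ea /eb -!expRD; congr expR.
by rewrite /T sE; field.
Qed.

(** With lambda = 2 y, the density is a constant times
    |Gamma(xa + i y) Gamma(xb + i y)|^2 / |Gamma(2 i y)|^2 for xa = rho / 2 and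
    xb = (alpha - beta + 1) / 2, and xa + xb - 1/2 = alpha + 1/2. *)
Lemma jacobi_n_ge (R : realType) (alpha beta : R) :
  beta <= alpha -> - 2^-1 <= beta -> - 2^-1 < alpha ->
  exists c : R, [/\ 0 < c,
    forall lambda, 0 < lambda <= 1 -> c * lambda ^+ 2 <= jacobi_n alpha beta lambda &
    forall lambda, 1 <= lambda ->
      c * lambda `^ (2 * alpha + 1) <= jacobi_n alpha beta lambda].
Proof.
move=> hab hb ha.
pose xa := rho alpha beta / 2; pose xb := (alpha - beta + 1) / 2.
have xa0 : 0 < xa by rewrite /xa /rho; lra.
have xb0 : 2^-1 <= xb by rewrite /xb; lra.
pose s := alpha + 2^-1; have s0 : 0 < s by rewrite /s; lra.
have sE : xa + xb - 2^-1 = s by rewrite /xa /xb /s /rho; lra.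
have [_ G0] := @gamma_cvg R (alpha + 1) 0 ltac:(lra)
   ltac:(rewrite eq_complex/= eqxx andbT; apply: lt0r_neq0; lra).
set G := Normc.normc _ in G0.
pose w : R := (2 * pi) `^ (- 2^-1).
have w0 : 0 < w by rewrite powR_gt0// mulr_gt0// pi_gt0.
pose t2 := expR (rho alpha beta * ln 2).
have t20 : 0 < t2 by exact: expR_gt0.
pose E0 := expR (s * ln 5 + (2 * xa * (xa + 4) + 2 * (xb - 2^-1) * (xb + 2^-1 + 4))).
have E00 : 0 < E0 by exact: expR_gt0.
pose K := (1 + xa ^+ 2) * (4 * xb ^+ 2 + 1).
have K0 : 0 < K by have a2 := sqr_ge0 xa; have b2 := sqr_ge0 xb; apply: mulr_gt0; lra.
pose c1 := w / ((t2 * G) ^+ 2 * (2 * K * E0)).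
have tG : 0 < (t2 * G) ^+ 2 by rewrite exprn_gt0// mulr_gt0.
have KE : 0 < 2 * K * E0 by apply: mulr_gt0 => //; apply: mulr_gt0.
have c10 : 0 < c1 by apply: divr_gt0 => //; exact: mulr_gt0.
have key (y : R) : 0 < y ->
   c1 * (y ^+ 2 / (1 + y ^+ 2)) * expR (s * ln (1 + y ^+ 2)) <= jacobi_n alpha beta (2 * y).
  move=> y0; have yn : y != 0 by exact: lt0r_neq0.
  have y2n : 2 * y != 0 by apply: lt0r_neq0; lra.
  have y2 : 0 < y ^+ 2 by exact: exprn_gt0.
  have nz u v : v != 0 -> (u +i* v)%C != 0 :> R[i].
    by rewrite eq_complex/= negb_and orbC => ->.
  have [_ ga] := gamma_cvg (ltW xa0) (nz xa y yn).
  have [_ gb] := @gamma_cvg _ xb y ltac:(lra) (nz xb y yn).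
  have [_ gi] := @gamma_cvg _ 0 (2 * y) (lexx _) (nz 0 (2 * y) y2n).
  have := gamma_imag_le xa0 xb0 y0 (esym sE).
  set A := Normc.normc _ in ga *; set B := Normc.normc _ in gb *.
  set I := Normc.normc _ in gi *; move=> IAB.
  have -> : jacobi_n alpha beta (2 * y) = w * (t2 * G * I / (A * B)) ^- 2.
    rewrite /jacobi_n -/w; congr (_ * _ ^- 2).
    have z1 : (rho alpha beta +i* (2 * y))%C / 2 = (xa +i* y)%C.
      apply: (canLR (mulfK _)); first by rewrite pnatr_eq0.
      rewrite mulr_natr mulr2n.
      by apply/eqP; rewrite eq_complex/=; apply/andP; split; apply/eqP; rewrite /xa; field.
    have z2 : (xa +i* y)%C - beta%:C%C = (xb +i* y)%C.
      apply/eqP; rewrite eq_complex/=; apply/andP; split; apply/eqP; last by ring.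
      by rewrite /xa /xb /rho; lra.
    rewrite /jacobi_c z1 z2 Normc.normcM Normc.normcV Normc.normcM.
    rewrite [Normc.normc (Gamma (xa +i* y)%C * _)]Normc.normcM.
    rewrite [Normc.normc (cpow _ _ * _)]Normc.normcM -/A -/B -/I -/G.
    by rewrite /cpow [Normc.normc (cexp _)]normc_cexp/= mulr0 subr0.
  have IE : (t2 * G * I / (A * B)) ^- 2 = (A ^+ 2 * B ^+ 2) / ((t2 * G) ^+ 2 * I ^+ 2).
    by field; rewrite !lt0r_neq0.
  have I20 : 0 < I ^+ 2 by exact: exprn_gt0.
  rewrite IE [leRHS]mulrA ler_pdivlMr; last exact: mulr_gt0.
  set X := A ^+ 2 * B ^+ 2 in IAB *.
  have X0 : 0 < X by rewrite mulr_gt0// exprn_gt0.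
  have e1 : expR (s * (ln 5 - ln (1 + y ^+ 2)) +
      (2 * xa * (xa + 4) + 2 * (xb - 2^-1) * (xb + 2^-1 + 4))) =
      E0 / expR (s * ln (1 + y ^+ 2)).
    by rewrite /E0 -expRB; congr expR; ring.
  set e := expR (s * ln (1 + y ^+ 2)) in e1 *.
  have e0 : 0 < e by exact: expR_gt0.
  have k0 : (xa ^+ 2 + y ^+ 2) * (xb ^+ 2 + y ^+ 2) / (y ^+ 2 * (4^-1 + y ^+ 2)) <=
     K * (1 + y ^+ 2) / y ^+ 2.
    rewrite ler_pdivrMr; last by rewrite mulr_gt0//; lra.
    have -> : K * (1 + y ^+ 2) / y ^+ 2 * (y ^+ 2 * (4^-1 + y ^+ 2)) =
      ((1 + xa ^+ 2) * (1 + y ^+ 2)) * ((4 * xb ^+ 2 + 1) * (4^-1 + y ^+ 2)).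
      by rewrite /K; field.
    have a2 := sqr_ge0 xa; have b2 := sqr_ge0 xb.
    apply: ler_pM; [clear - a2 y2; lra|clear - b2 y2; lra| |].
      by have := mulr_ge0 a2 (ltW y2); nra.
    by have := mulr_ge0 b2 (ltW y2); nra.
  have IX : I ^+ 2 <= 2 * (K * (1 + y ^+ 2) / y ^+ 2) * (E0 / e) * X.
    apply: (le_trans IAB); rewrite e1 ler_wpM2r ?(ltW X0)// ler_wpM2r//.
      by rewrite divr_ge0 ?ltW.
    by rewrite ler_wpM2l.
  apply: le_trans (_ : c1 * (y ^+ 2 / (1 + y ^+ 2)) * e *
     ((t2 * G) ^+ 2 * (2 * (K * (1 + y ^+ 2) / y ^+ 2) * (E0 / e) * X)) <= _).
    have Y0 : 0 <= y ^+ 2 / (1 + y ^+ 2) by apply: divr_ge0; clear - y2; lra.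
    apply: ler_wpM2l; last by apply: ler_wpM2l IX; exact: ltW.
    by apply: mulr_ge0 (ltW e0); apply: mulr_ge0 Y0; exact: ltW.
  rewrite le_eqVlt; apply/orP; left; apply/eqP; rewrite /c1; field.
  by rewrite yn !lt0r_neq0//; lra.
clearbody c1; clear tG KE.
pose c := c1 * (40^-1 * expR (- (s * ln 4))).
have e41 : expR (- (s * ln 4)) <= 1.
  by rewrite expR_le1 oppr_le0 mulr_ge0 ?ln_ge0 ?(ltW s0)//; lra.
exists c; split.
- by apply: mulr_gt0 => //; apply: mulr_gt0; rewrite ?expR_gt0//; lra.
- move=> l /andP[l0 l1]; have l2 : 0 < l ^+ 2 by exact: exprn_gt0.
  have l21 : l ^+ 2 <= 1 by rewrite exprn_ile1// ltW.
  have := key (l / 2) ltac:(lra); have -> : 2 * (l / 2) = l by field.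
  set Y := (l / 2) ^+ 2; have YE : Y = l ^+ 2 / 4 by rewrite /Y; field.
  clearbody Y; apply: le_trans; rewrite /c -[leLHS]mulrA -[leRHS]mulrA.
  apply: ler_wpM2l; first exact: ltW.
  have e1 : 1 <= expR (s * ln (1 + Y)).
    by rewrite -[leLHS]expR0 ler_expR; apply: mulr_ge0 (ltW s0) _; rewrite ln_ge0//; lra.
  apply: le_trans (_ : 40^-1 * l ^+ 2 <= _).
    by apply: ler_wpM2r (ltW l2) _ _ _; rewrite -[leRHS]mulr1 ler_wpM2l.
  apply: le_trans (_ : Y / (1 + Y) * 1 <= _).
    by rewrite mulr1 ler_pdivlMr; nra.
  by apply: ler_wpM2l => //; apply: divr_ge0; lra.
- move=> l l1; have l0 : 0 < l by lra.
  have l2 : 1 <= l ^+ 2 by rewrite exprn_ege1.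
  have := key (l / 2) ltac:(lra); have -> : 2 * (l / 2) = l by field.
  set Y := (l / 2) ^+ 2; have YE : Y = l ^+ 2 / 4 by rewrite /Y; field.
  clearbody Y; apply: le_trans; rewrite /c -[leLHS]mulrA -[leRHS]mulrA.
  apply: ler_wpM2l; first exact: ltW.
  rewrite -[leLHS]mulrA; apply: ler_pM.
  + by [].
  + by rewrite mulr_ge0 ?expR_ge0 ?powR_ge0.
  + by rewrite ler_pdivlMr; lra.
  + rewrite /powR gt_eqF// -expRD ler_expR.
    have -> : - (s * ln 4) + (2 * alpha + 1) * ln l = s * (2 * ln l - ln 4).
      by rewrite /s; field.
    rewrite ler_wpM2l ?(ltW s0)//.
    have -> : 2 * ln l = ln (l ^+ 2) by rewrite lnXn// mulr_natl.
    rewrite -ln_div ?posrE//; last lra.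
    by rewrite ler_ln ?posrE; lra.
Qed.

(** * Smooth test functions *)

Definition smooth_on (R : realType) (U : set R) (f : R -> R) :=
  forall (n : nat) (x : R), U x -> derivable (derive1n n f) x 1.

Lemma derive1n_eqon (R : realType) (U : set R) (f g : R -> R) n : open U ->
  (forall x, U x -> f x = g x) ->
  forall x, U x -> derive1n n f x = derive1n n g x.
Proof.
move=> oU fg; elim: n => [|n ih] x Ux; first exact: fg.
rewrite !derive1nS !derive1E; apply: near_eq_derive.
by have : nbhs x U by [exact: open_nbhs_nbhs]; apply: filterS => y /ih.
Qed.

Lemma smooth_on_eq (R : realType) (U : set R) (f g : R -> R) : open U ->
  (forall x, U x -> f x = g x) -> smooth_on U g -> smooth_on U f.
Proof.
move=> oU fg sg n x Ux.
have h : is_derive x 1 (derive1n n g) (derive1 (derive1n n g) x).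
  by rewrite derive1E; apply: DeriveDef => //; exact: sg.
by have [] := drv_eqon oU Ux (@derive1n_eqon R U f g n oU fg) h.
Qed.

(** Iterated derivatives rarely have usable closed forms; a class of functions
    closed under differentiation replaces them in all the proofs of smoothness
    below. *)
Lemma smooth_class (R : realType) (U : set R) (P : (R -> R) -> Prop) : open U ->
  (forall f, P f -> exists2 g, P g & forall x, U x -> is_derive x 1 f (g x)) ->
  forall f, P f -> smooth_on U f.
Proof.
move=> oU HP f Pf n x Ux.
have [g Pg gE] : exists2 g, P g & forall y, U y -> derive1n n f y = g y.
  elim: n => [|n [g Pg gE]]; first by exists f.
  have [k Pk kE] := HP g Pg; exists k => // y Uy.
  by rewrite derive1nS derive1E; case: (drv_eqon oU Uy gE (kE y Uy)).
have [k _ kE] := HP g Pg.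
by have [] := drv_eqon oU Ux gE (kE x Ux).
Qed.

Lemma smooth_on_derive (R : realType) (U : set R) (f : R -> R) :
  smooth_on U f -> smooth_on U (derive1 f) /\
  forall x, U x -> is_derive x 1 f (derive1 f x).
Proof.
have dS n : derive1n n.+1 f = derive1n n (derive1 f).
  by elim: n => [//|n ih]; rewrite derive1nS ih -derive1nS.
move=> sf; split=> [n x Ux|x Ux]; first by rewrite -dS; exact: sf.
by rewrite derive1E; apply: DeriveDef => //; exact: (sf 0%N).
Qed.

(** By Leibniz's rule, a class closed under differentiation that contains the
    products of smooth functions. *)
Inductive sum_of_products (R : realType) (S : (R -> R) -> Prop) : (R -> R) -> Prop :=
| sop_mul f g of S f & S g : sum_of_products S (fun x => f x * g x)
| sop_add f g of sum_of_products S f & sum_of_products S g :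
    sum_of_products S (fun x => f x + g x).

Lemma smooth_onM (R : realType) (U : set R) (f g : R -> R) : open U ->
  smooth_on U f -> smooth_on U g -> smooth_on U (fun x => f x * g x).
Proof.
move=> oU sf sg; apply: (@smooth_class R U (sum_of_products (smooth_on U)) oU);
  last exact: sop_mul.
move=> h; elim=> [{sf sg}f {}g sf sg|{sf sg}f {}g _ [f' Sf' df] _ [g' Sg' dg]].
  have [sf' df] := smooth_on_derive sf; have [sg' dg] := smooth_on_derive sg.
  exists (fun x => derive1 f x * g x + f x * derive1 g x).
    by apply: sop_add; apply: sop_mul.
  by move=> x Ux; exact: drvM (df x Ux) (dg x Ux).
exists (fun x => f' x + g' x); first exact: sop_add.
by move=> x Ux; exact: drvD (df x Ux) (dg x Ux).
Qed.

Lemma smooth_on_affine (R : realType) (U : set R) (f : R -> R) (c d : R) : open U ->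
  smooth_on setT f -> smooth_on U (fun x => f (c * x + d)).
Proof.
move=> oU sf; pose P h := exists k g, smooth_on setT g /\ h = fun x : R => k * g (c * x + d).
apply: (@smooth_class R U P oU); last first.
  by exists 1, f; split => //; apply/funext => x; rewrite mul1r.
move=> _ [k [g [sg ->]]]; have [sg' dg] := smooth_on_derive sg.
exists (fun x => k * c * derive1 g (c * x + d)); first by exists (k * c), (derive1 g).
move=> x _; have da : is_derive x 1 (fun y => c * y + d) c.
  by apply: (drv_eq (drvD (drvZ c (drv_id x)) (drv_cst d x))); rewrite mulr1 addr0.
by apply: (drv_eq (drvZ k (drv_comp da (dg _ I)))); ring.
Qed.

Lemma smooth_on_exp (R : realType) (U : set R) (b : R) : open U ->
  smooth_on U (fun x => expR (- (b * x))).
Proof.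
move=> oU; pose P h := exists k, h = fun x : R => k * expR (- (b * x)).
apply: (@smooth_class R U P oU); last first.
  by exists 1; apply/funext => x; rewrite mul1r.
move=> _ [k ->]; exists (fun x => k * - b * expR (- (b * x))); first by exists (k * - b).
move=> x _; apply: (drv_eq (drvZ k (drv_exp (drvN (drvZ b (drv_id x)))))).
ring.
Qed.

Lemma drv_powR (R : realType) (a x : R) : 0 < x ->
  is_derive x 1 (fun y => y `^ a) (a * x `^ (a - 1)).
Proof. exact: is_derive1_powR. Qed.

Lemma smooth_on_powR (R : realType) (a : R) :
  smooth_on [set x : R | 0 < x] (fun x => x `^ a).
Proof.
pose P h := exists k e, h = fun x : R => k * x `^ e.
apply: (@smooth_class R _ P); last by exists 1, a; apply/funext => x; rewrite mul1r.
  exact: open_gt.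
move=> _ [k [e ->]]; exists (fun x => k * e * x `^ (e - 1)); first by exists (k * e), (e - 1).
move=> x x0; apply: (drv_eq (drvZ k (drv_powR e x0))).
by rewrite mulrA.
Qed.

Definition flat (R : realType) (x : R) : R := if 0 < x then expR (- x^-1) else 0.

Lemma poly_exp_bound (R : realType) (p : {poly R}) k :
  exists C, forall y, 0 <= y -> `|p.[y]| * y ^+ k * expR (- y) <= C.
Proof.
elim/poly_ind: p k => [|p c ih] k.
  by exists 0 => y _; rewrite horner0 normr0 !mul0r.
have [C pC] := ih k.+1; exists (C + `|c| * k.+1`!%:R * 1 + `|c|) => y y0.
rewrite !hornerE; apply: le_trans (_ : (`|p.[y]| * y + `|c|) * y ^+ k * expR (- y) <= _).
  rewrite ler_wpM2r ?expR_ge0// ler_wpM2r ?exprn_ge0//.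
  by apply: le_trans (ler_normD _ _) _; rewrite normrM (ger0_norm y0).
have e0 := expR_ge0 (- y).
have h1 := pC y y0; rewrite exprS mulrA in h1.
have yk : y ^+ k * expR (- y) <= k.+1`!%:R + 1.
  have ey : expR y * expR (- y) = 1 by rewrite expRN divff// gt_eqF// expR_gt0.
  have k1 : 1 <= k.+1`!%:R :> R by rewrite ler1n fact_gt0.
  apply: le_trans (_ : (k.+1`!%:R * expR y) * expR (- y) <= _); last first.
    by rewrite -mulrA ey mulr1 lerDl.
  rewrite ler_wpM2r//.
  have [y1|y1] := leP y 1.
    apply: le_trans (exprn_ile1 _ y0 y1) _.
    by apply: mulr_ege1 => //; rewrite -expR0 ler_expR.
  have := expR_ge1Dxn k y0 => h.
  have : y ^+ k.+1 / k.+1`!%:R <= expR y by lra.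
  rewrite ler_pdivrMr ?ltr0n ?fact_gt0// mulrC => h2; apply: le_trans h2.
  by rewrite exprS -[leLHS]mul1r ler_wpM2r ?exprn_ge0// ltW.
have h3 := ler_wpM2l (normr_ge0 c) yk.
rewrite mulrDl mulrDl; lra.
Qed.

Lemma drv_horner (R : realType) (p : {poly R}) (x : R) :
  is_derive x 1 (fun y => p.[y]) (p^`()).[x].
Proof.
elim/poly_ind: p => [|p c ih].
  rewrite (_ : (fun y => _) = (fun=> 0)) ?deriv0 ?horner0; first exact: drv_cst.
  by apply/funext => y; rewrite horner0.
rewrite (_ : (fun y => _) = (fun y => p.[y] * y + c)); last first.
  by apply/funext => y; rewrite !hornerE.
apply: (drv_eq (drvD (drvM ih (drv_id x)) (drv_cst c x))).
by rewrite derivD derivM derivX derivC !hornerE.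
Qed.

(** The class consists of the functions p(1 / x) exp (- 1 / x), extended by 0,
    for p a polynomial; they are O(x^2) at the origin, hence have derivative 0
    there. *)
Lemma smooth_flat (R : realType) : smooth_on setT (@flat R).
Proof.
pose P (f : R -> R) := exists p : {poly R}, f = fun x => if 0 < x then p.[x^-1] * expR (- x^-1) else 0.
apply: (@smooth_class R _ P); [exact: openT| |]; last first.
  by exists 1; apply/funext => x; rewrite /flat; case: ifP => //; rewrite hornerE mul1r.
move=> _ [p ->]; pose q := 'X^2 * (p - p^`()).
exists (fun x => if 0 < x then q.[x^-1] * expR (- x^-1) else 0); first by exists q.
move=> x _; have [x0|x0|->] := ltgtP x 0.
- apply: (@drv_eqon _ _ (fun=> 0) [set y | y < 0] _ _ _ _ _ (drv_cst 0 x)) => //.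
  by move=> y /= y0; rewrite ltNge (ltW y0).
- apply: (@drv_eqon _ _ (fun y => p.[y^-1] * expR (- y^-1)) [set y | 0 < y]) => //.
    by move=> y /= ->.
  have xn : x != 0 by exact: lt0r_neq0.
  have dV := drvV (drv_id x) xn.
  apply: (drv_eq (drvM (drv_comp dV (drv_horner p _)) (drv_exp (drvN dV)))).
  rewrite /q hornerM hornerXn hornerD hornerN; move: (p.[_]) (_.[_]) (expR _) => s t e.
  by field.
- have [C pC] := poly_exp_bound p 2.
  have C0 : 0 <= C by have := pC 0 (lexx 0); rewrite expr0n/= mulr0 mul0r.
  set f := fun y => _.
  have fC y : `|f y| <= C * y ^+ 2.
    rewrite /f; case: ifPn => [y0|_]; last by rewrite normr0 mulr_ge0 ?sqr_ge0.
    have yi : 0 <= y^-1 by rewrite invr_ge0 ltW.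
    have := pC _ yi; rewrite normrM (ger0_norm (expR_ge0 _)) => h.
    rewrite -ler_pdivrMr ?exprn_gt0// -exprVn.
    by apply: le_trans h; rewrite mulrAC.
  have f0 : f 0 = 0 by rewrite /f ltxx.
  have lim0 : h^-1 *: (f (h *: 1 + 0) - f 0) @[h --> (0 : R)^'] --> (0 : R).
    apply/cvgrPdist_lt => e e0; near=> h; rewrite f0 subr0 addr0 sub0r normrN.
    have h0 : h != 0 by near: h; exact: nbhs_dnbhs_neq.
    rewrite normrM normfV; apply: le_lt_trans (_ : C * `|h| < e).
      rewrite ler_pdivrMl ?normr_gt0//; apply: (le_trans (fC _)).
      rewrite [h *: 1]mulr1 -[h ^+ 2]real_normK ?num_real//.
      by rewrite expr2 mulrCA.
    have : `|h| < e / (C + 1).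
      near: h; apply: dnbhs0_lt; rewrite divr_gt0//; lra.
    rewrite ltr_pdivlMr; last lra.
    by have := normr_ge0 h; lra.
  have dv : derivable f 0 1 by apply/cvg_ex; exists 0.
  by apply: DeriveDef => //; exact: cvg_lim lim0.
Unshelve. all: by end_near. Qed.

Lemma flat_ge0 (R : realType) (x : R) : 0 <= flat x.
Proof. by rewrite /flat; case: ifP => // _; exact: expR_ge0. Qed.

Lemma flat_le1 (R : realType) (x : R) : flat x <= 1.
Proof.
by rewrite /flat; case: ifP => // x0; rewrite expR_le1 oppr_le0 invr_ge0 ltW.
Qed.

Lemma flat_eq0 (R : realType) (x : R) : x <= 0 -> flat x = 0.
Proof. by rewrite /flat leNgt => /negbTE ->. Qed.

Lemma flat_half (R : realType) (x : R) : 2^-1 <= x -> expR (- 2) <= flat x.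
Proof.
move=> x2; have x0 : 0 < x by lra.
by rewrite /flat x0 ler_expR lerN2 -[leRHS]invrK lef_pV2 ?posrE.
Qed.

(** Up to constant factors this is t^(- a) exp (- b t) on [2 u, v / 2], and it
    vanishes outside ]u, v[. *)
Definition cutoff (R : realType) (u v a b t : R) : R :=
  flat (u^-1 * t - 1) * flat (1 - v^-1 * t) * (t `^ (- a) * expR (- (b * t))).

Lemma cutoff_ge0 (R : realType) (u v a b t : R) : 0 <= cutoff u v a b t.
Proof. by rewrite /cutoff !mulr_ge0 ?flat_ge0 ?powR_ge0 ?expR_ge0. Qed.

Lemma cutoff_le (R : realType) (u v a b t : R) :
  cutoff u v a b t <= t `^ (- a) * expR (- (b * t)).
Proof.
rewrite /cutoff -[leRHS]mul1r ler_wpM2r ?mulr_ge0 ?powR_ge0 ?expR_ge0//.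
by rewrite mulr_ile1 ?flat_ge0 ?flat_le1.
Qed.

Lemma cutoff_eq0 (R : realType) (u v a b t : R) : 0 < u -> 0 < v ->
  ~~ (u < t < v) -> cutoff u v a b t = 0.
Proof.
move=> u0 v0; rewrite negb_and -!leNgt /cutoff => /orP[tu|vt].
  by rewrite flat_eq0 ?mul0r// subr_le0 mulrC ler_pdivrMr// mul1r.
by rewrite [X in _ * X * _]flat_eq0 ?mulr0 ?mul0r// subr_le0 mulrC ler_pdivlMr// mul1r.
Qed.

Lemma cutoff_ge (R : realType) (u v a b t : R) : 0 < u -> 0 < v ->
  2 * u <= t <= v / 2 ->
  expR (- 4) * (t `^ (- a) * expR (- (b * t))) <= cutoff u v a b t.
Proof.
move=> u0 v0 /andP[ut tv]; rewrite ler_wpM2r ?mulr_ge0 ?powR_ge0 ?expR_ge0//.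
have -> : expR (- 4) = expR (- 2) * expR (- 2) :> R by rewrite -expRD; congr expR; ring.
apply: ler_pM; rewrite ?expR_ge0//; apply: flat_half.
  have : 2 <= u^-1 * t by rewrite mulrC ler_pdivlMr.
  by lra.
have : v^-1 * t <= 2^-1 by rewrite mulrC ler_pdivrMr//; lra.
by lra.
Qed.

Lemma smooth_cutoff (R : realType) (u v a b : R) : 0 < u -> 0 < v ->
  smooth_on setT (cutoff u v a b).
Proof.
move=> u0 v0 n x _.
have [xu|xu] := ltP x u.
  have lo : smooth_on [set y | y < u] (cutoff u v a b).
    apply: (smooth_on_eq (g := fun=> 0)); first exact: open_lt.
      by move=> y /= yu; rewrite cutoff_eq0// negb_and -leNgt ltW.
    apply: (@smooth_class R [set y | y < u] (fun f => f = fun=> 0)) => //.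
    by move=> f ->; exists (fun=> 0) => // y _; exact: drv_cst.
  exact: lo.
have oU : open [set y : R | 0 < y] by exact: open_gt.
have hi : smooth_on [set y | 0 < y] (cutoff u v a b).
  apply: smooth_onM => //; apply: smooth_onM => //.
  - exact: smooth_on_affine (@smooth_flat R).
  - apply: (smooth_on_eq (g := fun t => flat (- v^-1 * t + 1))) => //.
      by move=> y _; rewrite mulNr addrC.
    exact: smooth_on_affine (@smooth_flat R).
  - exact: smooth_on_powR.
  - exact: smooth_on_exp.
by apply: hi => /=; lra.
Qed.

Lemma test_cutoff (R : realType) (u v a b : R) : 0 < u -> 0 < v ->
  test_function (fun t => (cutoff u v a b t)%:C%C).
Proof.
move=> u0 v0; split.
- by move=> n x; exact: (@smooth_cutoff R u v a b u0 v0 n x I).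
- have : smooth_on setT (fun=> 0 : R).
    apply: (@smooth_class R setT (fun f => f = fun=> 0) openT) => //.
    by move=> f ->; exists (fun=> 0) => // y _; exact: drv_cst.
  by move=> s0 n x; exact: (s0 n x I).
- exists `[u, v]%classic; split; first exact: segment_compact.
    by move=> x /=; rewrite !in_itv/= andbT => /andP[ux _]; exact: lt_le_trans ux.
  move=> t /= tuv; rewrite cutoff_eq0//; apply/negP => /andP[ut tv].
  by apply: tuv; rewrite in_itv/= !ltW.
Qed.

(** * Integral estimates *)

(** The integral of a nonnegative function is a supremum over the simple
    functions below it.  Monotonicity in this form applies to the transform as
    a function of lambda with no account of its measurability. *)
Lemma ge0_integral_mono (R : realType) (D1 D2 : set R) (f g : R -> \bar R) :
  D1 `<=` D2 -> (forall x, D1 x -> (0 <= f x <= g x)%E) ->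
  (forall x, D2 x -> (0 <= g x)%E) ->
  (\int[lebesgue_measure]_(x in D1) f x <= \int[lebesgue_measure]_(x in D2) g x)%E.
Proof.
move=> D12 fg g0; rewrite !ge0_integralE//; last first.
  by move=> x /fg /andP[].
apply/ge_ereal_sup => /= _ [h /= hf <-]; apply: ereal_sup_ubound; exists h => //= x.
apply: le_trans (hf x) _; rewrite /patch.
case: ifPn => [xD1|_].
  by rewrite (_ : x \in D2) ?inE; [case/andP: (fg x (set_mem xD1))|apply/D12/set_mem].
by case: ifPn => // /set_mem/g0.
Qed.

Lemma integral_support (R : realType) (u v : R) (f : R -> \bar R) : 0 < u ->
  (forall t, ~~ (u <= t <= v) -> f t = 0%E) ->
  (\int[lebesgue_measure]_(x in `]0%R, +oo[) f x =
   \int[lebesgue_measure]_(x in `[u, v]) f x)%E.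
Proof.
move=> u0 f0; rewrite integral_mkcond [RHS]integral_mkcond.
congr integral; apply/funext => x; rewrite /patch !mem_setE !in_itv/= andbT.
case: ifPn => x0; case: ifPn => // xuv.
  exact: f0.
by case/andP: xuv => ux _; rewrite (lt_le_trans u0 ux) in x0.
Qed.

Lemma integral_cst_itv (R : realType) (x y c : R) : x <= y ->
  (\int[lebesgue_measure]_(t in `[x, y]) c%:E = (c * (y - x))%:E)%E.
Proof.
move=> xy; rewrite integral_cst//.
have := lebesgue_measure_itv (R := R) `[x, y]; rewrite /= lte_fin => ->.
move: xy; rewrite le_eqVlt => /predU1P[->|xy].
  by rewrite ltxx subrr mulr0 mule0.
by rewrite xy EFinM EFinB.
Qed.

Lemma powR_ge_near (R : realType) (k x t e : R) : 1 <= k -> 0 < x ->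
  x / k <= t <= k * x -> k `^ (- `|e|) * x `^ e <= t `^ e.
Proof.
move=> k1 x0 /andP[t1 t2]; have k0 : 0 < k by lra.
have t0 : 0 < t by apply: lt_le_trans t1; rewrite divr_gt0.
rewrite /powR !gt_eqF// -expRD ler_expR.
have l1 : ln x - ln k <= ln t by rewrite -ln_div ?posrE// ler_ln ?posrE// divr_gt0.
have l2 : ln t <= ln k + ln x by rewrite -lnM ?posrE// ler_ln ?posrE// mulr_gt0.
have lk : 0 <= ln k by rewrite ln_ge0.
have h : `|e * (ln t - ln x)| <= `|e| * ln k.
  by rewrite normrM ler_wpM2l// ler_norml; apply/andP; split; lra.
by move: h; rewrite ler_norml => /andP[h1 _]; lra.
Qed.

(** ** The weight m *)

Lemma sinh_ge_id (R : realType) (t : R) : 0 <= t -> t <= sinh t.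
Proof.
move=> t0; suff : sinh 0 - 0 <= sinh t - t :> R by rewrite sinh0; lra.
apply: (@derive_ge0_le R (fun y => sinh y - y) (fun y => cosh y - 1)) => // y yt.
  exact: drvB (drv_sinh y) (drv_id y).
rewrite subr_ge0 -(@ler_pXn2r _ 2) ?nnegrE ?(ltW (cosh_gt0 _))//.
by rewrite cosh2 expr1n lerDl sqr_ge0.
Qed.

Lemma cosh_le_exp (R : realType) (t : R) : 0 <= t -> cosh t <= expR t.
Proof.
move=> t0; rewrite /cosh; have : expR (- t) <= expR t by rewrite ler_expR; lra.
lra.
Qed.

Lemma cosh_ge1 (R : realType) (t : R) : 1 <= cosh t.
Proof.
rewrite -(@ler_pXn2r _ 2) ?nnegrE ?(ltW (cosh_gt0 _))//.
by rewrite cosh2 expr1n lerDl sqr_ge0.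
Qed.

Lemma sinh_le_lin (R : realType) (t : R) : 0 <= t <= 1 -> sinh t <= expR 1 * t.
Proof.
move=> /andP[t0 t1].
suff : sinh t - expR 1 * t <= sinh 0 - expR 1 * 0 by rewrite sinh0; lra.
apply: (@derive_le0_le R (fun y => sinh y - expR 1 * y) (fun y => cosh y - expR 1 * 1)) => // y yt.
  exact: drvB (drv_sinh y) (drvZ _ (drv_id y)).
rewrite mulr1 subr_le0; apply: le_trans (cosh_le_exp _) _; first lra.
by rewrite ler_expR; lra.
Qed.

Lemma jacobi_m_small (R : realType) (alpha beta : R) :
  - 2^-1 <= beta -> - 2^-1 < alpha ->
  exists c C : R, [/\ 0 < c, 0 < C & forall t, 0 < t <= 1 ->
    c * t `^ (2 * alpha + 1) <= jacobi_m alpha beta t <= C * t `^ (2 * alpha + 1)].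
Proof.
move=> hb ha.
have [w w0 wE] : exists2 w : R, 0 < w & (2 * pi) `^ (- 2^-1) * 2 `^ (2 * rho alpha beta) = w.
  by eexists; last reflexivity; rewrite mulr_gt0// powR_gt0// mulr_gt0// pi_gt0.
have e0 : 0 < expR 1 :> R by exact: expR_gt0.
exists w, (w * (expR 1) `^ (2 * alpha + 1) * (expR 1) `^ (2 * beta + 1)); split => //.
  by apply: mulr_gt0; [apply: mulr_gt0 => //|]; rewrite powR_gt0.
move=> t /andP[t0 t1]; rewrite /jacobi_m wE.
have tn : 0 <= t by exact: ltW.
have a0 : 0 <= 2 * alpha + 1 by lra.
have b0 : 0 <= 2 * beta + 1 by lra.
have s1 : t `^ (2 * alpha + 1) <= sinh t `^ (2 * alpha + 1).
  by apply: ge0_ler_powR; rewrite ?nnegrE ?sinh_ge0 ?sinh_ge_id.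
have s2 : sinh t `^ (2 * alpha + 1) <= (expR 1) `^ (2 * alpha + 1) * t `^ (2 * alpha + 1).
  rewrite -powRM ?(ltW e0)//; apply: ge0_ler_powR; rewrite ?nnegrE ?sinh_ge0//.
    by rewrite mulr_ge0// ltW.
  by rewrite sinh_le_lin// tn.
have c1 : 1 <= cosh t `^ (2 * beta + 1).
  apply: le_trans (_ : 1 `^ (2 * beta + 1) <= _); first by rewrite powR1.
  apply: ge0_ler_powR; rewrite ?nnegrE ?cosh_ge1//.
  exact: ltW (cosh_gt0 _).
have c2 : cosh t `^ (2 * beta + 1) <= (expR 1) `^ (2 * beta + 1).
  apply: ge0_ler_powR; rewrite ?nnegrE ?(ltW (cosh_gt0 _)) ?(ltW e0)//.
  by apply: le_trans (cosh_le_exp tn) _; rewrite ler_expR.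
apply/andP; split.
  rewrite -[leLHS]mulr1; apply: ler_pM => //; first by rewrite mulr_ge0 ?powR_ge0// ltW.
  by rewrite ler_wpM2l// ltW.
have -> : w * expR 1 `^ (2 * alpha + 1) * expR 1 `^ (2 * beta + 1) * t `^ (2 * alpha + 1) =
  (w * (expR 1 `^ (2 * alpha + 1) * t `^ (2 * alpha + 1))) * expR 1 `^ (2 * beta + 1) by ring.
apply: ler_pM; rewrite ?powR_ge0 ?mulr_ge0 ?powR_ge0//; first exact: ltW.
by rewrite ler_wpM2l// ltW.
Qed.

Lemma jacobi_m_large (R : realType) (alpha beta : R) :
  - 2^-1 <= beta -> - 2^-1 < alpha ->
  exists c C : R, [/\ 0 < c, 0 < C & forall t, 1 <= t ->
    c * expR (2 * rho alpha beta * t) <= jacobi_m alpha beta t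
      <= C * expR (2 * rho alpha beta * t)].
Proof.
move=> hb ha.
have [w w0 wE] : exists2 w : R, 0 < w & (2 * pi) `^ (- 2^-1) * 2 `^ (2 * rho alpha beta) = w.
  by eexists; last reflexivity; rewrite mulr_gt0// powR_gt0// mulr_gt0// pi_gt0.
exists (w * 4^-1 `^ (2 * alpha + 1) * 2^-1 `^ (2 * beta + 1)), w; split => //.
  by apply: mulr_gt0; [apply: mulr_gt0 => //|]; rewrite powR_gt0.
move=> t t1; rewrite /jacobi_m wE.
have et := expR_gt0 t; have eN := expR_gt0 (- t).
have e2 : 2 <= expR t by apply: le_trans (expR_ge1Dx t); lra.
have [q4 q2] : (0 : R) <= 4^-1 /\ (0 : R) <= 2^-1 by split; lra.
have et' := ltW et.
have eNl : expR (- t) <= 2^-1 by rewrite expRN lef_pV2 ?posrE//.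
have a0 : 0 <= 2 * alpha + 1 by lra.
have b0 : 0 <= 2 * beta + 1 by lra.
have s0 : 0 <= sinh t by apply: sinh_ge0; lra.
have c0 : 0 <= cosh t by exact: ltW (cosh_gt0 _).
have pe e : expR t `^ e = expR (e * t).
  by rewrite /powR gt_eqF// expRK.
have ee : expR (2 * rho alpha beta * t) =
    expR t `^ (2 * alpha + 1) * expR t `^ (2 * beta + 1).
  by rewrite !pe -expRD; congr expR; rewrite /rho; ring.
have s1 : 4^-1 `^ (2 * alpha + 1) * expR t `^ (2 * alpha + 1) <= sinh t `^ (2 * alpha + 1).
  rewrite -powRM//; apply: ge0_ler_powR; rewrite ?nnegrE ?(mulr_ge0 q4) ?(mulr_ge0 q2)//.
  by rewrite /sinh; lra.
have s2 : sinh t `^ (2 * alpha + 1) <= expR t `^ (2 * alpha + 1).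
  by apply: ge0_ler_powR; rewrite ?nnegrE ?(ltW et)//; rewrite /sinh; lra.
have c1 : 2^-1 `^ (2 * beta + 1) * expR t `^ (2 * beta + 1) <= cosh t `^ (2 * beta + 1).
  rewrite -powRM//; apply: ge0_ler_powR; rewrite ?nnegrE ?(mulr_ge0 q4) ?(mulr_ge0 q2)//.
  by rewrite /cosh; lra.
have c2 : cosh t `^ (2 * beta + 1) <= expR t `^ (2 * beta + 1).
  by apply: ge0_ler_powR; rewrite ?nnegrE ?(ltW et)//; rewrite /cosh; lra.
rewrite ee; apply/andP; split.
  have -> : w * 4^-1 `^ (2 * alpha + 1) * 2^-1 `^ (2 * beta + 1) *
    (expR t `^ (2 * alpha + 1) * expR t `^ (2 * beta + 1)) =
    w * (4^-1 `^ (2 * alpha + 1) * expR t `^ (2 * alpha + 1)) *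
    (2^-1 `^ (2 * beta + 1) * expR t `^ (2 * beta + 1)) by ring.
  apply: ler_pM => //.
  - by apply: mulr_ge0 (ltW w0) _; rewrite mulr_ge0 ?powR_ge0.
  - by rewrite ler_wpM2l// ltW.
rewrite mulrA; apply: ler_pM; rewrite ?powR_ge0 ?mulr_ge0 ?powR_ge0 ?(ltW w0)//.
by rewrite ler_wpM2l// ltW.
Qed.

Lemma jacobi_m_ge0 (R : realType) (alpha beta t : R) : 0 <= jacobi_m alpha beta t.
Proof. by rewrite /jacobi_m !mulr_ge0 ?powR_ge0. Qed.

Lemma jacobi_n_ge0 (R : realType) (alpha beta t : R) : 0 <= jacobi_n alpha beta t.
Proof. by rewrite /jacobi_n mulr_ge0 ?powR_ge0// invr_ge0 exprn_ge0 ?normc_ge0. Qed.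

Lemma jacobi_m_drv (R : realType) (alpha beta t : R) : 0 < t ->
  exists d, is_derive t 1 (jacobi_m alpha beta) d.
Proof.
move=> t0; eexists.
exact: (drvM (drvZ _ (drv_comp (drv_sinh t) (drv_powR _ (sinh_gt0 t0))))
  (drv_comp (drv_cosh t) (drv_powR _ (cosh_gt0 t)))).
Qed.

(** ** Lower bounds for the transform *)

Lemma integrable_drv (R : realType) (u v : R) (f : R -> R) :
  (forall t, u <= t <= v -> exists d, is_derive t 1 f d) ->
  lebesgue_measure.-integrable `[u, v] (EFin \o f).
Proof.
move=> df; apply: continuous_compact_integrable; first exact: segment_compact.
apply: derivable_within_continuous => t; rewrite in_itv/= => /df[d].
by case.
Qed.

(** For lambda <= 1 / v the kernel phi_lambda is bounded below on the whole
    support of the test function.  The function h is any minorant of the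
    resulting integrand, chosen so that its integral is easy to compute. *)
Lemma transform_ge (R : realType) (alpha beta zeta kappa sigma u v a b lambda x y Z : R)
    (h : R -> R) :
  beta <= alpha -> - 2^-1 <= beta -> - 2^-1 < alpha ->
  0 < u -> 0 < v -> 0 < lambda -> lambda * v <= 1 -> u <= x -> y <= v ->
  (forall t, x <= t <= y -> 0 <= h t <=
     t `^ (- kappa) * cutoff u v a b t *
     (expR (- (rho alpha beta * t)) * (1 + rho alpha beta * t) / 2) *
     jacobi_m alpha beta t) ->
  (Z%:E <= \int[lebesgue_measure]_(t in `[x, y]) (h t)%:E)%E ->
  (lambda ^+ 2 + zeta ^+ 2) `^ (- (sigma / 2)) * Z <=
  Normc.normc (jacobi_transform alpha beta zeta kappa sigma
    (fun t => (cutoff u v a b t)%:C%C) lambda).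
Proof.
move=> hab hb ha u0 v0 l0 lv ux yv hh hZ.
have [f [f1 [f2 [fs fE]]]] := @jacobi_phi_sol R alpha beta lambda hab hb ha.
have rE : rho alpha beta = (alpha + 2^-1) + (beta + 2^-1) by rewrite /rho; lra.
rewrite rE in fs.
have flow t : 0 <= t -> lambda * t <= 1 ->
   expR (- (rho alpha beta * t)) * (1 + rho alpha beta * t) / 2 <= f t.
  rewrite rE; apply: jacobi_sol_ge_half fs _; lra.
pose G t := t `^ (- kappa) * cutoff u v a b t * f t * jacobi_m alpha beta t.
have Gsupp t : ~~ (u <= t <= v) -> G t = 0.
  move=> tuv; rewrite /G cutoff_eq0 ?mulr0 ?mul0r//.
  by apply: contra tuv => /andP[/ltW -> /ltW ->].
have r0 : 0 <= rho alpha beta by rewrite /rho; lra.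
have ft0 t : 0 <= t <= v -> 0 <= f t.
  move=> /andP[t0 tv]; apply: le_trans (flow t t0 _).
    by rewrite mulr_ge0// mulr_ge0 ?expR_ge0// addr_ge0// mulr_ge0.
  by apply: le_trans lv; rewrite ler_wpM2l// ltW.
have G0 t : 0 <= G t.
  have [tuv|tuv] := boolP (u <= t <= v); last by rewrite Gsupp.
  rewrite /G; apply: mulr_ge0; last exact: jacobi_m_ge0.
  apply: mulr_ge0; last by apply: ft0; lra.
  by apply: mulr_ge0; [exact: powR_ge0|exact: cutoff_ge0].
have Gint : lebesgue_measure.-integrable `[u, v] (EFin \o G).
  apply: integrable_drv => t tuv; have t0 : 0 < t by lra.
  have [_ _ dfs] := fs; have [df _ _] := dfs t I.
  have [dm Dm] := jacobi_m_drv alpha beta t0.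
  have [_ db] := @smooth_on_derive R setT _ (@smooth_cutoff R u v a b u0 v0).
  eexists; exact: (drvM (drvM (drvM (drv_powR _ t0) (db t I)) df) Dm).
have GE := @integral_support R u v (EFin \o G) u0 _.
have {}GE : (\int[lebesgue_measure]_(t in `]0%R, +oo[) (G t)%:E =
   \int[lebesgue_measure]_(t in `[u, v]) (G t)%:E)%E.
  by apply: GE => t tuv /=; rewrite Gsupp.
have Gfin : (\int[lebesgue_measure]_(t in `[u, v]) (G t)%:E)%E \is a fin_num.
  exact: integrable_fin_num Gint.
have GZ : Z <= \int[lebesgue_measure]_(t in `]0%R, +oo[) G t.
  rewrite /Rintegral GE -lee_fin fineK//; apply: (le_trans hZ).
  apply: ge0_integral_mono => [t /=|t /=|t _]; rewrite ?in_itv/= ?lee_fin//.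
    by move=> /andP[xt ty]; rewrite (le_trans ux xt) (le_trans ty yv).
  move=> txy; have /andP[-> h2] := hh t txy; apply: (le_trans h2).
  rewrite /G; apply: ler_wpM2r; first exact: jacobi_m_ge0.
  apply: ler_wpM2l; first by apply: mulr_ge0; [exact: powR_ge0|exact: cutoff_ge0].
  apply: flow; first lra.
  by apply: le_trans lv; rewrite ler_wpM2l ?(ltW l0)//; lra.
rewrite /jacobi_transform Normc.normcM normc_real ger0_norm ?powR_ge0//.
rewrite ler_wpM2l ?powR_ge0//.
rewrite (_ : cintegral _ _ = (\int[lebesgue_measure]_(t in `]0%R, +oo[) G t)%:C%C).
  by rewrite normc_real; apply: le_trans GZ (ler_norm _).
have pE t : (t `^ (- kappa))%:C%C * (cutoff u v a b t)%:C%C * jacobi_phi alpha beta lambda t *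
    (jacobi_m alpha beta t)%:C%C = (G t)%:C%C :> R[i].
  by rewrite fE /G !rmorphM.
rewrite /cintegral; congr Complex; first by apply: eq_Rintegral => t _; rewrite pE.
rewrite (_ : (fun t => _) = (fun=> 0)); first by rewrite Rintegral_cst// mul0r.
by apply/funext => t; rewrite pE.
Qed.

(** The transform inequality for the functions cutoff u v a b, freed from
    extended reals: an upper bound X of the integral on the right and a lower
    bound Y of the one on the left are all that the applications compute. *)
Definition real_bound (R : realType) (alpha beta zeta p q kappa sigma C : R) :=
  forall u v a b X Y : R, 0 < u -> 0 < v -> 0 <= X -> 0 <= Y ->
    (\int[lebesgue_measure]_(t in `]0%R, +oo[)
       (cutoff u v a b t `^ p * jacobi_m alpha beta t)%:E <= X%:E)%E ->
    (Y%:E <= \int[lebesgue_measure]_(l in `]0%R, +oo[)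
       (Normc.normc (jacobi_transform alpha beta zeta kappa sigma
         (fun t => (cutoff u v a b t)%:C%C) l) `^ q * jacobi_n alpha beta l)%:E)%E ->
    Y `^ q^-1 <= C * X `^ p^-1.

Lemma bound_real (R : realType) (alpha beta zeta p q kappa sigma : R) :
  1 < p -> 1 < q ->
  (exists C : R, forall f : R -> R[i], test_function f ->
       (weighted_Lnorm q (jacobi_n alpha beta)
          (jacobi_transform alpha beta zeta kappa sigma f)
        <= C%:E * weighted_Lnorm p (jacobi_m alpha beta) f)%E) ->
  exists C, real_bound alpha beta zeta p q kappa sigma C.
Proof.
move=> p1 q1 [C HC]; exists `|C| => // u v a b X Y u0 v0 X0 Y0 hX hY.
have := HC _ (test_cutoff a b u0 v0); rewrite /weighted_Lnorm.
set IX := (X in (_ <= _ * X `^ _)%E); set IY := (X in (X `^ _ <= _)%E) => h.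
have IX0 : (0 <= IX)%E.
  by apply: integral_ge0 => t _; rewrite lee_fin mulr_ge0 ?powR_ge0 ?jacobi_m_ge0.
have IXX : (IX <= X%:E)%E.
  apply: le_trans hX; rewrite /IX.
  rewrite le_eqVlt; apply/orP; left; apply/eqP; apply: eq_integral => t _.
  by rewrite normc_real ger0_norm ?cutoff_ge0.
have q0 : 0 <= q^-1 by rewrite invr_ge0; lra.
have p0 : 0 <= p^-1 by rewrite invr_ge0; lra.
rewrite -lee_fin EFinM -!poweR_EFin.
apply: le_trans (_ : (IY `^ q^-1 <= _)%E).
  by apply: gt0_ler_poweR => //; rewrite ?in_itv/= ?leey ?lee_fin ?andbT//; apply: le_trans hY.
apply: (le_trans h); apply: le_trans (_ : (`|C|%:E * IX `^ p^-1 <= _)%E).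
  by rewrite lee_wpmul2r ?poweR_ge0// lee_fin ler_norm.
rewrite lee_wpmul2l ?lee_fin//.
by apply: gt0_ler_poweR => //; rewrite ?in_itv/= ?leey ?lee_fin ?andbT.
Qed.

(** * The necessary conditions *)

Lemma powRDp (R : realType) (x r s : R) : 0 < x -> x `^ (r + s) = x `^ r * x `^ s.
Proof. by move=> x0; rewrite powRD// (lt0r_neq0 x0) implybT. Qed.

Lemma powR_growth (R : realType) (c1 c2 e1 e2 : R) : 0 < c1 ->
  (forall T, 1 <= T -> c1 * T `^ e1 <= c2 * T `^ e2) -> e1 <= e2.
Proof.
move=> c10 H; rewrite leNgt; apply/negP => e12; have d0 : 0 < e1 - e2 by lra.
pose M := `|c2 / c1| + 1; have M1 : 1 <= M by rewrite lerDr.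
pose T := M `^ (e1 - e2)^-1.
have T1 : 1 <= T.
  apply: le_trans (_ : M `^ 0 <= _); first by rewrite powRr0.
  by apply: ler_powR => //; rewrite invr_ge0 ltW.
have T0 : 0 < T by lra.
have := H T T1; rewrite -{1}(subrK e2 e1) powRDp//.
rewrite mulrA ler_pM2r ?powR_gt0//; last lra.
rewrite /T -powRrM mulVf ?lt0r_neq0// powRr1; last lra.
rewrite mulrC -ler_pdivlMr// /M; have := ler_norm (c2 / c1); lra.
Qed.

(** The factor exp (eta T) dominates any power of T, through one term of its
    Taylor expansion. *)
Lemma exp_growth (R : realType) (c1 c2 e eta : R) : 0 < c1 ->
  (forall T, 1 <= T -> c1 * T `^ e * expR (eta * T) <= c2) -> eta <= 0.
Proof.
move=> c10 H; rewrite leNgt; apply/negP => eta0.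
pose k := (Num.trunc `|e|).+1; have ek : `|e| <= k%:R := ltW (truncnS_gt _).
pose d := c1 * eta ^+ k.+1 / k.+1`!%:R.
have f0 : 0 < k.+1`!%:R :> R by rewrite ltr0n fact_gt0.
have d0 : 0 < d by rewrite divr_gt0// mulr_gt0// exprn_gt0.
suff dT T : 1 <= T -> d * T <= c2.
  have := dT (`|c2| / d + 1); rewrite lerDr divr_ge0 ?(ltW d0)// => /(_ isT).
  rewrite mulrDr mulr1 mulrCA divff ?lt0r_neq0// mulr1.
  by have := ler_norm c2; lra.
move=> T1; have T0 : 0 < T by lra.
apply: le_trans (H T T1).
have h1 : (T ^+ k)^-1 <= T `^ e.
  have -> : T ^- k = T `^ (- k%:R) by rewrite powRN powR_mulrn// ltW.
  apply: ler_powR => //.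
  by move: ek; rewrite ler_norml => /andP[].
have h2 : (eta * T) ^+ k.+1 / k.+1`!%:R <= expR (eta * T).
  by have := expR_ge1Dxn k (mulr_ge0 (ltW eta0) (ltW T0)); lra.
have -> : d * T = c1 * (T ^+ k)^-1 * ((eta * T) ^+ k.+1 / k.+1`!%:R).
  rewrite /d exprMn [T ^+ k.+1]exprS; field.
  by rewrite !lt0r_neq0// exprn_gt0.
apply: ler_pM => //.
- by rewrite mulr_ge0 ?(ltW c10)// invr_ge0 exprn_ge0// ltW.
- by rewrite divr_ge0 ?(ltW f0)// exprn_ge0// mulr_ge0// ltW.
- by rewrite ler_wpM2l// ltW.
Qed.

Lemma powR_norm_mul (R : realType) (q y n : R) : 0 < q -> 0 <= y -> 0 <= n ->
  (y `^ q * n) `^ q^-1 = y * n `^ q^-1.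
Proof.
move=> q0 y0 n0; rewrite powRM ?powR_ge0// -powRrM divff ?lt0r_neq0//.
by rewrite powRr1.
Qed.

(** The common part of the two scaling arguments: all quantities are
    replaced by constant bounds, x0 and k0 in the variable t, s0 and n0 in the
    variable lambda, so that the integrals become lengths of intervals. *)
Lemma box_bound (R : realType)
    (alpha beta zeta p q kappa sigma C u b x0 k0 s0 n0 l1 l2 : R) :
  beta <= alpha -> - 2^-1 <= beta -> - 2^-1 < alpha -> 1 < p -> 1 < q ->
  real_bound alpha beta zeta p q kappa sigma C ->
  0 < u -> 0 < l1 -> l1 <= l2 -> l2 * (8 * u) <= 1 ->
  0 <= x0 -> 0 <= k0 -> 0 <= s0 -> 0 <= n0 ->
  (forall t, 2 * u <= t <= 4 * u ->
     k0 <= t `^ (- kappa) * (expR (- 4) * expR (- (b * t))) *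
     (expR (- (rho alpha beta * t)) * (1 + rho alpha beta * t) / 2) *
     jacobi_m alpha beta t) ->
  (forall t, u <= t <= 8 * u -> expR (- (b * t)) `^ p * jacobi_m alpha beta t <= x0) ->
  (forall l, l1 <= l <= l2 ->
     s0 <= (l ^+ 2 + zeta ^+ 2) `^ (- (sigma / 2)) /\ n0 <= jacobi_n alpha beta l) ->
  s0 * (k0 * (2 * u)) * (n0 * (l2 - l1)) `^ q^-1 <= C * (x0 * (7 * u)) `^ p^-1.
Proof.
move=> hab hb ha p1 q1 HC u0 l10 l12 lu x00 k00 s00 n00 hk hx hs.
have v0 : 0 < 8 * u by lra.
have c1 t : cutoff u (8 * u) 0 b t <= expR (- (b * t)).
  by have := cutoff_le u (8 * u) 0 b t; rewrite oppr0 powRr0 mul1r.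
have kk : 0 <= s0 * (k0 * (2 * u)) by rewrite !mulr_ge0// ltW.
have ll : 0 <= l2 - l1 by lra.
have nl : 0 <= n0 * (l2 - l1) by rewrite mulr_ge0.
rewrite -powR_norm_mul//; last lra.
apply: (HC u (8 * u) 0 b) => //.
- by rewrite !mulr_ge0// ltW.
- by rewrite mulr_ge0 ?powR_ge0.
- rewrite (@integral_support R u (8 * u))//; last first.
    move=> t tuv; rewrite cutoff_eq0//; last by apply: contra tuv => /andP[/ltW -> /ltW ->].
    by rewrite powR0 ?mul0r//; apply: lt0r_neq0; lra.
  have -> : x0 * (7 * u) = x0 * (8 * u - u) by ring.
  rewrite -integral_cst_itv; last lra.
  apply: ge0_integral_mono => [//|t /=|t _]; rewrite ?lee_fin// in_itv/= => tu.
  rewrite mulr_ge0 ?powR_ge0 ?jacobi_m_ge0//=; apply: le_trans (hx t tu).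
  rewrite ler_wpM2r ?jacobi_m_ge0//; apply: ge0_ler_powR; rewrite ?nnegrE ?cutoff_ge0 ?expR_ge0//.
  lra.
- rewrite mulrA -integral_cst_itv//.
  apply: ge0_integral_mono => [l /=|l /=|l _].
  + by rewrite !in_itv/= andbT => /andP[ll1 _]; exact: lt_le_trans ll1.
  + rewrite in_itv/= => hl; rewrite !lee_fin mulr_ge0 ?powR_ge0//=.
    have [h1 h2] := hs l hl; apply: ler_pM => //; first exact: powR_ge0.
    have l0 : 0 < l by lra.
    apply: ge0_ler_powR; rewrite ?nnegrE ?normc_ge0//; first lra.
    apply: le_trans (_ : (l ^+ 2 + zeta ^+ 2) `^ (- (sigma / 2)) * (k0 * (2 * u)) <= _).
      by rewrite ler_wpM2r// mulr_ge0//; lra.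
    apply: (@transform_ge R alpha beta zeta kappa sigma u (8 * u) 0 b l (2 * u) (4 * u) _ (fun=> k0)) => //.
    * by apply: le_trans lu; rewrite ler_wpM2r//; lra.
    * by lra.
    * by lra.
    * move=> t tu; rewrite k00/=; apply: le_trans (hk t tu) _.
      have rt : 0 <= rho alpha beta * t by rewrite mulr_ge0 /rho; lra.
      apply: ler_wpM2r; first exact: jacobi_m_ge0.
      apply: ler_wpM2r; first by rewrite mulr_ge0// mulr_ge0 ?expR_ge0//; lra.
      apply: ler_wpM2l; first exact: powR_ge0.
      have := @cutoff_ge R u (8 * u) 0 b t u0 v0; rewrite oppr0 powRr0 mul1r.
      by apply; lra.
    * rewrite integral_cst_itv ?lee_fin; last lra.
      by rewrite le_eqVlt; apply/orP; left; apply/eqP; ring.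
  + by rewrite lee_fin mulr_ge0 ?powR_ge0 ?jacobi_n_ge0.
Qed.

(** Test functions exp (- 2 rho t / p) on [T, 8 T] against frequencies of size
    1 / T.  Then |f|^p m is of size 1, whereas f phi m is of size
    T exp (rho (1 - 2 / p) T).  The exponent s measures the multiplier, which is
    of size T^sigma or 1 according to whether zeta vanishes. *)
Lemma low_frequency_growth (R : realType) (alpha beta zeta p q kappa sigma C s S : R) :
  beta <= alpha -> - 2^-1 <= beta -> - 2^-1 < alpha -> 1 < q -> 2 <= p ->
  real_bound alpha beta zeta p q kappa sigma C -> 0 < S ->
  (forall T l, 1 <= T -> (16 * T)^-1 <= l <= (8 * T)^-1 ->
     S * T `^ s <= (l ^+ 2 + zeta ^+ 2) `^ (- (sigma / 2))) ->
  exists K C' : R, 0 < K /\ forall T, 1 <= T ->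
    K * T `^ (s - kappa + 2 - 3 / q) * expR (rho alpha beta * (1 - 2 / p) * T)
    <= C' * T `^ p^-1.
Proof.
move=> hab hb ha q1 p2 HC S0 hS.
have [cn [cn0 hn _]] := jacobi_n_ge hab hb ha.
have [cm [Cm [cm0 Cm0 hm]]] := jacobi_m_large hb ha.
set r := rho alpha beta; have r0 : 0 < r by rewrite /r /rho; lra.
have [K1 K10 K1E] : exists2 K1 : R, 0 < K1 & K1 = 4 `^ (- `|- kappa|) * expR (- 4) * r * cm.
  by eexists; last reflexivity; do ! apply: mulr_gt0 => //; rewrite ?powR_gt0 ?expR_gt0.
have q0 : 0 < q by lra.
have p0 : 0 < p by lra.
have [w w0 wE] : exists2 w : R, 0 < w & w = cn * 16^-1 ^+ 3.
  by eexists; last reflexivity; rewrite mulr_gt0// exprn_gt0// invr_gt0.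
exists (S * K1 * 2 * w `^ q^-1), (C * (Cm * 7) `^ p^-1); split.
  by apply: mulr_gt0; [apply: mulr_gt0 => //; apply: mulr_gt0|exact: powR_gt0].
move=> T T1; have T0 : 0 < T by lra.
(* with this b, the p-th power of exp (- b t) cancels m(t) ~ exp (2 rho t) *)
pose b := 2 * r / p; pose eta := r * (1 - 2 / p).
have p12 : 2 / p <= 1 by rewrite ler_pdivrMr// mul1r.
have eta0 : 0 <= eta by rewrite mulr_ge0; lra.
pose k0 := K1 * (T `^ (- kappa) * T) * expR (eta * T).
pose n0 := cn * (16 * T)^-1 ^+ 2.
have Tn0 : T != 0 by exact: lt0r_neq0.
have := @box_bound R alpha beta zeta p q kappa sigma C T b Cm k0 (S * T `^ s)
   n0 (16 * T)^-1 (8 * T)^-1 hab hb ha ltac:(lra) q1 HC T0.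
have -> : (8 * T)^-1 - (16 * T)^-1 = (16 * T)^-1 by field; exact: Tn0.
have -> : n0 * (16 * T)^-1 = w * T `^ (- 3).
  by rewrite wE powRN powR_mulrn ?ltW// /n0 -mulrA -exprSr invfM exprMn [T^-1 ^+ 3]exprVn mulrA.
move=> H; have {}H := H _ _ _ _ _ _ _ _ _ _.
have E1 : (w * T `^ (- 3)) `^ q^-1 = (w) `^ q^-1 * T `^ (- (3 / q)).
  by rewrite powRM ?powR_ge0 ?(ltW w0)// -powRrM mulNr.
have E2 : (Cm * (7 * T)) `^ p^-1 = (Cm * 7) `^ p^-1 * T `^ p^-1.
  by rewrite mulrA powRM ?mulr_ge0 ?(ltW Cm0) ?(ltW T0).
rewrite E1 E2 in H.
have E3 : T `^ (s - kappa + 2 - 3 / q) = T `^ s * T `^ (- kappa) * T * T * T `^ (- (3 / q)).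
  have TD x y : T `^ (x + y) = T `^ x * T `^ y.
    exact: powRDp.
  rewrite TD (TD (s - kappa) 2) (TD s); have -> : T `^ 2 = T * T by rewrite powR_mulrn ?ltW// expr2.
  by rewrite !mulrA.
rewrite E3.
have -> : S * K1 * 2 * (w) `^ q^-1 *
   (T `^ s * T `^ (- kappa) * T * T * T `^ (- (3 / q))) * expR (r * (1 - 2 / p) * T) =
   S * T `^ s * (k0 * (2 * T)) * ((w) `^ q^-1 * T `^ (- (3 / q))).
  by rewrite /k0 /eta; ring.
have -> : C * (Cm * 7) `^ p^-1 * T `^ p^-1 = C * ((Cm * 7) `^ p^-1 * T `^ p^-1) by ring.
apply: H.
- by rewrite invr_gt0; lra.
- by rewrite lef_pV2 ?posrE; clear - T0; lra.
- by rewrite mulVf//; apply: lt0r_neq0; lra.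
- exact: ltW.
- by rewrite /k0 !mulr_ge0 ?expR_ge0 ?powR_ge0// ltW.
- by rewrite mulr_ge0 ?powR_ge0// ltW.
- by rewrite /n0 mulr_ge0 ?sqr_ge0// ltW.
- move=> t tT; have t0 : 0 < t by clear - T0 tT; lra.
  have /andP[m1 _] := hm t ltac:(lra).
  have k1 := @powR_ge_near R 4 T t (- kappa) ltac:(clear; lra) T0 ltac:(clear - T0 tT; lra).
  have e1 : expR (eta * T) <= expR (- (b * t)) * expR (- (r * t)) * expR (2 * r * t).
    rewrite -!expRD ler_expR.
    have -> : - (b * t) + - (r * t) + 2 * r * t = eta * t by rewrite /b /eta; field; exact: lt0r_neq0.
    by rewrite ler_wpM2l//; lra.
  have rt : r * T <= (1 + r * t) / 2 by nra.
  have rT0 : 0 <= r * T by rewrite mulr_ge0// ltW.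
  apply: le_trans (_ : t `^ (- kappa) * (expR (- 4) * expR (- (b * t))) *
     (expR (- (r * t)) * (1 + r * t) / 2) * (cm * expR (2 * r * t)) <= _); last first.
    apply: ler_wpM2l m1; rewrite !mulr_ge0 ?powR_ge0 ?expR_ge0//; clear - rt rT0; lra.
  have -> : t `^ (- kappa) * (expR (- 4) * expR (- (b * t))) *
     (expR (- (r * t)) * (1 + r * t) / 2) * (cm * expR (2 * r * t)) =
    (expR (- 4) * cm) * (t `^ (- kappa) * ((1 + r * t) / 2)) *
    (expR (- (b * t)) * expR (- (r * t)) * expR (2 * r * t)) by ring.
  have -> : k0 = (expR (- 4) * cm) * ((4 `^ (- `|- kappa|) * T `^ (- kappa)) * (r * T)) *
      expR (eta * T) by rewrite /k0 K1E; ring.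
  apply: ler_pM => //; rewrite ?expR_ge0 ?mulr_ge0 ?expR_ge0 ?powR_ge0 ?(ltW cm0) ?(ltW r0) ?(ltW T0)//.
  apply: ler_wpM2l; first by rewrite mulr_ge0 ?expR_ge0// ltW.
  by apply: ler_pM => //; rewrite mulr_ge0 ?powR_ge0.
- move=> t tT; have /andP[_ m2] := hm t ltac:(lra).
  rewrite /powR gt_eqF ?expR_gt0// expRK.
  apply: le_trans (ler_wpM2l (expR_ge0 _) m2) _.
  rewrite mulrCA -expRD -/r (_ : _ + _ = 0) ?expR0 ?mulr1//.
  by rewrite /b; field; exact: lt0r_neq0.
- move=> l hl; split; first exact: hS.
  have /andP[l1 l2] := hl; have l0 : 0 < l by apply: lt_le_trans l1; rewrite invr_gt0; clear - T0; lra.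
  have l01 : l <= 1 by apply: (le_trans l2); rewrite invf_le1; clear - T1; lra.
  apply: le_trans (hn l _); last by rewrite l0.
  by rewrite /n0 ler_wpM2l ?(ltW cn0)// lerXn2r ?nnegrE ?invr_ge0 ?(ltW l0)//; clear - T0; lra.
Qed.

(** Test functions on [u, 8 u] with u = 1 / (16 T) against frequencies between T
    and 2 T = 1 / (8 u).  At this scale m and n are powers with exponent
    2 alpha + 1, as for the Hankel transform in dimension 2 (alpha + 1), and
    condition (N) is homogeneity. *)
Lemma high_frequency_cond (R : realType) (alpha beta zeta p q kappa sigma C : R) :
  beta <= alpha -> - 2^-1 <= beta -> - 2^-1 < alpha -> 1 < p -> 1 < q ->
  real_bound alpha beta zeta p q kappa sigma C ->
  2 * (alpha + 1) * (p^-1 + q^-1 - 1) <= sigma - kappa.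
Proof.
move=> hab hb ha p1 q1 HC.
have [cn [cn0 _ hn]] := jacobi_n_ge hab hb ha.
have [cm [Cm [cm0 Cm0 hm]]] := jacobi_m_small hb ha.
set r := rho alpha beta; have r0 : 0 < r by rewrite /r /rho; lra.
have [A A0 AE] : exists2 A : R, 0 <= A & A = 2 * alpha + 1.
  by eexists; last reflexivity; lra.
rewrite -AE in hn hm.
pose k := 4 + zeta ^+ 2; have k1 : 1 <= k by rewrite /k; have := sqr_ge0 zeta; lra.
have [S S0 SE] : exists2 S : R, 0 < S & S = k `^ (- `|- (sigma / 2)|).
  by eexists; last reflexivity; rewrite powR_gt0; lra.
have [K1 K10 K1E] : exists2 K1 : R, 0 < K1 &
    K1 = 4 `^ (- `|- kappa|) * expR (- 4) * (expR (- r) / 2) * cm.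
  eexists; last reflexivity.
  by do ! apply: mulr_gt0 => //; rewrite ?powR_gt0 ?expR_gt0 ?invr_gt0.
have q0 : 0 < q by lra.
have p0 : 0 < p by lra.
suff H T : 1 <= T ->
    S * (K1 * (16 `^ (kappa - A))) * (8^-1) * cn `^ q^-1 *
     T `^ (- sigma + kappa - (A + 1) + (A + 1) / q) <=
    C * (Cm * 8 `^ A * 16 `^ (- A) * (7 / 16)) `^ p^-1 * T `^ (- ((A + 1) / p)).
  have c0 : 0 < S * (K1 * (16 `^ (kappa - A))) * (8^-1) * cn `^ q^-1.
    by do ! apply: mulr_gt0 => //; rewrite ?powR_gt0 ?invr_gt0.
  have := powR_growth c0 H; rewrite AE => h.
  have -> : 2 * (alpha + 1) * (p^-1 + q^-1 - 1) =
    (2 * alpha + 1 + 1) / p + (2 * alpha + 1 + 1) / q - (2 * alpha + 1 + 1) by ring.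
  lra.
move=> T1; have T0 : 0 < T by lra.
have Tn0 : T != 0 by exact: lt0r_neq0.
pose u := (16 * T)^-1; have u0 : 0 < u by rewrite invr_gt0; lra.
have uT : u * (16 * T) = 1 by rewrite /u mulVf//; apply: lt0r_neq0; lra.
have u16 : 16 * u <= 1 by nra.
have uE e : u `^ e = 16 `^ (- e) * T `^ (- e).
  rewrite /u -powR_inv1; last lra.
  by rewrite -powRrM mulN1r powRM// ltW.
have TD x y : T `^ (x + y) = T `^ x * T `^ y by exact: powRDp.
pose k0 := K1 * u `^ (A - kappa).
have TA : 1 <= T by [].
have := @box_bound R alpha beta zeta p q kappa sigma C u 0 (Cm * (8 * u) `^ A) k0
  (S * T `^ (- sigma)) (cn * T `^ A) T (2 * T) hab hb ha p1 q1 HC u0 T0.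
have -> : 2 * T - T = T by ring.
have -> : cn * T `^ A * T = cn * T `^ (A + 1) by rewrite TD (powRr1 (ltW T0)) mulrA.
have -> : (cn * T `^ (A + 1)) `^ q^-1 = cn `^ q^-1 * T `^ ((A + 1) / q).
  by rewrite powRM ?powR_ge0 ?(ltW cn0)// -powRrM.
have -> : Cm * (8 * u) `^ A * (7 * u) = (Cm * 8 `^ A * 16 `^ (- A) * (7 / 16)) * T `^ (- (A + 1)).
  rewrite powRM ?(ltW u0)// uE opprD TD [T `^ (- 1)]powR_inv1; last lra.
  by rewrite /u; field; exact: Tn0.
have -> : ((Cm * 8 `^ A * 16 `^ (- A) * (7 / 16)) * T `^ (- (A + 1))) `^ p^-1 =
   (Cm * 8 `^ A * 16 `^ (- A) * (7 / 16)) `^ p^-1 * T `^ (- ((A + 1) / p)).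
  by rewrite powRM ?powR_ge0 ?mulr_ge0 ?powR_ge0 ?divr_ge0 ?(ltW Cm0)// -powRrM mulNr.
have -> : S * T `^ (- sigma) * (k0 * (2 * u)) * (cn `^ q^-1 * T `^ ((A + 1) / q)) =
   S * (K1 * 16 `^ (kappa - A)) / 8 * cn `^ q^-1 *
   T `^ (- sigma + kappa - (A + 1) + (A + 1) / q).
  have -> : - sigma + kappa - (A + 1) + (A + 1) / q =
    - sigma + ((kappa - A) + (- 1 + (A + 1) / q)) by ring.
  rewrite (TD (- sigma)) (TD (kappa - A)) (TD (- 1)) /k0 uE opprB [T `^ (- 1)]powR_inv1; last lra.
  by rewrite /u; field; rewrite ?Tn0 ?(lt0r_neq0 q0).
move=> bb; rewrite -[leRHS]mulrA; apply: bb.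
- by lra.
- by nra.
- by rewrite mulr_ge0 ?powR_ge0// ltW.
- by rewrite /k0 mulr_ge0 ?powR_ge0// ltW.
- by rewrite mulr_ge0 ?powR_ge0// ltW.
- by rewrite mulr_ge0 ?powR_ge0// ltW.
- move=> t tu; have t0 : 0 < t by lra.
  have t1 : t <= 1 by lra.
  have /andP[m1 _] := hm t ltac:(lra).
  have kp := @powR_ge_near R 4 u t (- kappa) ltac:(clear; lra) u0 ltac:(clear - u0 tu; lra).
  have tA : u `^ A <= t `^ A by apply: ge0_ler_powR; rewrite ?nnegrE//; clear - u0 tu; lra.
  have e1 : expR (- r) / 2 <= expR (- (r * t)) * (1 + r * t) / 2.
    rewrite ler_wpM2r// -[leLHS]mulr1; apply: ler_pM; rewrite ?expR_ge0//.
      by rewrite ler_expR lerN2 -[leRHS]mulr1 ler_wpM2l// ltW.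
    by rewrite lerDl mulr_ge0// ltW.
  rewrite mul0r oppr0 expR0 mulr1.
  have uD : u `^ (A - kappa) = u `^ (- kappa) * u `^ A.
    by rewrite addrC powRDp.
  have -> : k0 = (4 `^ (- `|- kappa|) * u `^ (- kappa)) * expR (- 4) * (expR (- r) / 2) *
     (cm * u `^ A) by rewrite /k0 uD K1E; ring.
  apply: ler_pM; rewrite ?mulr_ge0 ?powR_ge0 ?expR_ge0 ?(ltW cm0)//.
    apply: ler_pM => //; rewrite ?mulr_ge0 ?powR_ge0 ?expR_ge0//.
    by rewrite ler_wpM2r ?expR_ge0.
  by apply: le_trans m1; rewrite ler_wpM2l// ltW.
- move=> t tu; have /andP[_ m2] := hm t ltac:(lra).
  rewrite mul0r oppr0 expR0 powR1 mul1r; apply: (le_trans m2).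
  rewrite ler_wpM2l ?(ltW Cm0)//; apply: ge0_ler_powR; rewrite ?nnegrE//; clear - u0 tu; lra.
- move=> l /andP[l1 l2]; have l0 : 1 <= l by lra.
  split.
    have -> : T `^ (- sigma) = (T ^+ 2) `^ (- (sigma / 2)).
      rewrite -powR_mulrn ?(ltW T0)// -powRrM; congr (_ `^ _).
      by field.
    rewrite SE; apply: powR_ge_near => //; first exact: exprn_gt0.
    have z2 := sqr_ge0 zeta; have T2 : 1 <= T ^+ 2 by rewrite exprn_ege1.
    have lT : T ^+ 2 <= l ^+ 2 by rewrite lerXn2r ?nnegrE//; clear - T0 l1; lra.
    have lT2 : l ^+ 2 <= 4 * T ^+ 2 by nra.
    apply/andP; split.
      rewrite ler_pdivrMr; last lra.
      by nra.
    by rewrite /k; nra.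
  apply: le_trans (hn l l0); rewrite ler_wpM2l ?(ltW cn0)//.
  by apply: ge0_ler_powR; rewrite ?nnegrE//; clear - T0 l1; lra.
Qed.

Lemma integral_cinv (R : realType) (x y c : R) : 0 < x -> x < y ->
  (\int[lebesgue_measure]_(t in `[x, y]) (c * t^-1)%:E = (c * (ln y - ln x))%:E)%E.
Proof.
move=> x0 xy.
have dF t : x <= t -> (is_derive t 1 (fun s : R => c * ln s) (c * t^-1)).
  by move=> xt; apply: drvZ; apply: is_derive1_ln; lra.
have df t : x <= t -> derivable (fun s : R => c * s^-1) t 1.
  move=> xt; have t0 : t != 0 by apply: lt0r_neq0; lra.
  by case: (drvZ c (drvV (drv_id t) t0)).
rewrite (@continuous_FTC2 R (fun t => c * t^-1) (fun t => c * ln t))//.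
- by rewrite -EFinB mulrBr.
- apply: derivable_within_continuous => t; rewrite in_itv/= => /andP[xt _].
  exact: df.
- split.
  + by move=> t; rewrite in_itv/= => /andP[xt _]; case: (dF t (ltW xt)).
  + apply: cvg_at_right_filter; apply: is_derive_continuous (dF x _) => //.
  + apply: cvg_at_left_filter; apply: is_derive_continuous (dF y _); exact: ltW.
- by move=> t; rewrite in_itv/= => /andP[xt _]; rewrite derive1E; case: (dF t (ltW xt)).
Qed.

(** If sigma q >= 3 and zeta = 0 then |lambda|^(- sigma q) n(lambda) is not
    integrable at 0, where the integral against phi_lambda of a positive function
    is bounded below. *)
Lemma zero_frequency_cond (R : realType) (alpha beta p q kappa sigma C : R) :
  beta <= alpha -> - 2^-1 <= beta -> - 2^-1 < alpha -> 1 < p -> 1 < q ->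
  real_bound alpha beta 0 p q kappa sigma C -> sigma * q < 3.
Proof.
move=> hab hb ha p1 q1 HC; rewrite ltNge; apply/negP => sq.
have [cn [cn0 hn _]] := jacobi_n_ge hab hb ha.
have [cm [Cm [cm0 Cm0 hm]]] := jacobi_m_small hb ha.
set r := rho alpha beta in hn hm *; have r0 : 0 < r by rewrite /r /rho; lra.
have [A A0 AE] : exists2 A : R, 0 <= A & A = 2 * alpha + 1.
  by eexists; last reflexivity; lra.
rewrite -AE in hm.
have q0 : 0 < q by lra.
have p0 : 0 < p by lra.
have [h0 h00 h0E] : exists2 h0 : R, 0 < h0 &
    h0 = 2 `^ (- `|- kappa|) * 2^-1 `^ (- kappa) * expR (- 4) *
         (expR (- r) / 2) * (cm * (2 `^ (- `|A|) * 2^-1 `^ A)).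
  eexists; last reflexivity.
  by do ! apply: mulr_gt0 => //; rewrite ?powR_gt0 ?expR_gt0 ?invr_gt0.
have [Z Z0 ZE] : exists2 Z : R, 0 < Z & Z = h0 * (2^-1 - 4^-1).
  by eexists; last reflexivity; apply: mulr_gt0 => //; lra.
have [w w0 wE] : exists2 w : R, 0 < w & w = Z `^ q * cn.
  by eexists; last reflexivity; rewrite mulr_gt0 ?powR_gt0.
pose D := C * Cm `^ p^-1.
suff H M : 0 < M -> (w * M) `^ q^-1 <= D.
  have D0 : 0 <= D by apply: le_trans (H 1 ltr01); exact: powR_ge0.
  have M0 : 0 < (D `^ q + 1) / w by rewrite divr_gt0// ltr_pwDr// powR_ge0.
  have := H _ M0; rewrite mulrCA divff ?lt0r_neq0// mulr1 => h.
  have : ((D `^ q + 1) `^ q^-1) `^ q <= D `^ q.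
    by apply: ge0_ler_powR; rewrite ?nnegrE ?powR_ge0// ltW.
  rewrite -powRrM mulVf ?lt0r_neq0// powRr1; last by rewrite addr_ge0 ?powR_ge0.
  by lra.
move=> M0; pose e := expR (- M).
have e0 : 0 < e := expR_gt0 _.
have e1 : e < 1 by rewrite /e -expR0 ltr_expR; lra.
have v0 : 0 < 8^-1 :> R by lra.
apply: (HC 8^-1 1 0 0) => //.
- exact: ltW.
- by rewrite mulr_ge0// ltW.
- rewrite (@integral_support R 8^-1 1)//; last first.
    move=> t tuv; rewrite cutoff_eq0//; last by apply: contra tuv => /andP[/ltW -> /ltW ->].
    by rewrite powR0 ?mul0r//; apply: lt0r_neq0; lra.
  apply: (@le_trans _ _ (Cm * (1 - 8^-1))%:E); last first.
    by rewrite lee_fin -[leRHS]mulr1 ler_wpM2l ?(ltW Cm0)//; lra.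
  rewrite -integral_cst_itv; last lra.
  apply: ge0_integral_mono => [//|t /=|t _]; rewrite ?lee_fin ?(ltW Cm0)// in_itv/= => tu.
  have t0 : 0 < t by lra.
  have t01 : 0 < t <= 1 by rewrite t0; case/andP: tu.
  rewrite mulr_ge0 ?powR_ge0 ?jacobi_m_ge0//=.
  have c1 : cutoff 8^-1 1 0 0 t `^ p <= 1.
    have -> : 1 = 1 `^ p :> R by rewrite powR1.
    apply: ge0_ler_powR; rewrite ?nnegrE ?cutoff_ge0 ?(ltW p0)//.
    by apply: le_trans (cutoff_le _ _ _ _ _) _; rewrite oppr0 powRr0 mul0r oppr0 expR0 mulr1.
  have m1 : jacobi_m alpha beta t <= Cm.
    have /andP[_ m2] := hm t t01; apply: (le_trans m2).
    rewrite -[leRHS]mulr1 ler_wpM2l ?(ltW Cm0)// -(powRr0 t).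
    exact: ger_powR.
  by rewrite -[leRHS]mul1r; apply: ler_pM; rewrite ?powR_ge0 ?jacobi_m_ge0.
have -> : w * M = w * (ln 1 - ln e) by rewrite ln1 /e expRK; ring.
rewrite -integral_cinv//.
apply: ge0_integral_mono => [l /=|l /=|l _].
- by rewrite !in_itv/= andbT => /andP[le _]; exact: lt_le_trans le.
- rewrite in_itv/= => /andP[le l1]; have l0 : 0 < l := lt_le_trans e0 le.
  have l01 : 0 < l <= 1 by rewrite l0.
  rewrite !lee_fin divr_ge0 ?(ltW w0) ?(ltW l0)//=.
  have Jl : l `^ (- sigma) * Z <= Normc.normc (jacobi_transform alpha beta 0 kappa sigma
         (fun t => (cutoff 8^-1 1 0 0 t)%:C%C) l).
    have -> : l `^ (- sigma) = (l ^+ 2 + 0 ^+ 2) `^ (- (sigma / 2)).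
      rewrite expr0n/= addr0 -powR_mulrn ?(ltW l0)// -powRrM; congr (_ `^ _).
      by field.
    apply: (@transform_ge R alpha beta 0 kappa sigma 8^-1 1 0 0 l 4^-1 2^-1 _ (fun=> h0)) => //.
    + by rewrite mulr1.
    + by lra.
    + by lra.
    + move=> t tu; rewrite (ltW h00)/=; have t0 : 0 < t by lra.
      have /andP[m1 _] := hm t ltac:(lra).
      have kp := @powR_ge_near R 2 2^-1 t (- kappa) ltac:(clear; lra) ltac:(clear; lra) ltac:(clear - tu; lra).
      have kA := @powR_ge_near R 2 2^-1 t A ltac:(clear; lra) ltac:(clear; lra) ltac:(clear - tu; lra).
      have cF : expR (- 4) <= cutoff 8^-1 1 0 0 t.
        have := @cutoff_ge R 8^-1 1 0 0 t v0 ltr01.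
        rewrite oppr0 powRr0 mul0r oppr0 expR0 !mulr1; apply; lra.
      have e1r : expR (- r) / 2 <= expR (- (r * t)) * (1 + r * t) / 2.
        rewrite ler_wpM2r// -[leLHS]mulr1; apply: ler_pM; rewrite ?expR_ge0//.
          by rewrite ler_expR lerN2 -[leRHS]mulr1 ler_wpM2l ?(ltW r0)//; lra.
        by rewrite lerDl mulr_ge0// ltW.
      rewrite h0E; apply: ler_pM; rewrite ?mulr_ge0 ?powR_ge0 ?expR_ge0 ?(ltW cm0)//; last first.
        by apply: le_trans m1; rewrite ler_wpM2l// ltW.
      apply: ler_pM; rewrite ?mulr_ge0 ?powR_ge0 ?expR_ge0//.
      by apply: ler_pM; rewrite ?mulr_ge0 ?powR_ge0 ?expR_ge0.
    + by rewrite integral_cst_itv ?ZE//; lra.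
  apply: le_trans (_ : (l `^ (- sigma) * Z) `^ q * (cn * l ^+ 2) <= _); last first.
    apply: ler_pM; [exact: powR_ge0|by rewrite mulr_ge0 ?sqr_ge0// ltW| |exact: hn].
    apply: ge0_ler_powR => //; rewrite ?nnegrE ?normc_ge0 ?(ltW q0)//.
    by rewrite mulr_ge0 ?powR_ge0// ltW.
  rewrite wE powRM ?powR_ge0 ?(ltW Z0)// -powRrM mulNr.
  have -> : l `^ (- (sigma * q)) * Z `^ q * (cn * l ^+ 2) =
     Z `^ q * cn * (l `^ (- (sigma * q)) * l ^+ 2) by ring.
  apply: ler_wpM2l; first by rewrite mulr_ge0 ?powR_ge0// ltW.
  rewrite -powR_inv1 ?(ltW l0)// -powR_mulrn ?(ltW l0)// -powRDp//.
  by apply: ger_powR => //; lra.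
- by rewrite lee_fin mulr_ge0 ?powR_ge0 ?jacobi_n_ge0.
Qed.

(** If kappa p' >= 2 (alpha + 1) the extremal function for Hoelder's inequality
    is t^(- kappa / (p - 1)).  For its truncation f to ]d, 1[ one has
    |f|^p m <= t^(- kappa) f m.  The integral X of the right-hand side also bounds
    the transform from below for frequencies of size 1, so that
    X <= const X^(1 / p); but X is at least a multiple of the integral of 1 / t
    over [2 d, 1 / 2], which is unbounded as d tends to 0. *)
Lemma origin_cond (R : realType) (alpha beta zeta p q kappa sigma C : R) :
  beta <= alpha -> - 2^-1 <= beta -> - 2^-1 < alpha -> 1 < p -> 1 < q ->
  real_bound alpha beta zeta p q kappa sigma C ->
  kappa * (p / (p - 1)) < 2 * (alpha + 1).
Proof.
move=> hab hb ha p1 q1 HC; rewrite ltNge; apply/negP => kp.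
have [cn [cn0 hn _]] := jacobi_n_ge hab hb ha.
have [cm [Cm [cm0 Cm0 hm]]] := jacobi_m_small hb ha.
set r := rho alpha beta in hn hm *; have r0 : 0 < r by rewrite /r /rho; lra.
have [A A0 AE] : exists2 A : R, 0 <= A & A = 2 * alpha + 1.
  by eexists; last reflexivity; lra.
rewrite -AE in hm.
have q0 : 0 < q by lra.
have p0 : 0 < p by lra.
have pp : 0 < p - 1 by lra.
pose a := kappa / (p - 1).
have ka : A + 1 <= kappa + a.
  have -> : kappa + a = kappa * (p / (p - 1)).
    by rewrite /a; field; exact: lt0r_neq0.
  by rewrite AE; lra.
have ap : a * (p - 1) = kappa by rewrite /a mulfVK// lt0r_neq0.
pose k := 4 + zeta ^+ 2; have k1 : 1 <= k by rewrite /k; have := sqr_ge0 zeta; lra.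
have [S S0 SE] : exists2 S : R, 0 < S & S = k `^ (- `|- (sigma / 2)|).
  by eexists; last reflexivity; rewrite powR_gt0; lra.
have [c5 c50 c5E] : exists2 c5 : R, 0 < c5 & c5 = expR (- r) / 2.
  by eexists; last reflexivity; rewrite divr_gt0 ?expR_gt0.
have [n0 n00 n0E] : exists2 n0 : R, 0 < n0 & n0 = cn * 2^-1 ^+ 2 * (1 - 2^-1).
  by eexists; last reflexivity; rewrite !mulr_gt0 ?exprn_gt0//; lra.
have [cL cL0 cLE] : exists2 cL : R, 0 < cL & cL = expR (- 4) * cm.
  by eexists; last reflexivity; rewrite mulr_gt0 ?expR_gt0.
have [e e0 eE] : exists2 e : R, 0 < e & e = 1 - p^-1.
  by eexists; last reflexivity; rewrite subr_gt0 invf_lt1.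
pose D := C / (S * c5 * n0 `^ q^-1).
suff H M : 0 < M -> (cL * M) `^ e <= D.
  have D0 : 0 <= D by apply: le_trans (H 1 ltr01); exact: powR_ge0.
  have M0 : 0 < (D `^ e^-1 + 1) / cL by rewrite divr_gt0// ltr_pwDr// powR_ge0.
  have := H _ M0; rewrite mulrCA divff ?lt0r_neq0// mulr1 => h.
  have : ((D `^ e^-1 + 1) `^ e) `^ e^-1 <= D `^ e^-1.
    by apply: ge0_ler_powR; rewrite ?nnegrE ?powR_ge0// invr_ge0 ltW.
  rewrite -powRrM divff ?lt0r_neq0// powRr1; last by rewrite addr_ge0 ?powR_ge0.
  by lra.
(* chosen so that the integral of 1 / t over [2 d, 1 / 2] is M *)
move=> M0; pose d := expR (- M) / 4.
have d0 : 0 < d by rewrite divr_gt0 ?expR_gt0.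
have d1 : d < 4^-1 by rewrite /d ltr_pdivrMr// mulVf// -expR0 ltr_expR; lra.
pose F := cutoff d 1 a 0.
have F0 t : 0 <= F t by exact: cutoff_ge0.
have Fle t : F t <= t `^ (- a).
  by apply: le_trans (cutoff_le _ _ _ _ _) _; rewrite mul0r oppr0 expR0 mulr1.
have Fge t : 2 * d <= t <= 1 / 2 -> expR (- 4) * t `^ (- a) <= F t.
  by move=> /(@cutoff_ge R d 1 a 0 t d0 ltr01); rewrite mul0r oppr0 expR0 mulr1.
pose G t := t `^ (- kappa) * F t * jacobi_m alpha beta t.
have G0 t : 0 <= G t.
  exact: mulr_ge0 (mulr_ge0 (powR_ge0 _ _) (F0 t)) (jacobi_m_ge0 _ _ _).
have Gint : lebesgue_measure.-integrable `[d, 1] (EFin \o G).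
  apply: integrable_drv => t /andP[dt _]; have t0 : 0 < t by lra.
  have [dm Dm] := jacobi_m_drv alpha beta t0.
  have dF : derivable F t 1 by exact: (@smooth_cutoff R d 1 a 0 d0 ltr01 0 t I).
  eexists; exact: (drvM (drvM (drv_powR _ t0) (derivableP dF)) Dm).
pose IG := (\int[lebesgue_measure]_(t in `[d, 1%R]) (G t)%:E)%E.
have IGf : IG \is a fin_num by exact: integrable_fin_num Gint.
pose X := fine IG; have XE : X%:E = IG by rewrite fineK.
have Xge : cL * M <= X.
  rewrite -lee_fin XE.
  have -> : cL * M = cL * (ln 2^-1 - ln (2 * d)).
    congr (_ * _).
    have -> : 2 * d = 2^-1 * expR (- M) by rewrite /d; field.
    by rewrite lnM ?posrE ?expR_gt0// expRK; ring.
  rewrite -integral_cinv; [|clear - d0; lra|clear - d1; lra].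
  apply: ge0_integral_mono => [t /=|t /=|t _]; rewrite ?in_itv/= ?lee_fin//.
    by move=> /andP[t1 t2]; clear - d0 t1 t2; lra.
  move=> tt; have t0 : 0 < t by clear - d0 tt; lra.
  have t01 : 0 < t <= 1 by rewrite t0; case/andP: tt => _; lra.
  rewrite divr_ge0 ?(ltW cL0) ?(ltW t0)//=.
  have /andP[m1 _] := hm t t01.
  apply: le_trans (_ : t `^ (- kappa) * (expR (- 4) * t `^ (- a)) * (cm * t `^ A) <= _); last first.
    apply: ler_pM => //; rewrite ?mulr_ge0 ?powR_ge0 ?expR_ge0 ?(ltW cm0)//.
    by rewrite ler_wpM2l ?powR_ge0// Fge// div1r.
  have -> : t `^ (- kappa) * (expR (- 4) * t `^ (- a)) * (cm * t `^ A) =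
     cL * (t `^ (- kappa) * t `^ (- a) * t `^ A) by rewrite cLE; ring.
  rewrite ler_wpM2l ?(ltW cL0)// -!powRDp// -powR_inv1 ?(ltW t0)//.
  by apply: ger_powR => //; lra.
have X0 : 0 < X by apply: lt_le_trans Xge; rewrite mulr_gt0.
have key : ((S * c5 * X) `^ q * n0) `^ q^-1 <= C * X `^ p^-1.
  apply: (HC d 1 a 0) => //; first exact: ltW.
  - by rewrite mulr_ge0 ?powR_ge0// ltW.
  - rewrite (@integral_support R d 1)//; last first.
      move=> t tuv; rewrite cutoff_eq0//; last by apply: contra tuv => /andP[/ltW -> /ltW ->].
      by rewrite powR0 ?mul0r//; apply: lt0r_neq0; clear - p0; lra.
    rewrite XE; apply: ge0_integral_mono => [//|t /=|t _]; rewrite ?lee_fin// in_itv/= => tu.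
    have t0 : 0 < t by clear - d0 tu; lra.
    rewrite mulr_ge0 ?powR_ge0 ?jacobi_m_ge0//=.
    rewrite /G ler_wpM2r ?jacobi_m_ge0// -/F.
    have [-> |Fn] := eqVneq (F t) 0.
      by rewrite powR0 ?mulr0//; apply: lt0r_neq0; clear - p0; lra.
    have Fp : 0 < F t by rewrite lt0r Fn F0.
    have -> : F t `^ p = F t `^ (p - 1) * F t.
      by rewrite -{3}(@powRr1 R (F t))// -powRDp// subrK.
    rewrite ler_wpM2r//.
    have -> : t `^ (- kappa) = (t `^ (- a)) `^ (p - 1) by rewrite -powRrM mulNr ap.
    by apply: ge0_ler_powR; rewrite ?nnegrE ?powR_ge0 ?(ltW pp).
  rewrite n0E mulrA -integral_cst_itv; last by clear; lra.
  apply: ge0_integral_mono => [l /=|l /=|l _].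
  - by rewrite !in_itv/= andbT => /andP[ll _]; apply: lt_le_trans ll; clear; lra.
  - rewrite in_itv/= => hl; have l0 : 0 < l by clear - hl; lra.
    rewrite !lee_fin !mulr_ge0 ?powR_ge0 ?(ltW cn0)//=; try (clear; lra).
    have l01 : 0 < l <= 1 by rewrite l0; case/andP: hl.
    apply: ler_pM; [exact: powR_ge0|by rewrite mulr_ge0 ?sqr_ge0// ltW| |]; last first.
      apply: le_trans (hn l l01); rewrite ler_wpM2l ?(ltW cn0)//.
      by rewrite lerXn2r ?nnegrE//; clear - hl; lra.
    apply: ge0_ler_powR => //; rewrite ?nnegrE ?normc_ge0 ?(ltW q0)//.
      by rewrite !mulr_ge0// ltW.
    apply: le_trans (_ : (l ^+ 2 + zeta ^+ 2) `^ (- (sigma / 2)) * (c5 * X) <= _).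
      rewrite -mulrA ler_wpM2r ?mulr_ge0 ?(ltW c50) ?(ltW X0)//.
      have z2 := sqr_ge0 zeta.
      have k0 : 0 < k by lra.
      have := @powR_ge_near R k 1 (l ^+ 2 + zeta ^+ 2) (- (sigma / 2)) k1 ltr01.
      rewrite (_ : 1 `^ (- (sigma / 2)) = 1) ?powR1// !mulr1 SE; apply; rewrite /k div1r; apply/andP; split; last by nra.
      apply: le_trans (_ : 4^-1 <= _); last by nra.
      by rewrite lef_pV2 ?posrE//; lra.
    apply: (@transform_ge R alpha beta zeta kappa sigma d 1 a 0 l d 1 _ (fun t => c5 * G t)) => //.
    + by rewrite mulr1; case/andP: hl.
    + move=> t /andP[dt t1]; have t0 : 0 < t by lra.
      rewrite mulr_ge0 ?(ltW c50)//=.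
      have e1 : c5 <= expR (- (r * t)) * (1 + r * t) / 2.
        rewrite c5E ler_wpM2r// -[leLHS]mulr1; apply: ler_pM; rewrite ?expR_ge0//.
          by rewrite ler_expR lerN2 -[leRHS]mulr1 ler_wpM2l ?(ltW r0).
        by rewrite lerDl mulr_ge0// ltW.
      rewrite /G [leLHS]mulrA; apply: ler_wpM2r; first exact: jacobi_m_ge0.
      rewrite [leLHS]mulrC; apply: ler_wpM2l; last exact: e1.
      exact: mulr_ge0 (powR_ge0 _ _) (F0 t).
    + under eq_integral do rewrite EFinM.
      by rewrite (@integralZl _ _ _ lebesgue_measure _ _ _ Gint)//= EFinM XE.
  - by rewrite lee_fin mulr_ge0 ?powR_ge0 ?jacobi_n_ge0.
have Xp : 0 < X `^ p^-1 by exact: powR_gt0.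
have XD : X = X `^ e * X `^ p^-1 by rewrite -powRDp// eE subrK powRr1// ltW.
apply: (@le_trans _ _ (X `^ e)).
  by apply: ge0_ler_powR; rewrite ?nnegrE ?mulr_ge0 ?(ltW e0) ?(ltW cL0) ?(ltW M0) ?(ltW X0).
rewrite /D ler_pdivlMr ?mulr_gt0 ?powR_gt0//.
rewrite -(ler_pM2r Xp); apply: le_trans key.
rewrite powR_norm_mul ?(ltW n00)//; last by rewrite !mulr_ge0// ltW.
have -> : X `^ e * (S * c5 * n0 `^ q^-1) * X `^ p^-1 =
  S * c5 * (X `^ e * X `^ p^-1) * n0 `^ q^-1 by ring.
by rewrite -XD.
Qed.

(** For frequencies of size 1 / T, the multiplier is of size T^sigma if zeta = 0
    and comparable to zeta^(- sigma) otherwise. *)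
Lemma multiplier_low (R : realType) (zeta sigma : R) :
  exists2 S : R, 0 < S & forall T l, 1 <= T -> (16 * T)^-1 <= l <= (8 * T)^-1 ->
     S * T `^ (if zeta == 0 then sigma else 0) <= (l ^+ 2 + zeta ^+ 2) `^ (- (sigma / 2)).
Proof.
have [-> |z0] := eqVneq zeta 0.
  exists (16 `^ (- `|- sigma|)) => [|T l T1 /andP[l1 l2]]; first exact: powR_gt0.
  have T0 : 0 < T by lra.
  have Ti : 0 < T^-1 by rewrite invr_gt0.
  have l0 : 0 < l by apply: lt_le_trans l1; rewrite invr_gt0; lra.
  have -> : (l ^+ 2 + 0 ^+ 2) `^ (- (sigma / 2)) = l `^ (- sigma).
    rewrite expr0n/= addr0 -powR_mulrn ?(ltW l0)// -powRrM; congr (_ `^ _).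
    by field.
  have -> : T `^ sigma = T^-1 `^ (- sigma).
    by rewrite -powR_inv1 ?(ltW T0)// -powRrM mulN1r opprK.
  apply: powR_ge_near => //; first lra.
  apply/andP; split; first by rewrite mulrC -invfM.
  by apply: (le_trans l2); rewrite invfM ler_wpM2r ?(ltW Ti)//; lra.
have zz : 0 < zeta ^+ 2 by rewrite exprn_even_gt0.
pose k := 1 + (zeta ^+ 2)^-1; have k1 : 1 <= k by rewrite lerDl invr_ge0 ltW.
exists (k `^ (- `|- (sigma / 2)|) * (zeta ^+ 2) `^ (- (sigma / 2))) => [|T l T1 /andP[l1 l2]].
  by rewrite mulr_gt0 ?powR_gt0//; lra.
have l0 : 0 < l by apply: lt_le_trans l1; rewrite invr_gt0; lra.
have l11 : l <= 1 by apply: (le_trans l2); rewrite invf_le1; lra.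
rewrite powRr0 mulr1; apply: powR_ge_near => //.
have l20 := sqr_ge0 l.
apply/andP; split; last by rewrite /k mulrDl mul1r mulVf ?lt0r_neq0//; nra.
apply: le_trans (_ : zeta ^+ 2 <= _); last lra.
by rewrite ler_pdivrMr; [rewrite ler_peMr// ltW|lra].
Qed.

(** Compared with the bound const T^(1 / p), the exponential growth excludes
    p > 2; for p = 2 it is absent and the powers of T are compared. *)
Lemma low_frequency_cond (R : realType) (alpha beta zeta p q kappa sigma C : R) :
  beta <= alpha -> - 2^-1 <= beta -> - 2^-1 < alpha -> 1 < q -> 2 <= p ->
  real_bound alpha beta zeta p q kappa sigma C ->
  p = 2 /\ (if zeta == 0 then sigma else 0) - kappa + 2 - 3 / q <= 2^-1.
Proof.
move=> hab hb ha q1 p2 HC.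
have [S S0 hS] := multiplier_low zeta sigma.
have [K [C' [K0 H]]] := low_frequency_growth hab hb ha q1 p2 HC S0 hS.
move: H; set e := _ + 2 - 3 / q => H.
have r0 : 0 < rho alpha beta by rewrite /rho; lra.
have pE : p = 2.
  have := @exp_growth R K C' (e - p^-1) (rho alpha beta * (1 - 2 / p)) K0.
  rewrite pmulr_rle0// => h; have {}h : 1 - 2 / p <= 0.
    apply: h => T T1; have T0 : 0 < T by lra.
    have Tp : 0 < T `^ p^-1 by exact: powR_gt0.
    rewrite -(ler_pM2r Tp); apply: le_trans (H T T1).
    have -> : T `^ e = T `^ (e - p^-1) * T `^ p^-1 by rewrite -powRDp// subrK.
    by rewrite le_eqVlt; apply/orP; left; apply/eqP; ring.
  have p0 : 0 < p by lra.
  by move: h; rewrite subr_le0 ler_pdivlMr// mul1r; lra.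
split=> //; apply: (powR_growth K0) => T T1.
by have := H T T1; rewrite pE divff// subrr mulr0 mul0r expR0 mulr1; exact.
Qed.

Theorem theorem4p5 (R : realType) (alpha beta zeta p q kappa sigma : R)
    (hab : beta <= alpha) (hb : - 2^-1 <= beta) (ha : - 2^-1 < alpha)
    (hzeta : 0 <= zeta) (hp : 1 < p) (hq : 1 < q)
    (hbound : exists C : R, forall f : R -> R[i], test_function f ->
       (weighted_Lnorm q (jacobi_n alpha beta)
          (jacobi_transform alpha beta zeta kappa sigma f)
        <= C%:E * weighted_Lnorm p (jacobi_m alpha beta) f)%E) :
  let p' := p / (p - 1) in
  let condN := 2 * (alpha + 1) * (p^-1 + q^-1 - 1) <= sigma - kappa in
  p <= 2 /\
  (* (1) *)
  (zeta != 0 -> kappa * p' < 2 * (alpha + 1) /\ condN) /\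
  (* (2) *)
  (zeta != 0 -> p = 2 ->
     [/\ kappa < alpha + 1, condN & 3 * (2^-1 - q^-1) <= kappa] /\
     (q = 2 -> 0 <= kappa < alpha + 1 /\ kappa <= sigma)) /\
  (* (3) *)
  (zeta = 0 ->
     [/\ kappa * p' < 2 * (alpha + 1), sigma * q < 3 & condN]) /\
  (* (4) *)
  (zeta = 0 -> p = 2 ->
     [/\ kappa < alpha + 1, condN, sigma * q < 3 &
         sigma - kappa <= 3 * (q^-1 - 2^-1)] /\
     (q = 2 -> kappa = sigma /\
               sigma < Num.min (2 * (alpha + 1)) 3 / 2)).
Proof.
move=> p' condN; have [C HC] := bound_real hp hq hbound.
have B : kappa * p' < 2 * (alpha + 1) := origin_cond hab hb ha hp hq HC.
have N : condN := high_frequency_cond hab hb ha hp hq HC.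
have D : zeta = 0 -> sigma * q < 3.
  by move=> z0; move: HC; rewrite z0 => /(zero_frequency_cond hab hb ha hp hq).
have B2 : p = 2 -> kappa < alpha + 1.
  move=> p2; move: B; rewrite /p' p2 (_ : 2 / (2 - 1) = 2 :> R); first lra.
  by field.
have L : 2 <= p -> p = 2 /\ (if zeta == 0 then sigma else 0) - kappa + 2 - 3 / q <= 2^-1.
  by move=> p2; exact: low_frequency_cond hab hb ha hq p2 HC.
have N2 : p = 2 -> q = 2 -> kappa <= sigma.
  move=> p2 q2; have := N; rewrite /condN p2 q2.
  by rewrite (_ : 2^-1 + 2^-1 - 1 = 0 :> R) ?mulr0; lra.
split; first by case: (leP p 2) => // p2; have [] := L (ltW p2); lra.
split; first by [].
split.
  move=> z0 p2; have [_] := L ltac:(lra); rewrite (negPf z0) => E.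
  split=> [|q2]; first by split=> //; [exact: B2|lra].
  split; last exact: N2.
  rewrite (B2 p2) andbT; move: E; rewrite q2; lra.
split; first by move=> z0; split=> //; exact: D.
move=> z0 p2; have [_] := L ltac:(lra); rewrite z0 eqxx => F.
split=> [|q2]; first by split=> //; [exact: B2|exact: D|lra].
have kE : kappa = sigma.
  by apply/eqP; rewrite eq_le N2//=; move: F; rewrite q2; lra.
split=> //; have h1 := B2 p2; have := D z0; rewrite q2 => h2.
rewrite ltr_pdivlMr// lt_min; apply/andP; split=> //.
by rewrite -kE; lra.
Qed.
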